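(* Let $X$ be a space of finite category $\mathrm{cat}(X)$, and let $n$ be an integer with $n\ge \log_2(\mathrm{cat}(X))$. If $f_1,\dots,f_n\in Z_\Sigma(X)$, then $f_1\circ\cdots\circ f_n=0$. Thus $t_\Sigma(X)\le \lceil \log_2(\mathrm{cat}(X))\rceil$, where $\lceil x\rceil$ is the least integer greater than or equal to $x$.
   Context: All spaces are based, connected and have the based homotopy type of CW complexes; maps and homotopies preserve base points; $[X,Y]$ is the set of based homotopy classes of maps and $0$ is the class of the constant map. $\mathrm{cat}(X)$ is the unreduced Lusternik–Schnirelmann category: the least $k$ such that $X$ is covered by $k$ open sets each contractible in $X$ (so a contractible space has category $1$, and $\mathrm{cat}(X)\le 2$ iff $X$ is a co-H-space). $\Sigma$ denotes the collection of all suspensions $\Sigma A$ of based spaces $A$ (here $A$ need not be connected, so that $S^1$ is included). $Z_\Sigma(X)$ is the set of $f\in[X,X]$ such that $f_*:[\Sigma A,X]\to[\Sigma A,X]$ is the constant map to $0$ for every $A$; it is a semigroup with zero element $0$ under composition. A semigroup $S$ with zero is nilpotent if there is an integer $n$ such that $x_1\cdots x_n=0$ for all $x_1,\dots,x_n\in S$; the least such $n$ is its nilpotency ($\infty$ if none exists). $t_\Sigma(X)$ is $0$ if $X$ is contractible, and otherwise is the nilpotency of $Z_\Sigma(X)$. *)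

(* Defs.v *)
From HB Require Import structures.
From mathcomp Require Import all_boot all_order all_algebra generic_quotient.
From mathcomp Require Import all_classical all_reals all_analysis.

Set Implicit Arguments.
Unset Strict Implicit.
Unset Printing Implicit Defensive.

Import Order.TTheory GRing.Theory Num.Theory.
Import numFieldNormedType.Exports.

Local Open Scope classical_set_scope.
Local Open Scope ring_scope.
Local Open Scope quotient_scope.

(** Based spaces are [ptopologicalType]s, with base point [point]. *)

HB.mixin Record isBased (X Y : ptopologicalType) (f : X -> Y) := {
  map_point : f point = point
}.

#[short(type="basedMap")]
HB.structure Definition BasedMap (X Y : ptopologicalType) :=
  {f of isContinuous X Y f & isBased X Y f}.

HB.instance Definition _ (X Y : ptopologicalType) := gen_eqMixin (basedMap X Y).
HB.instance Definition _ (X Y : ptopologicalType) :=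
  gen_choiceMixin (basedMap X Y).

HB.instance Definition _ (X : ptopologicalType) :=
  isBased.Build X X idfun erefl.

HB.instance Definition _ (X Y : ptopologicalType) :=
  isBased.Build X Y (cst point) erefl.

Lemma comp_map_point (X Y Z : ptopologicalType) (f : basedMap X Y)
  (g : basedMap Y Z) : (g \o f) point = point.
Proof. by rewrite /= !map_point. Qed.

HB.instance Definition _ (X Y Z : ptopologicalType) (f : basedMap X Y)
  (g : basedMap Y Z) := isBased.Build X Z (g \o f) (comp_map_point f g).

Section based_maps.
Variables X Y Z : ptopologicalType.

Definition bid : basedMap X X := idfun.
Definition bcst : basedMap X Y := cst point.
Definition bcomp (g : basedMap Y Z) (f : basedMap X Y) : basedMap X Z := g \o f.

End based_maps.

Definition unitI (R : realType) : set R := [set t | 0 <= t <= 1].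
Arguments unitI : clear implicits.

Section unit_interval.
Variable R : realType.

Lemma unitI0 : (0 : R) \in unitI R.
Proof. by rewrite inE /unitI /= lexx ler01. Qed.

Lemma unitI1 : (1 : R) \in unitI R.
Proof. by rewrite inE /unitI /= lexx ler01. Qed.

Definition I0 : unitI R := SigSub unitI0.
Definition I1 : unitI R := SigSub unitI1.

End unit_interval.
Arguments I0 {R}.
Arguments I1 {R}.

Definition homotopic (R : realType) (X Y : ptopologicalType)
    (f g : basedMap X Y) : Prop :=
  exists H : X * unitI R -> Y,
    [/\ continuous H,
        forall x, H (x, I0) = f x,
        forall x, H (x, I1) = g x &
        forall t, H (point, t) = point].

Lemma pair_continuous (X Y Z : topologicalType) (f : X -> Y) (g : X -> Z) :
  continuous f -> continuous g -> continuous (fun x => (f x, g x)).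
Proof. by move=> cf cg x; apply: cvg_pair; [exact: cf | exact: cg]. Qed.

Section homotopic_equivalence.
Variable R : realType.
Local Notation I := (set_type (unitI R)).

Let clamp_subproof (t : R) : Num.min 1 (Num.max 0 t) \in unitI R.
Proof.
rewrite inE /unitI /=; apply/andP; split.
  by rewrite le_min ler01 /= le_max lexx.
by rewrite ge_min lexx.
Qed.

Let clamp (t : R) : I := SigSub (clamp_subproof t).

Let clampE (t : R) (u : I) : t = val u -> clamp t = u.
Proof.
case: u => u /= pu ->; apply: val_inj => /=.
have /andP[u0 u1] : 0 <= u <= 1 by move: pu; rewrite inE.
by rewrite (max_idPr u0) (min_idPr u1).
Qed.

Let clamp_continuous : continuous clamp.
Proof.
apply: continuous_comp_initial => t.
apply: (@continuous_min R R^o (cst 1) (fun t => Num.max 0 t)).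
  exact: cvg_cst.
apply: (@continuous_max R R^o (cst 0) id); first exact: cvg_cst.
exact: cvg_id.
Qed.

Let reparam (X : topologicalType) (h : R -> R) (p : X * I) : X * I :=
  (p.1, clamp (h (val p.2))).

Let reparam_continuous (X : topologicalType) (h : R -> R) :
  continuous h -> continuous (@reparam X h).
Proof.
move=> ch; apply: pair_continuous; first by move=> p; exact: cvg_fst.
move=> p; apply: (@continuous_comp _ R I (fun p : X * I => h (val p.2)) clamp);
  last exact: clamp_continuous.
apply: (@continuous_comp _ R R (fun p : X * I => val p.2) h); last exact: ch.
apply: (@continuous_comp _ I R snd (fun u : I => val u)); first exact: cvg_snd.
exact: initial_continuous.
Qed.

Variables X Y : ptopologicalType.

Lemma eqfun_homotopic (f g : basedMap X Y) : f =1 g -> homotopic R f g.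
Proof.
move=> fg; exists (f \o fst); split => //=; last by move=> _; exact: map_point.
by move=> p; apply: continuous_comp; [exact: cvg_fst | exact: cts_fun].
Qed.

Lemma homotopic_refl (f : basedMap X Y) : homotopic R f f.
Proof. exact: eqfun_homotopic. Qed.

Lemma homotopic_sym (f g : basedMap X Y) : homotopic R f g -> homotopic R g f.
Proof.
move=> [H [cH H0 H1 Hp]].
exists (H \o reparam (fun t => 1 - t)); split.
- move=> p; apply: continuous_comp; last exact: cH.
  apply: reparam_continuous => t.
  by apply: cvgB; [exact: cvg_cst | exact: cvg_id].
- by move=> x; rewrite /reparam /= (clampE (u := I1)) ?H1//= subr0.
- by move=> x; rewrite /reparam /= (clampE (u := I0)) ?H0//= subrr.
- by move=> t; rewrite /reparam /= Hp.
Qed.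

Lemma homotopic_trans (f g h : basedMap X Y) :
  homotopic R f g -> homotopic R g h -> homotopic R f h.
Proof.
move=> [H [cH H0 H1 Hp]] [K [cK K0 K1 Kp]].
pose H' := H \o reparam (fun t => 2 * t).
pose K' := K \o reparam (fun t => 2 * t - 1).
have cH' : continuous H'.
  move=> p; apply: continuous_comp; last exact: cH.
  apply: reparam_continuous => t.
  by apply: cvgM; [exact: cvg_cst | exact: cvg_id].
have cK' : continuous K'.
  move=> p; apply: continuous_comp; last exact: cK.
  apply: reparam_continuous => t.
  apply: cvgB; last exact: cvg_cst.
  by apply: cvgM; [exact: cvg_cst | exact: cvg_id].
pose G (p : X * I) := if val p.2 <= 2^-1 then H' p else K' p.
have cv : continuous (fun p : X * I => val p.2 : R).
  move=> p.
  apply: (@continuous_comp _ I R snd (fun u : I => val u)).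
    exact: cvg_snd.
  exact: initial_continuous.
have half : 2 * 2^-1 = 1 :> R by rewrite mulfV// pnatr_eq0.
have half_gt0 : 0 < 2^-1 :> R by rewrite invr_gt0 ltr0n.
pose A := [set p : X * I | val p.2 <= 2^-1].
pose B := [set p : X * I | 2^-1 <= val p.2].
have clA : closed A.
  rewrite (_ : A = (fun p : X * I => val p.2 : R) @^-1` [set t | t <= 2^-1])//.
  by apply: preimage_closed; [move=> p _; exact: cv | exact: closed_le].
have clB : closed B.
  rewrite (_ : B = (fun p : X * I => val p.2 : R) @^-1` [set t | 2^-1 <= t])//.
  by apply: preimage_closed; [move=> p _; exact: cv | exact: closed_ge].
have cGA : {within A, continuous G}.
  apply: (@subspace_eq_continuous _ A _ H'); last exact: continuous_subspaceT.
  by move=> p /set_mem; rewrite /from_subspace /G /A /= => ->.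

have cGB : {within B, continuous G}.
  apply: (@subspace_eq_continuous _ B _ K'); last exact: continuous_subspaceT.
  move=> p /set_mem le_p; rewrite /from_subspace /G; case: ifPn => // ge_p.
  have {le_p ge_p} E : val p.2 = 2^-1 by apply/le_anti/andP.
  rewrite /H' /K' /reparam /= E half.
  rewrite (clampE (u := I0)) ?subrr// (clampE (u := I1))//.
  by rewrite H1 K0.
exists G; split.
- apply/continuous_subspace_setT.
  suff <- : A `|` B = [set: X * I] by exact: withinU_continuous.
  by apply/seteqP; split => // p _; apply/orP; exact: le_total.
- move=> x; rewrite /G /= ltW//.
  by rewrite /H' /reparam /= (clampE (u := I0)) ?H0//= mulr0.
- move=> x; rewrite /G /= leNgt.
  rewrite invf_lt1 ?ltr0n// ltr1n /=.
  by rewrite /K' /reparam /= (clampE (u := I1)) ?K1//= mulr1 (addrK 1 1).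
- by move=> t; rewrite /G; case: ifP => _; rewrite /H' /K' /reparam /= ?Hp ?Kp.
Qed.

End homotopic_equivalence.

Section homotopy_classes.
Variable R : realType.

Section def.
Variables X Y : ptopologicalType.

Definition homotopic_rel : rel (basedMap X Y) := fun f g => `[< homotopic R f g >].

Lemma homotopic_rel_refl : reflexive homotopic_rel.
Proof. by move=> f; apply/asboolP; exact: homotopic_refl. Qed.

Lemma homotopic_rel_sym : symmetric homotopic_rel.
Proof. by move=> f g; apply/asboolP/asboolP; exact: homotopic_sym. Qed.

Lemma homotopic_rel_trans : transitive homotopic_rel.
Proof.
by move=> g f h /asboolP fg /asboolP gh; apply/asboolP; exact: homotopic_trans fg gh.
Qed.

Canonical homotopic_equiv :=
  EquivRel homotopic_rel homotopic_rel_refl homotopic_rel_sym homotopic_rel_trans.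

(** [hclass X Y] is the set [X, Y]. *)
Definition hclass := {eq_quot homotopic_equiv}.

HB.instance Definition _ := Choice.on hclass.
HB.instance Definition _ := EqQuotient.on hclass.

Definition hpi (f : basedMap X Y) : hclass := \pi_hclass f.

Definition hzero : hclass := hpi (bcst X Y).

Lemma hpiP (f g : basedMap X Y) : hpi f = hpi g <-> homotopic R f g.
Proof.
split; first by move=> /eqmodP /asboolP.
by move=> fg; apply/eqmodP/asboolP.
Qed.

Lemma hpi_repr (a : hclass) : hpi (repr a) = a.
Proof. exact: reprK. Qed.

End def.

Definition hid (X : ptopologicalType) : hclass X X := hpi (bid X).

Definition hcomp (X Y Z : ptopologicalType) (b : hclass Y Z) (a : hclass X Y) :
  hclass X Z := hpi (bcomp (repr b) (repr a)).

Lemma hcompE (X Y Z : ptopologicalType) (g : basedMap Y Z) (f : basedMap X Y) :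
  hcomp (hpi g) (hpi f) = hpi (bcomp g f).
Proof.
have /hpiP[H [cH H0 H1 Hp]] : hpi (repr (hpi f)) = hpi f by exact: hpi_repr.
have /hpiP[K [cK K0 K1 Kp]] : hpi (repr (hpi g)) = hpi g by exact: hpi_repr.
apply/hpiP; exists (fun p => K (H p, p.2)); split.
- move=> p; apply: (@continuous_comp _ _ _ (fun p => (H p, p.2)) K).
    by apply: pair_continuous; [exact: cH | move=> q; exact: cvg_snd].
  exact: cK.
- by move=> x; rewrite K0 H0.
- by move=> x; rewrite K1 H1.
- by move=> t; rewrite Hp Kp.
Qed.

Lemma hcompA (W X Y Z : ptopologicalType) (c : hclass Y Z) (b : hclass X Y)
  (a : hclass W X) : hcomp c (hcomp b a) = hcomp (hcomp c b) a.
Proof.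
rewrite -(hpi_repr a) -(hpi_repr b) -(hpi_repr c) !hcompE.
by apply/hpiP; exact: eqfun_homotopic.
Qed.

Lemma hcomp1h (X Y : ptopologicalType) (a : hclass X Y) : hcomp (hid Y) a = a.
Proof.
rewrite -(hpi_repr a) hcompE.
by apply/hpiP; exact: eqfun_homotopic.
Qed.

Lemma hcomph1 (X Y : ptopologicalType) (a : hclass X Y) : hcomp a (hid X) = a.
Proof.
rewrite -(hpi_repr a) hcompE.
by apply/hpiP; exact: eqfun_homotopic.
Qed.

Lemma hcomp0h (X Y Z : ptopologicalType) (a : hclass X Y) :
  hcomp (hzero Y Z) a = hzero X Z.
Proof.
rewrite -(hpi_repr a) hcompE.
by apply/hpiP; exact: eqfun_homotopic.
Qed.

Lemma hcomph0 (X Y Z : ptopologicalType) (b : hclass Y Z) :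
  hcomp b (hzero X Y) = hzero X Z.
Proof.
rewrite -(hpi_repr b) hcompE.
by apply/hpiP; apply: eqfun_homotopic => x /=; exact: map_point.
Qed.

End homotopy_classes.
Arguments hclass : clear implicits.
Arguments hid : clear implicits.
Arguments hzero : clear implicits.

HB.instance Definition _ (R : realType) (X : ptopologicalType) :=
  Monoid.isLaw.Build (hclass R X X) (hid R X) (@hcomp R X X X)
    (@hcompA R X X X X) (@hcomp1h R X X) (@hcomph1 R X X).

Definition homotopy_equivalent (R : realType) (X Y : ptopologicalType) : Prop :=
  exists (f : hclass R X Y) (g : hclass R Y X),
    hcomp g f = hid R X /\ hcomp f g = hid R Y.

Definition contractible (R : realType) (X : ptopologicalType) : Prop :=
  hid R X = hzero R X X.

(** Euclidean balls are given by the sum of squares because the library norm on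
['rV[R]_n] is the sup norm; the topology on ['rV[R]_n] is the usual one. *)
Definition disc (R : realType) (n : nat) : set 'rV[R]_n :=
  [set v | \sum_(j < n) v 0 j ^+ 2 <= 1].
Arguments disc : clear implicits.

Definition disc_interior (R : realType) (n : nat) : set (disc R n) :=
  [set v | \sum_(j < n) (val v : 'rV[R]_n) 0 j ^+ 2 < 1].
Arguments disc_interior : clear implicits.

Definition disc_boundary (R : realType) (n : nat) : set (disc R n) :=
  [set v | \sum_(j < n) (val v : 'rV[R]_n) 0 j ^+ 2 = 1].
Arguments disc_boundary : clear implicits.

(** A CW structure on [K], presented by a characteristic map for each cell. *)
Record cw_structure (R : realType) (K : topologicalType) := CWStructure {
  cell : Type;
  cell_dim : cell -> nat;
  char_map : forall e : cell, disc R (cell_dim e) -> K;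
  open_cell := fun e : cell => @char_map e @` disc_interior R (cell_dim e);
  cw_hausdorff : hausdorff_space K;
  char_map_continuous : forall e, continuous (@char_map e);
  char_map_inj : forall e,
    {in disc_interior R (cell_dim e) &, injective (@char_map e)};
  open_cell_disjoint : trivIset [set: cell] open_cell;
  open_cell_cover : \bigcup_e open_cell e = [set: K];
  cw_closure_finite : forall e, exists F : set cell,
    [/\ finite_set F,
        forall e', F e' -> (cell_dim e' < cell_dim e)%N &
        @char_map e @` disc_boundary R (cell_dim e)
          `<=` \bigcup_(e' in F) open_cell e'];
  cw_weak_topology : forall C : set K,
    (forall e, closed (@char_map e @^-1` C)) -> closed C
}.

(** Requiring the base point to be a vertex loses nothing: any point of a CW
complex becomes a vertex after subdividing a cell. *)
Definition based_cw_complex (R : realType) (K : ptopologicalType) : Prop :=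
  exists (C : cw_structure R K) (e : cell C),
    cell_dim e = 0%N /\ open_cell e point.

Definition has_cw_type (R : realType) (X : ptopologicalType) : Prop :=
  exists2 K : ptopologicalType, based_cw_complex R K & homotopy_equivalent R X K.

(** [susp R A] is the reduced suspension: [A * [0, 1]] with both ends and the
line over the base point collapsed to a single point. *)
Section suspension.
Variables (R : realType) (A : ptopologicalType).

Definition susp_collapsed : set (A * unitI R) :=
  [set p | p.1 = point \/ p.2 = I0 \/ p.2 = I1].

Definition susp_rel : rel (A * unitI R) := fun p q =>
  `[< p = q \/ (susp_collapsed p /\ susp_collapsed q) >].

Lemma susp_rel_refl : reflexive susp_rel.
Proof. by move=> p; apply/asboolP; left. Qed.

Lemma susp_rel_sym : symmetric susp_rel.
Proof.
by move=> p q; apply/asboolP/asboolP => -[->|[? ?]]; [left|right|left|right].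
Qed.

Lemma susp_rel_trans : transitive susp_rel.
Proof.
move=> q p r /asboolP[->//|[cp cq]] /asboolP[<-|[_ cr]]; apply/asboolP.
  by right.
by right.
Qed.

Canonical susp_equiv :=
  EquivRel susp_rel susp_rel_refl susp_rel_sym susp_rel_trans.

Definition susp : Type := quotient_topology {eq_quot susp_equiv}.

HB.instance Definition _ := Topological.on susp.
HB.instance Definition _ :=
  isPointed.Build susp (\pi_(quotient_topology {eq_quot susp_equiv}) (point, I0)).

End suspension.
Arguments susp : clear implicits.

(** Valued in [\bar R] so that the least element of the empty set is [+oo]. *)
Definition least_nat (R : realType) (P : set nat) : \bar R :=
  ereal_inf [set n%:R%:E | n in P].

(** Here homotopies are free: [U] need not contain the base point. *)
Definition contractible_in (R : realType) (X : ptopologicalType) (U : set X) :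
    Prop :=
  exists (c : X) (H : U * unitI R -> X),
    [/\ continuous H,
        forall u, H (u, I0) = val u &
        forall u, H (u, I1) = c].

Definition categorical_cover (R : realType) (X : ptopologicalType) (k : nat) :
    Prop :=
  exists U : 'I_k -> set X,
    (forall i, open (U i) /\ contractible_in R (U i)) /\
    \bigcup_i U i = [set: X].

Definition lscat (R : realType) (X : ptopologicalType) : \bar R :=
  least_nat R [set k | categorical_cover R X k].

(** Nilpotency of the subset [S], closed under [op] and containing [z]. A
semigroup has no empty product, so products have [m.+1] factors; the bigop is
[x_0 (x_1 (... (x_(m-1) x_m)))]. *)
Definition nilpotency (R : realType) (T : Type) (op : T -> T -> T) (z : T)
    (S : set T) : \bar R :=
  least_nat R [set n | exists2 m : nat, n = m.+1 &
    forall x : nat -> T, (forall i, S (x i)) ->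
      \big[op/x m]_(i < m) x i = z].

(** [A] need not be connected, so that the circle is among the [susp R A]. *)
Definition Z_Sigma (R : realType) (X : ptopologicalType) : set (hclass R X X) :=
  [set f | forall A : ptopologicalType, has_cw_type R A ->
     forall a : hclass R (susp R A) X, hcomp f a = hzero R (susp R A) X].
Arguments Z_Sigma : clear implicits.

Lemma Z_Sigma0 (R : realType) (X : ptopologicalType) :
  Z_Sigma R X (hzero R X X).
Proof. by move=> A _ a; rewrite hcomp0h. Qed.

Lemma Z_Sigma_comp (R : realType) (X : ptopologicalType) (f g : hclass R X X) :
  Z_Sigma R X f -> Z_Sigma R X g -> Z_Sigma R X (hcomp f g).
Proof. by move=> _ Zg A cwA a; rewrite -hcompA Zg// hcomph0. Qed.

Definition t_Sigma (R : realType) (X : ptopologicalType) : \bar R :=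
  if `[< contractible R X >] then 0%E
  else nilpotency R (@hcomp R X X X) (hzero R X X) (Z_Sigma R X).

Definition log2 (R : realType) (x : R) : R := ln x / ln 2.

(* Main.v *)
From HB Require Import structures.
Require Import Defs.
From mathcomp Require Import all_boot all_order all_algebra generic_quotient finmap.
From mathcomp Require Import all_classical all_reals all_analysis.
From mathcomp Require Import ring lra.

Set Implicit Arguments.
Unset Strict Implicit.
Unset Printing Implicit Defensive.

Import Order.TTheory GRing.Theory Num.Theory.
Import numFieldNormedType.Exports.

Local Open Scope classical_set_scope.
Local Open Scope ring_scope.
Local Open Scope quotient_scope.

(** A class in [Z_Sigma] annihilates maps out of suspensions, and such maps arise
whenever a map is null homotopic on two pieces of a space: deforming the map to
the base point on the part of each piece away from the other leaves only the
middle, where it factors through the suspension of the intersection of the two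
pieces with a disjoint base point added. Hence if [g] is null on each of two
pieces and [f] is in [Z_Sigma], then [f \o g] is null on their union ([glue_null]).
Starting from the identity of [X], which is null on each member of a categorical
cover, every factor doubles the number of members that can be merged, so [n]
factors exhaust a cover with at most [2 ^ n] members ([null_on_labels]).

The argument needs pieces that are subcomplexes, and an intersection with the
homotopy type of a CW complex; the members of an open cover provide neither. They
are therefore replaced by a simplicial complex over the cover: a complex [L] with a
map [r] to [X] and a label on each vertex, such that [r] sends the open star of a
vertex into the member of the cover named by its label ([good]). The vertices
with labels in a given set span a subcomplex, and the points of [L] with total
weight 1 on both sides of a splitting of the vertices form a CW complex, whose
cells are products of two simplices ([midp_cw_type]).

A complex over the cover that is large enough is built from a CW complex [K] with
a map [g : K -> X]: there are a good complex [L] and a map [s] from [K] to [L] with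
[r \o s] homotopic to [g] ([realisation_ex]). It is constructed one dimension at a
time; over a new cell it is a mapping cylinder between a fine net of the disc,
which gives the new vertices, and the complex already present over the sphere
([attach_cell]). With [K] a CW complex homotopy equivalent to [X] and [g] the
equivalence, the composite of the [f_i] with [g] is homotopic to one that factors
through [L], where it is null, and [g] has a homotopy inverse ([composite_null]).

Complexes are given no topology. A point of a complex is a function on the
vertices, and continuity of a map on the complex means continuity of its
composites with all plots, that is, with all coordinatewise continuous families
of points that involve finitely many vertices. The same style is used on discs
and cells: a map is continuous when its composites with test maps are. *)

(** * Continuous real and vector valued functions *)

Section real_continuity.
Context {R : realType} {Z : topologicalType}.
Implicit Types f g : Z -> R.

Lemma contK (c : R) : continuous (fun _ : Z => c).
Proof. by move=> z; exact: cvg_cst. Qed.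

Lemma contD f g : continuous f -> continuous g -> continuous (fun z => f z + g z).
Proof. by move=> cf cg z; apply: cvgD; [exact: cf | exact: cg]. Qed.

Lemma contN f : continuous f -> continuous (fun z => - f z).
Proof. by move=> cf z; apply: cvgN; exact: cf. Qed.

Lemma contM f g : continuous f -> continuous g -> continuous (fun z => f z * g z).
Proof. by move=> cf cg z; apply: cvgM; [exact: cf | exact: cg]. Qed.

Lemma contV f : (forall z, f z != 0) -> continuous f -> continuous (fun z => (f z)^-1).
Proof. by move=> f0 cf z; apply: cvgV => //; exact: cf. Qed.

Lemma contmax f g : continuous f -> continuous g ->
  continuous (fun z => Num.max (f z) (g z)).
Proof. by move=> cf cg z; apply: (@continuous_max R Z); [exact: cf|exact: cg]. Qed.

Lemma contmin f g : continuous f -> continuous g ->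
  continuous (fun z => Num.min (f z) (g z)).
Proof. by move=> cf cg z; apply: (@continuous_min R Z); [exact: cf|exact: cg]. Qed.

Lemma contX f n : continuous f -> continuous (fun z => f z ^+ n).
Proof.
move=> cf; elim: n => [|n ih].
  by under eq_fun do rewrite expr0; exact: contK.
by under eq_fun do rewrite exprS; exact: contM.
Qed.

Lemma contsqrt f : continuous f -> continuous (fun z => Num.sqrt (f z)).
Proof.
move=> cf z; apply: (@continuous_comp _ _ _ f); first exact: cf.
exact: sqrt_continuous.
Qed.

Lemma contsum (I : Type) (r : seq I) (P : pred I) (F : I -> Z -> R) :
  (forall i, continuous (F i)) -> continuous (fun z => \sum_(i <- r | P i) F i z).
Proof.
move=> cF; elim: r => [|i r ih].
  by under eq_fun do rewrite big_nil; exact: contK.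
under eq_fun do rewrite big_cons.
by case: (P i) => //; apply: contD.
Qed.

Lemma rv_cont n (f : Z -> 'rV[R]_n) :
  (forall j, continuous (fun z => f z 0 j)) -> continuous f.
Proof.
move=> cf z A [P nP sPA].
apply: (filterS (P := \bigcap_(j in [set k | k \in [fset x in 'I_n]%fset])
  [set y | P 0 j (f y 0 j)])).
  by move=> y Py; apply: sPA => i j; rewrite ord1; apply: Py => /=; rewrite !inE.
by apply: filter_bigI => j _; exact: (cf j z (P 0 j) (nP 0 j)).
Qed.

Lemma cont_coord n (f : Z -> 'rV[R]_n) j : continuous f -> continuous (fun z => f z 0 j).
Proof.
by move=> cf z; apply: (@continuous_comp _ _ _ f (fun M : 'rV[R]_n => M 0 j));
  [exact: cf | exact: coord_continuous].
Qed.

End real_continuity.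

(** * Gluing *)

Section gluing.
Context {Z X : topologicalType}.

Lemma cont_comp {Y : topologicalType} (f : Z -> Y) (g : Y -> X) :
  continuous g -> continuous f -> continuous (fun z => g (f z)).
Proof. by move=> cg cf z; apply: continuous_comp; [exact: cf | exact: cg]. Qed.

Lemma closed_glue (I : choiceType) (D : set I) (A : I -> set Z) (f : Z -> X) :
  finite_set D -> (forall i, D i -> closed (A i)) ->
  (forall z, exists2 i, D i & A i z) ->
  (forall i, D i -> continuous (fun z : A i => f (val z))) -> continuous f.
Proof.
move=> fD clA cov cf; apply/continuous_closedP => C clC.
have -> : f @^-1` C = \bigcup_(i in D) (A i `&` f @^-1` C).
  apply/seteqP; split => [z /= Cz | z [i _ []//]].
  by have [i Di Az] := cov z; exists i.
apply: closed_bigcup => // i Di.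
have /continuous_closedP/(_ _ clC) := cf _ Di.
rewrite -openC => -[B oB BE].
have -> : A i `&` f @^-1` C = A i `&` ~` B.
  apply/seteqP; split => z [Az /= h]; split => //=.
    move=> Bz; have : (val @^-1` B) (SigSub (mem_set Az)) by [].
    by rewrite BE; apply.
  apply: contrapT => nC; apply: h.
  suff : (val @^-1` B) (SigSub (mem_set Az)) by [].
  by rewrite BE.
by apply: closedI; [exact: clA | exact: open_closedC].
Qed.

End gluing.

(** The two closed pieces are presented by test maps into [Z] rather than as
subspaces, so that all the data of a situation can be pulled back along the test
map; nested case distinctions then need no subspaces of subspaces. *)
Lemma glue_le {R : realType} {Z X : topologicalType} (c d : Z -> R) (f : Z -> X) :
  continuous c -> continuous d ->
  (forall (Y : topologicalType) (j : Y -> Z), continuous j ->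
    (forall y, c (j y) <= d (j y)) -> continuous (fun y => f (j y))) ->
  (forall (Y : topologicalType) (j : Y -> Z), continuous j ->
    (forall y, d (j y) <= c (j y)) -> continuous (fun y => f (j y))) ->
  continuous f.
Proof.
move=> cc cd h1 h2.
pose A (b : bool) := if b then [set z | c z - d z <= 0] else [set z | d z - c z <= 0].
apply: (@closed_glue _ _ bool setT A) => //.
- exact: finite_finset.
- move=> [] _; rewrite /A.
    have -> : [set z | c z - d z <= 0] = (fun z => c z - d z) @^-1` [set t | t <= 0] by [].
    by apply: preimage_closed; [move=> z _; exact: (contD cc (contN cd)) | exact: closed_le].
  have -> : [set z | d z - c z <= 0] = (fun z => d z - c z) @^-1` [set t | t <= 0] by [].
  by apply: preimage_closed; [move=> z _; exact: (contD cd (contN cc)) | exact: closed_le].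
- move=> z; have [h|h] := leP (c z) (d z); first by exists true; rewrite //= subr_le0.
  by exists false; rewrite //= subr_le0 ltW.
- move=> [] _.
    apply: h1; first exact: initial_continuous.
    by move=> [z zA]; have := set_mem zA; rewrite /A /= subr_le0.
  apply: h2; first exact: initial_continuous.
  by move=> [z zA]; have := set_mem zA; rewrite /A /= subr_le0.
Qed.

(** * Compactness and final topologies *)

Section compactness.

Lemma compact_set_type {T : topologicalType} (A : set T) :
  compact A -> compact [set: A].
Proof.
move=> cA; apply/compact_near_coveringP => I F P FF cov.
have cA' : near_covering_within A.
  by apply/near_covering_withinP; apply/compact_near_coveringP.
pose P' (i : I) (x : T) := forall Ax : x \in A, P i (SigSub Ax).
have : \near F, A `<=` P' F.
  apply: (cA' I F P' FF) => x Ax.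
  have [[B C] [/= nB FC] sBC] := cov (SigSub (mem_set Ax)) Logic.I.
  have [_ [[B' oB' <-] B'x] sB] := nB.
  exists (B', C); first by split => //=; exact: open_nbhs_nbhs.
  move=> [y i] [/= B'y Ci] Ay Ay'.
  by apply: (sBC (_, _)); split => //=; apply: sB.
apply: filterS => i h [x Ax] _; exact: (h x (set_mem Ax) Ax).
Qed.

(** The product with a compact regular space preserves final topologies. Given an
open [Q], choose a compact neighbourhood [Jc] of [s0] with [{t0} * Jc] sent into [Q];
the set of all [t] such that [{t} * Jc] is sent into [Q] is open, because its
preimage in each [D i] is open by the tube lemma. *)
Lemma final_prod_continuous {T Y X : topologicalType} {J : Type}
    {D : J -> topologicalType} (chi : forall i, D i -> T) (h : T * Y -> X) :
  compact [set: Y] -> regular_space Y ->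
  (forall C, (forall i, closed (chi i @^-1` C)) -> closed C) ->
  (forall t, exists i d, chi i d = t) ->
  (forall i, continuous (fun p : D i * Y => h (chi i p.1, p.2))) ->
  continuous h.
Proof.
move=> cY rY fin cov ch [t0 s0] O.
rewrite nbhsE => -[Q [oQ Q_h] sO].
apply: (filterS (P := h @^-1` Q)); first by move=> p /sO.
have [i [d0 di]] := cov t0.
have cs : continuous (fun s => h (t0, s)).
  rewrite -di => s; apply: (@continuous_comp _ _ _ (fun s => (d0, s))
    (fun p : D i * Y => h (chi i p.1, p.2))); last exact: ch.
  by apply: cvg_pair; [exact: cvg_cst | exact: cvg_id].
have /rY[B nB sB] : nbhs s0 [set s | Q (h (t0, s))].
  by apply: cs; exact: open_nbhs_nbhs.
pose Jc := closure B.
have cJ : compact Jc.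
  by apply: subclosed_compact cY _ => //; exact: closed_closure.
pose W := [set t | forall s, Jc s -> Q (h (t, s))].
have oW : open W.
  rewrite -closedC; apply: fin => k.
  change (closed (~` (chi k @^-1` W))); rewrite closedC openE => d Wd.
  have /compact_near_coveringP/(_ _ (nbhs d) (fun d s => Q (h (chi k d, s)))) := cJ.
  apply => s Js; have : Q (h (chi k d, s)) by exact: Wd.
  move=> Q_s.
  have [[B1 B2] [/= n1 n2] sB12] := ch k (d, s) Q (open_nbhs_nbhs (conj oQ Q_s)).
  exists (B2, B1); first by split.
  by move=> [s' d'] /= [B2s B1d]; apply: (sB12 (_, _)).
exists (W, Jc); last by move=> [t s] [/= Wt Js]; exact: Wt.
split => /=; last by apply: filterS nB; exact: subset_closure.
by apply: open_nbhs_nbhs; split => // s Js; exact: sB.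
Qed.

(** The preimage of a closed set under [u \o j] is a finite union of preimages under
[j] of images of compact sets, which are closed in the Hausdorff space [K]. This
turns continuity on finitely many closed cells into continuity along any map
into their union. *)
Lemma compact_cover_continuous {K Y Z : topologicalType} {I : choiceType}
    (D : set I) {T : I -> topologicalType} (chi : forall i, T i -> K)
    (u : K -> Y) (j : Z -> K) :
  hausdorff_space K -> finite_set D -> (forall i, compact [set: T i]) ->
  (forall i, continuous (chi i)) -> (forall i, D i -> continuous (fun x => u (chi i x))) ->
  continuous j -> (forall z, exists2 i, D i & range (chi i) (j z)) ->
  continuous (fun z => u (j z)).
Proof.
move=> hK fD cT cchi cu cj cov; apply/continuous_closedP => C clC.
have -> : (fun z => u (j z)) @^-1` C =
    \bigcup_(i in D) (j @^-1` (chi i @` ((fun x => u (chi i x)) @^-1` C))).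
  apply/seteqP; split => [z /= Cz|z [i Di [x /= Cx <-//]]].
  by have [i Di [x _ xE]] := cov z; exists i => //; exists x; rewrite //= xE.
apply: closed_bigcup => // i Di.
move/continuous_closedP: cj; apply.
apply: compact_closed => //; apply: continuous_compact.
  exact: continuous_subspaceT.
apply: (subclosed_compact _ (cT i)) => //.
by move/continuous_closedP: (cu i Di); apply.
Qed.

Lemma hausdorff_prod {T Y : topologicalType} :
  hausdorff_space T -> hausdorff_space Y -> hausdorff_space (T * Y)%type.
Proof.
move=> hT hY [a b] [c d] cl; congr pair.
  apply: hT => A B nA nB.
  have [||[x y] [/= [? _] [? _]]] := cl (A `*` setT) (B `*` setT).
  - by exists (A, setT) => //=; split => //; exact: filterT.
  - by exists (B, setT) => //=; split => //; exact: filterT.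
  - by exists x.
apply: hY => A B nA nB.
have [||[x y] [/= [_ ?] [_ ?]]] := cl (setT `*` A) (setT `*` B).
- by exists (setT, A) => //=; split => //; exact: filterT.
- by exists (setT, B) => //=; split => //; exact: filterT.
- by exists y.
Qed.

Lemma hausdorff_separate {T Y : topologicalType} (F : set (T -> Y)) :
  hausdorff_space Y -> (forall f, F f -> continuous f) ->
  (forall x y, (forall f, F f -> f x = f y) -> x = y) -> hausdorff_space T.
Proof.
move=> hY cF sep x y cl; apply: sep => f Ff; apply: hY => A B nA nB.
have [z [? ?]] := cl _ _ (cF f Ff x _ nA) (cF f Ff y _ nB).
by exists (f z).
Qed.

End compactness.

(** * Euclidean norm and discs *)

Section euclid.
Context {R : realType}.

(** The discs of a CW structure are Euclidean, whereas the norm of row vectors is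
the maximum of the coordinates. *)
Definition enorm n (x : 'rV[R]_n) : R := Num.sqrt (\sum_(j < n) x 0 j ^+ 2).

Lemma enorm_ge0 n (x : 'rV[R]_n) : 0 <= enorm x.
Proof. exact: sqrtr_ge0. Qed.

Lemma sumsq_ge0 n (x : 'rV[R]_n) : 0 <= \sum_(j < n) x 0 j ^+ 2.
Proof. by apply: sumr_ge0 => j _; exact: sqr_ge0. Qed.

Lemma enormZ n (c : R) (x : 'rV[R]_n) : 0 <= c -> enorm (c *: x) = c * enorm x.
Proof.
move=> c0; rewrite /enorm.
under eq_bigr do rewrite mxE exprMn.
by rewrite -mulr_sumr sqrtrM ?sqr_ge0// sqrtr_sqr ger0_norm.
Qed.

Lemma cont_enorm {Z : topologicalType} n (f : Z -> 'rV[R]_n) :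
  continuous f -> continuous (fun z => enorm (f z)).
Proof.
move=> cf; apply: contsqrt; apply: contsum => j; apply: contX; exact: cont_coord.
Qed.

Lemma enorm_le1 n (x : 'rV[R]_n) : (enorm x <= 1) = (\sum_(j < n) x 0 j ^+ 2 <= 1).
Proof. by rewrite /enorm -{1}(@sqrtr1 R) ler_sqrt// ler01. Qed.

Lemma enorm_eq1 n (x : 'rV[R]_n) : (enorm x = 1) <-> (\sum_(j < n) x 0 j ^+ 2 = 1).
Proof.
split=> [h|]; last by rewrite /enorm => ->; rewrite sqrtr1.
by rewrite -[LHS](sqr_sqrtr (sumsq_ge0 x)) -/(enorm x) h expr1n.
Qed.

Lemma enorm_lt1 n (x : 'rV[R]_n) : (enorm x < 1) = (\sum_(j < n) x 0 j ^+ 2 < 1).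
Proof. by rewrite /enorm -{1}(@sqrtr1 R) ltr_sqrt. Qed.

Lemma enorm_eq0 n (x : 'rV[R]_n) : enorm x = 0 -> x = 0.
Proof.
move=> /eqP; rewrite sqrtr_eq0 => h; apply/rowP => j; rewrite mxE.
have /eqP : \sum_(j < n) x 0 j ^+ 2 = 0 by apply/eqP; rewrite eq_le h sumsq_ge0.
rewrite psumr_eq0; last by move=> *; exact: sqr_ge0.
by move=> /allP/(_ j); rewrite mem_index_enum sqrf_eq0 => /(_ isT)/eqP.
Qed.

Lemma coord_le_enorm n (x : 'rV[R]_n) j : `|x 0 j| <= enorm x.
Proof.
rewrite -sqrtr_sqr /enorm ler_wsqrtr// (bigD1 j)//= lerDl.
by apply: sumr_ge0 => *; exact: sqr_ge0.
Qed.

Lemma compact_disc n : compact (disc R n).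
Proof.
apply: bounded_closed_compact.
  exists 1; split; first exact: num_real.
  move=> M M1 x; rewrite /disc /= -enorm_le1 => x1.
  change (mx_norm x <= M); rewrite mx_normrE.
  apply: bigmax_le; first exact: ltW (lt_trans ltr01 M1).
  move=> [i j] _ /=; rewrite (ord1 i).
  exact: le_trans (coord_le_enorm _ _) (le_trans x1 (ltW M1)).
rewrite (_ : disc R n = (fun x => enorm x) @^-1` [set t | t <= 1]).
  apply: preimage_closed; last exact: closed_le.
  by move=> x _; apply: cont_enorm; move=> y; exact: cvg_id.
by apply/seteqP; split => x; rewrite /disc /= enorm_le1.
Qed.

End euclid.

(** * Simplicial complexes and their plots *)

Section complexes.
Context {R : realType} {V : choiceType}.
Implicit Types (L : set (set V)) (y : V -> R) (P : set V).

Definition supp y : set V := [set v | y v != 0].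

(** Points are not normalised: this is the cone over the complex without its apex.
Weights can then be formed without dividing by their sum, and maps that are
constant on rays play the role of maps on the complex. *)
Definition in_cx L y := (forall v, 0 <= y v) /\ L (supp y).

(** Plots replace a topology on the complex. Finitely many vertices suffice for
every plot that is used, since these come from discs and their products. *)
Definition plot {Z : topologicalType} (p : Z -> V -> R) :=
  (forall v, continuous (fun z => p z v)) /\
  exists2 W, finite_set W & forall z, supp (p z) `<=` W.

Definition cx L := forall k, L k ->
  [/\ finite_set k, k !=set0 & forall k', k' `<=` k -> k' !=set0 -> L k'].

Lemma supp_pos L y v : in_cx L y -> supp y v -> 0 < y v.
Proof. by move=> [y0 _] yv; rewrite lt_def y0 andbT. Qed.

Lemma in_cx_ex L y : cx L -> in_cx L y -> exists v, 0 < y v.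
Proof. by move=> cL yL; have [_ [v /(supp_pos yL) ?] _] := cL _ yL.2; exists v. Qed.

Lemma in_cx_sub L y z : cx L -> in_cx L y -> (forall v, 0 <= z v) ->
  supp z `<=` supp y -> (exists v, 0 < z v) -> in_cx L z.
Proof.
move=> cL [y0 Ly] z0 zy [v zv]; split => //.
have [_ _] := cL _ Ly; apply => //.
by exists v; rewrite /supp /= gt_eqF.
Qed.

Lemma plot_comp {Z Y : topologicalType} (p : Z -> V -> R) (j : Y -> Z) :
  continuous j -> plot p -> plot (fun t => p (j t)).
Proof.
move=> cj [cp [W fW pW]]; split; last by exists W.
by move=> v; apply: (cont_comp (cp v) cj).
Qed.

(** There are finitely many simplices on the vertices of the plot, and the support lies
in a given one when the coordinates outside it vanish, a closed condition. *)
Lemma plot_cover {Z : topologicalType} L (p : Z -> V -> R) :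
  cx L -> plot p -> (forall z, in_cx L (p z)) ->
  exists (D : set {fset V}), [/\ finite_set D, forall k, D k -> L [set` k],
    forall k, D k -> closed [set z | supp (p z) `<=` [set` k]] &
    forall z, exists2 k, D k & supp (p z) `<=` [set` k]].
Proof.
move=> cL [cp [W /finite_fsetP[F FE] pW]] pL.
exists [set k | k \in fpowerset F /\ L [set` k]]; split.
- apply: (@sub_finite_set _ _ [set` fpowerset F]); last exact: finite_fset.
  by move=> k [].
- by move=> k [].
- move=> k _.
  rewrite [X in closed X](_ : _ =
      \bigcap_(v in [set v | v \notin k]) ((fun z => p z v) @^-1` [set 0])).
    apply: closed_bigI => v _; move/continuous_closedP: (cp v); apply.
    exact: closed_eq.
  apply/seteqP; split => z /= h v.
    by move=> /= vk; apply/eqP; apply: contraNT vk => /h.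
  by rewrite /supp /=; apply: contraNP => /negP vk; apply/eqP; exact: h.
- move=> z; exists (fset_set (supp (p z))) => /=.
    have fs : finite_set (supp (p z)) by have [] := cL _ (pL z).2.
    split; last by rewrite fset_setK//; exact: (pL z).2.
    rewrite fpowersetE; apply/fsubsetP => v; rewrite in_fset_set// inE => /pW.
    by rewrite FE.
  have fs : finite_set (supp (p z)) by have [] := cL _ (pL z).2.
  by rewrite fset_setK.
Qed.

Lemma plot_glue {Z X : topologicalType} L (p : Z -> V -> R) (f : Z -> X) :
  cx L -> plot p -> (forall z, in_cx L (p z)) ->
  (forall k, L k -> forall (Y : topologicalType) (j : Y -> Z), continuous j ->
     (forall t, supp (p (j t)) `<=` k) -> continuous (fun t => f (j t))) ->
  continuous f.
Proof.
move=> cL pp pL cf; have [D [fD DL clD cov]] := plot_cover cL pp pL.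
apply: (@closed_glue Z X _ D (fun k => [set z | supp (p z) `<=` [set` k]]) f fD clD cov).
move=> k /DL Lk; apply: (cf _ Lk); first exact: initial_continuous.
by move=> [z zk]; exact: (set_mem zk).
Qed.

Lemma plot_lin {Z : topologicalType} (a b : Z -> R) (p q : Z -> V -> R) :
  continuous a -> continuous b -> plot p -> plot q ->
  plot (fun z v => a z * p z v + b z * q z v).
Proof.
move=> ca cb [cp [W fW pW]] [cq [W' fW' qW]]; split.
  by move=> v; apply: contD; apply: contM.
exists (W `|` W'); first by rewrite finite_setU.
move=> z v; rewrite /supp /= => h; apply: contrapT => /not_orP[n1 n2].
move/eqP: h; apply.
have -> : p z v = 0 by apply/eqP; apply: contrapT => /negP/(pW z v).
have -> : q z v = 0 by apply/eqP; apply: contrapT => /negP/(qW z v).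
by rewrite !mulr0 addr0.
Qed.

Lemma plotD {Z : topologicalType} (p q : Z -> V -> R) :
  plot p -> plot q -> plot (fun z v => p z v + q z v).
Proof.
move=> pp pq; rewrite (_ : (fun _ => _) = fun z v => 1 * p z v + 1 * q z v).
  by apply: plot_lin => //; exact: contK.
by apply/funext => z; apply/funext => v; rewrite !mul1r.
Qed.

Lemma plotZ {Z : topologicalType} (a : Z -> R) (p : Z -> V -> R) :
  continuous a -> plot p -> plot (fun z v => a z * p z v).
Proof.
move=> ca pp; rewrite (_ : (fun _ => _) = fun z v => a z * p z v + 0 * p z v).
  by apply: plot_lin => //; exact: contK.
by apply/funext => z; apply/funext => v; rewrite mul0r addr0.
Qed.

Definition res P y : V -> R := fun v => if `[< P v >] then y v else 0.

Lemma resE P y v : P v -> res P y v = y v.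
Proof. by move=> /asboolT Pv; rewrite /res Pv. Qed.

Lemma resN P y v : ~ P v -> res P y v = 0.
Proof. by move=> /asboolF Pv; rewrite /res Pv. Qed.

Lemma supp_res P y : supp (res P y) = supp y `&` P.
Proof.
apply/seteqP; split => v; rewrite /supp /res /=; case: asboolP => //=.
- by rewrite eqxx.
- by move=> _ [].
- by move=> nP [].
Qed.

Lemma res_ge0 P y : (forall v, 0 <= y v) -> forall v, 0 <= res P y v.
Proof. by move=> y0 v; rewrite /res; case: ifP. Qed.

Lemma plot_res {Z : topologicalType} P (p : Z -> V -> R) :
  plot p -> plot (fun z => res P (p z)).
Proof.
move=> [cp [W fW pW]]; split; last first.
  by exists W => // z; rewrite supp_res => v [/pW].
move=> v; rewrite /res; case: asboolP => _ //; exact: contK.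
Qed.

(** The sum is over the support, which is finite at points of a complex. *)
Definition wt P y : R := \sum_(v \in supp y) res P y v.

Lemma wtE P y W : finite_set W -> supp y `<=` W ->
  wt P y = \sum_(v <- fset_set W) res P y v.
Proof.
move=> fW yW; rewrite /wt (fsbig_widen (supp y) W)//; last first.
  by move=> v [_ /negP/negPn/eqP yv]; rewrite /= /res yv if_same.
exact: fsbig_finite.
Qed.

Lemma wt_cont {Z : topologicalType} P (p : Z -> V -> R) :
  plot p -> continuous (fun z => wt P (p z)).
Proof.
move=> pp; have [cp [W fW pW]] := plot_res P pp.
have [_ [W' fW' pW']] := pp.
under eq_fun do rewrite (wtE P fW' (pW' _)).
by apply: contsum.
Qed.

Lemma wt_scale P y z c : finite_set (supp y) -> finite_set (supp z) ->
  (forall v, P v -> z v = c * y v) -> wt P z = c * wt P y.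
Proof.
move=> fy fz E.
have fU : finite_set (supp y `|` supp z) by rewrite finite_setU.
rewrite (wtE (W := supp y `|` supp z) P fU)//.
rewrite (wtE (W := supp y `|` supp z) P fU)//.
rewrite mulr_sumr; apply: eq_bigr => v _; rewrite /res; case: asboolP => [/E//|_].
by rewrite mulr0.
Qed.

Lemma wt_ge0 P y : finite_set (supp y) -> (forall v, 0 <= y v) -> 0 <= wt P y.
Proof.
move=> fy y0; rewrite (wtE P fy)//.
by apply: sumr_ge0 => v _; exact: res_ge0.
Qed.

Lemma wt_gt0 P y v : finite_set (supp y) -> (forall v, 0 <= y v) ->
  P v -> 0 < y v -> y v <= wt P y.
Proof.
move=> fy y0 Pv yv; rewrite (wtE P fy)//.
rewrite (bigD1_seq v)/= ?fset_uniq//; last first.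
  by rewrite in_fset_set// inE /supp /= gt_eqF.
rewrite resE// lerDl; apply: sumr_ge0 => w _; exact: res_ge0.
Qed.

Lemma wt_gt0P P y : finite_set (supp y) -> (forall v, 0 <= y v) ->
  0 < wt P y <-> exists2 v, P v & 0 < y v.
Proof.
move=> fy y0; split; last by move=> [v Pv yv]; exact: lt_le_trans (wt_gt0 fy y0 Pv yv).
move=> w0; apply: contrapT => h; move: w0; rewrite (wtE P fy)// big1 ?ltxx// => v _.
rewrite /res; case: asboolP => // Pv; apply/eqP; rewrite eq_le y0 andbT leNgt.
by apply/negP => yv; apply: h; exists v.
Qed.

End complexes.

Arguments wt_cont {R V Z} P {p}.

(** * Maps and homotopies on a complex *)

Section maps_on_complexes.
Context {R : realType} {V : choiceType}.
Implicit Types (L : set (set V)).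

Definition fcont {X : topologicalType} L (g : (V -> R) -> X) :=
  forall (Z : topologicalType) (p : Z -> V -> R),
    plot p -> (forall z, in_cx L (p z)) -> continuous (fun z => g (p z)).

Definition hcont {X : topologicalType} L (G : (V -> R) -> R -> X) :=
  forall (Z : topologicalType) (p : Z -> V -> R) (t : Z -> R),
    plot p -> (forall z, in_cx L (p z)) -> continuous t ->
    (forall z, 0 <= t z <= 1) -> continuous (fun z => G (p z) (t z)).

Definition fhom {X : topologicalType} L (f g : (V -> R) -> X) :=
  exists G, [/\ hcont L G, forall y, in_cx L y -> G y 0 = f y &
    forall y, in_cx L y -> G y 1 = g y].

Lemma hcont_concat {X : topologicalType} L (G H : (V -> R) -> R -> X) :
  hcont L G -> hcont L H -> (forall y, in_cx L y -> G y 1 = H y 0) ->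
  hcont L (fun y t => if t <= 2^-1 then G y (2 * t) else H y (2 * t - 1)).
Proof.
move=> cG cH GH Z p t pp pL ct t01.
have half : 2 * 2^-1 = 1 :> R by rewrite mulfV// pnatr_eq0.
apply: (glue_le (c := t) (d := fun=> 2^-1)) => //; first exact: contK.
- move=> Y j cj tj.
  under eq_fun do rewrite tj.
  apply: cG => //; first exact: plot_comp.
    by apply: contM; [exact: contK | exact: cont_comp].
  move=> z; have := t01 (j z); have := tj z; lra.
- move=> Y j cj tj.
  rewrite (_ : (fun _ => _) = fun y => H (p (j y)) (2 * t (j y) - 1)).
    apply: cH => //; first exact: plot_comp.
      apply: contD; last exact: contK.
      by apply: contM; [exact: contK | exact: cont_comp].
    move=> z; have := t01 (j z); have := tj z; lra.
  apply/funext => y; case: ifPn => // h.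
  have -> : t (j y) = 2^-1 by apply/le_anti; rewrite h tj.
  by rewrite half subrr GH.
Qed.

Lemma fhom_trans {X : topologicalType} L (f g h : (V -> R) -> X) :
  fhom L f g -> fhom L g h -> fhom L f h.
Proof.
move=> [G [cG G0 G1]] [H [cH H0 H1]].
exists (fun y t => if t <= 2^-1 then G y (2 * t) else H y (2 * t - 1)); split.
- by apply: hcont_concat => // y yL; rewrite G1// H0.
- by move=> y yL; rewrite invr_ge0 ler0n mulr0 G0.
- move=> y yL; rewrite leNgt invf_lt1 ?ltr0n// ltr1n /= mulr1.
  by rewrite (_ : 2 - 1 = 1 :> R) ?H1//; ring.
Qed.

Lemma fhom_comp {X Y : topologicalType} L (f : X -> Y) (g h : (V -> R) -> X) :
  continuous f -> fhom L g h -> fhom L (fun y => f (g y)) (fun y => f (h y)).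
Proof.
move=> cf [G [cG G0 G1]]; exists (fun y t => f (G y t)); split.
- by move=> Z p t pp pL ct t01; apply: (cont_comp cf); exact: cG.
- by move=> y yL; rewrite G0.
- by move=> y yL; rewrite G1.
Qed.

Definition pmap L L' (q : (V -> R) -> (V -> R)) :=
  (forall (Z : topologicalType) (p : Z -> V -> R), plot p ->
    (forall z, in_cx L (p z)) -> plot (fun z => q (p z))) /\
  forall y, in_cx L y -> in_cx L' (q y).

Lemma in_cx_lin L (y z : V -> R) (a b : R) : cx L ->
  (forall v, 0 <= y v) -> (forall v, 0 <= z v) -> 0 <= a -> 0 <= b ->
  L (supp y `|` supp z) ->
  (0 < a /\ (exists v, 0 < y v)) \/ (0 < b /\ (exists v, 0 < z v)) ->
  in_cx L (fun v => a * y v + b * z v).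
Proof.
move=> cL y0 z0 a0 b0 Lyz ne; split.
  by move=> v; rewrite addr_ge0// mulr_ge0.
have [_ _] := cL _ Lyz; apply.
  move=> v; rewrite /supp /= => h; apply: contrapT => /not_orP[/negP/negPn/eqP n1].
  by move=> /negP/negPn/eqP n2; move: h; rewrite n1 n2 !mulr0 addr0 eqxx.
case: ne => -[ca [v cv]]; exists v; rewrite /supp /= gt_eqF//.
  by apply: ltr_pwDl; [exact: mulr_gt0 | exact: mulr_ge0].
by apply: ltr_wpDl; [exact: mulr_ge0 | exact: mulr_gt0].
Qed.

Lemma hcont_lin {X : topologicalType} L q (f : (V -> R) -> X) : cx L ->
  fcont L f -> pmap L L q -> (forall y, in_cx L y -> L (supp y `|` supp (q y))) ->
  hcont L (fun y t => f (fun v => (1 - t) * y v + t * q y v)).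
Proof.
move=> cL cf [qp qL] sq Z p t pp pL ct t01.
apply: (cf Z (fun z v => (1 - t z) * p z v + t z * q (p z) v)).
  apply: plot_lin => //; last exact: qp.
  by apply: contD; [exact: contK | exact: contN].
move=> z; have [t0 t1] := andP (t01 z).
have py := pL z; have qy := qL _ py.
apply: in_cx_lin;
  [exact: cL|exact: py.1|exact: qy.1|by rewrite subr_ge0|exact: t0|exact: sq|].
have [->|tz] := eqVneq (t z) 0.
  by left; rewrite subr0; split => //; exact: in_cx_ex py.
by right; rewrite lt_def tz t0; split => //; exact: in_cx_ex qy.
Qed.

(** The segment from [y] to [q y] stays in the complex, because the two supports
together span a simplex. *)
Lemma fhom_lin {X : topologicalType} L q (f : (V -> R) -> X) : cx L ->
  fcont L f -> pmap L L q -> (forall y, in_cx L y -> L (supp y `|` supp (q y))) ->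
  fhom L f (fun y => f (q y)).
Proof.
move=> cL cf qL sq.
exists (fun y t => f (fun v => (1 - t) * y v + t * q y v)); split.
- exact: hcont_lin.
- by move=> y yL; congr f; apply/funext => v; rewrite subr0 mul1r mul0r addr0.
- by move=> y yL; congr f; apply/funext => v; rewrite subrr mul1r mul0r add0r.
Qed.

Lemma fhom_subcx {X : topologicalType} L L' (f g : (V -> R) -> X) :
  L `<=` L' -> fhom L' f g -> fhom L f g.
Proof.
move=> LL' [G [cG G0 G1]].
have sub y : in_cx L y -> in_cx L' y by move=> [y0 Ly]; split => //; exact: LL'.
exists G; split.
- by move=> Z p t pp pL ct t01; apply: cG => // z; exact: sub.
- by move=> y /sub; exact: G0.
- by move=> y /sub; exact: G1.
Qed.

End maps_on_complexes.

(** * Complexes over a cover *)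

Section labelled.
Context {R : realType} {V : choiceType} {X : topologicalType} {k : nat}.
Variable U : 'I_k -> set X.

(** [good_cont] is continuity on the family of the points of one simplex, as in the
weak topology; by [plot_glue] it gives continuity along every plot. [good_lab] says
that [r] sends the open star of [v] into [U (l v)]. *)
Record good (L : set (set V)) (r : (V -> R) -> X) (l : V -> 'I_k) : Prop := Good {
  good_cx : cx L;
  good_cont : forall s, L s -> forall (Z : topologicalType) (p : Z -> V -> R),
    (forall v, continuous (fun z => p z v)) -> (forall z, in_cx L (p z)) ->
    (forall z, supp (p z) `<=` s) -> continuous (fun z => r (p z));
  good_scale : forall (c : R) y, 0 < c -> in_cx L y -> r (fun v => c * y v) = r y;
  good_lab : forall y v, in_cx L y -> 0 < y v -> U (l v) (r y) }.

Lemma good_fcont L r l : good L r l -> fcont L r.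
Proof.
move=> gL Z p pp pL; apply: (plot_glue (good_cx gL) pp pL) => s Ls Y j cj js.
apply: (good_cont gL Ls) => //.
by move=> v; apply: (cont_comp (pp.1 v) cj).
Qed.

End labelled.

(** * The cells in the middle of a split complex *)

Lemma squeeze_at {R : realType} {Z : topologicalType} (g N : Z -> R) z0 :
  {for z0, continuous N} -> N z0 = 0 -> (forall z, `|g z| <= N z) ->
  {for z0, continuous g}.
Proof.
move=> cN N0 gN; have g0 : g z0 = 0.
  by apply/eqP; rewrite -normr_le0 -N0.
apply/cvgrPdist_le => e e0; rewrite g0; near=> z.
rewrite sub0r normrN; apply: le_trans (gN z) _.
have : `|N z0 - N z| <= e by near: z; move/cvgrPdist_le: cN; apply.
by rewrite N0 sub0r normrN ger0_norm// (le_trans _ (gN z)).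
Unshelve. all: by end_near. Qed.

Lemma contV_at {R : realType} {Z : topologicalType} (f : Z -> R) z0 :
  f z0 != 0 -> {for z0, continuous f} -> {for z0, continuous (fun z => (f z)^-1)}.
Proof. by move=> f0 cf; apply: cvgV. Qed.

Lemma contM_at {R : realType} {Z : topologicalType} (f g : Z -> R) z0 :
  {for z0, continuous f} -> {for z0, continuous g} ->
  {for z0, continuous (fun z => f z * g z)}.
Proof. by move=> cf cg; apply: cvgM. Qed.

(** The vertices of the simplex [s] are split by [P] into two nonempty sets, and the
points with total weight 1 on both sides form a product of two simplices. Here it
is identified with a disc, with [b] as centre. A vertex [v1] inside [P] and a
vertex [v2] outside [P] are singled out; the others index the coordinates. *)
Section prism_cell.
Context {R : realType} {V : choiceType}.
Variables (P : set V) (s : set V) (v1 v2 : V) (b : V -> R).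
Hypothesis fs : finite_set s.
Hypotheses (sv1 : s v1) (Pv1 : P v1) (sv2 : s v2) (Pv2 : ~ P v2).
Hypotheses (b_gt0 : forall v, s v -> 0 < b v) (b_off : forall v, ~ s v -> b v = 0).
Hypotheses (b_P : wt P b = 1) (b_nP : wt (~` P) b = 1).

Local Notation S := (enum_fset (fset_set s)).

Lemma mem_S v : (v \in S) <-> s v.
Proof. by rewrite -[v \in S]/(v \in fset_set s) in_fset_set// inE. Qed.

Definition prism_rest : seq V := [seq v <- S | (v != v1) && (v != v2)].
Definition prism_dim := size prism_rest.

Definition prism_corner v := if `[< P v >] then v1 else v2.
(** These vectors are tangent to the product: weight moves from the corner of a side
to another vertex of the same side. *)
Definition prism_vec (i : 'I_prism_dim) : V -> R := fun v =>
  (v == nth v1 prism_rest i)%:R - (v == prism_corner (nth v1 prism_rest i))%:R.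
Definition prism_lin (x : 'rV[R]_prism_dim) : V -> R := fun v => \sum_i x 0 i * prism_vec i v.

Lemma restP (i : 'I_prism_dim) :
  [/\ s (nth v1 prism_rest i), nth v1 prism_rest i != v1 & nth v1 prism_rest i != v2].
Proof.
have : nth v1 prism_rest i \in prism_rest by exact: mem_nth.
by rewrite mem_filter => /andP[/andP[-> ->] /mem_S].
Qed.

Lemma prism_lin_off x v : ~ s v -> prism_lin x v = 0.
Proof.
move=> nsv; rewrite /prism_lin big1// => i _; rewrite /prism_vec.
have [si _ _] := restP i.
have /negbTE-> : v != nth v1 prism_rest i by apply/eqP => h; apply: nsv; rewrite h.
have /negbTE-> : v != prism_corner (nth v1 prism_rest i).
  by apply/eqP => h; apply: nsv; rewrite h /prism_corner; case: ifP.
by rewrite subrr mulr0.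
Qed.

Lemma supp_sub (y : V -> R) : (forall v, ~ s v -> y v = 0) -> supp y `<=` s.
Proof. by move=> h v; apply: contraPP => /h yv; rewrite /supp /= yv eqxx. Qed.

Lemma wtS Q (y : V -> R) : (forall v, ~ s v -> y v = 0) ->
  wt Q y = \sum_(v <- S) res Q y v.
Proof. by move=> h; rewrite (wtE Q fs (supp_sub h)). Qed.

Lemma sum_delta (f : V -> R) w : s w -> \sum_(v <- S) f v * (v == w)%:R = f w.
Proof.
move=> sw; rewrite (bigD1_seq w)/= ?fset_uniq//; last by apply/mem_S.
rewrite eqxx mulr1 big1 ?addr0// => v /negbTE->; by rewrite mulr0.
Qed.

Lemma wt_prism_lin Q x : Q = P \/ Q = ~` P -> wt Q (prism_lin x) = 0.
Proof.
move=> hQ; rewrite wtS; last by move=> v; exact: prism_lin_off.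
pose c v : R := (`[< Q v >])%:R.
have -> : \sum_(v <- S) res Q (prism_lin x) v =
    \sum_(v <- S) \sum_i c v * (x 0 i * prism_vec i v).
  apply: eq_bigr => v _; rewrite -mulr_sumr /res /c; case: asboolP => _.
    by rewrite mul1r.
  by rewrite mul0r.
rewrite exchange_big /= big1// => i _; have [si i1 i2] := restP i.
have -> : \sum_(v <- S) c v * (x 0 i * prism_vec i v) =
  x 0 i * (\sum_(v <- S) c v * (v == nth v1 prism_rest i)%:R -
           \sum_(v <- S) c v * (v == prism_corner (nth v1 prism_rest i))%:R).
  rewrite -sumrB mulr_sumr; apply: eq_bigr => v _; rewrite /prism_vec; ring.
rewrite !sum_delta//; last by rewrite /prism_corner; case: ifP.
rewrite (_ : c _ = c (prism_corner (nth v1 prism_rest i))) ?subrr ?mulr0//.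
rewrite /c /prism_corner; congr (_%:R); congr nat_of_bool; apply/asbool_equiv_eq.
case: asboolP => Pi; case: hQ => ->; by split.
Qed.

Lemma prism_lin_rest x (j : 'I_prism_dim) : prism_lin x (nth v1 prism_rest j) = x 0 j.
Proof.
rewrite /prism_lin (bigD1 j)//= big1 ?addr0.
  rewrite /prism_vec eqxx; have [_ h1 h2] := restP j.
  rewrite /prism_corner; case: ifP => _; rewrite ?(negbTE h1) ?(negbTE h2) subr0 mulr1//.
move=> i ij; rewrite /prism_vec; have [_ h1 h2] := restP j.
have /negbTE-> : nth v1 prism_rest j != prism_corner (nth v1 prism_rest i).
  by rewrite /prism_corner; case: ifP => _.
rewrite nth_uniq ?filter_uniq ?fset_uniq// eq_sym -val_eqE in ij *.
by rewrite (negbTE ij) subr0 mulr0.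
Qed.

Lemma prism_lin_surj (z : V -> R) : (forall v, ~ s v -> z v = 0) ->
  wt P z = 0 -> wt (~` P) z = 0 -> exists x, forall v, prism_lin x v = z v.
Proof.
move=> z_off zP znP.
pose x : 'rV[R]_prism_dim := \row_j z (nth v1 prism_rest j).
exists x.
pose w v := z v - prism_lin x v.
have woff v : ~ s v -> w v = 0 by move=> sv; rewrite /w z_off// prism_lin_off// subrr.
have wrest v : v != v1 -> v != v2 -> w v = 0.
  move=> n1 n2; have [sv|/woff//] := pselect (s v).
  have vr : v \in prism_rest by rewrite mem_filter n1 n2/=; apply/mem_S.
  have lt : (index v prism_rest < prism_dim)%N by rewrite index_mem.
  rewrite /w -(nth_index v1 vr) -[index _ _]/(val (Ordinal lt)) prism_lin_rest mxE.
  by rewrite subrr.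
have wtw Q : Q = P \/ Q = ~` P -> wt Q w = 0.
  move=> hQ; rewrite wtS// (_ : \sum_(v <- S) _ = wt Q z - wt Q (prism_lin x)).
    by rewrite wt_prism_lin// subr0; case: hQ => ->.
  rewrite !wtS//; last by move=> v; exact: prism_lin_off.
  rewrite -sumrB; apply: eq_bigr => v _; rewrite /res; case: ifP => //.
  by rewrite subrr.
have w1 : w v1 = 0.
  have := wtw P (or_introl erefl); rewrite wtS// (bigD1_seq v1)/= ?fset_uniq//; last by apply/mem_S.
  rewrite resE// big1 ?addr0// => v vn; rewrite /res; case: asboolP => // Pv.
  by apply: wrest => //; apply/eqP => h; apply: Pv2; rewrite -h.
have w2 : w v2 = 0.
  have := wtw (~` P) (or_intror erefl); rewrite wtS// (bigD1_seq v2)/= ?fset_uniq//; last by apply/mem_S.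
  rewrite resE// big1 ?addr0// => v vn; rewrite /res; case: asboolP => // Pv.
  by apply: wrest => //; apply/eqP => h; apply: Pv; rewrite h.
move=> v; apply/eqP; rewrite eq_sym -subr_eq0; apply/eqP; rewrite -/(w v).
have [->|n1] := eqVneq v v1; first by [].
by have [->|n2] := eqVneq v v2; first by []; exact: wrest.
Qed.

(** The Minkowski gauge of the product of simplices with [b] moved to the origin. *)
Definition gauge (x : 'rV[R]_prism_dim) : R :=
  \big[Num.max/0]_(v <- S) (- prism_lin x v / b v).

Lemma gauge_ge0 x : 0 <= gauge x.
Proof. by rewrite /gauge; apply: bigmax_ge_id. Qed.

Lemma gauge_ge x v : s v -> - prism_lin x v <= gauge x * b v.
Proof.
move=> sv; rewrite -ler_pdivrMr ?b_gt0//.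
have vS : v \in S by apply/mem_S.
exact: (le_bigmax_seq 0 v xpredT (fun v => - prism_lin x v / b v) vS isT).
Qed.

Lemma gauge_le x c : 0 <= c -> (forall v, s v -> - prism_lin x v <= c * b v) -> gauge x <= c.
Proof.
move=> c0 h; rewrite /gauge big_seq; apply: bigmax_le => // v /mem_S sv.
by rewrite ler_pdivrMr ?b_gt0//; exact: h.
Qed.

Lemma gauge_attained x : 0 < gauge x -> exists2 v, s v & - prism_lin x v = gauge x * b v.
Proof.
move=> g0; suff [v vS E] : exists2 v, v \in S & - prism_lin x v / b v = gauge x.
  exists v; first by apply/mem_S.
  by rewrite -E mulfVK// gt_eqF//; apply: b_gt0; apply/mem_S.
move: g0; rewrite /gauge; elim: S => [|w r ih]; first by rewrite big_nil ltxx.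
rewrite big_cons; case: (leP (- prism_lin x w / b w)) => h g0.
  by have [v vr <-] := ih g0; exists v => //; rewrite inE vr orbT.
by exists w => //; rewrite inE eqxx.
Qed.

Lemma prism_linZ (c : R) x v : prism_lin (c *: x) v = c * prism_lin x v.
Proof. by rewrite /prism_lin mulr_sumr; apply: eq_bigr => i _; rewrite mxE mulrA. Qed.

Lemma gaugeZ c x : 0 < c -> gauge (c *: x) = c * gauge x.
Proof.
have le1 c' x' : 0 < c' -> gauge (c' *: x') <= c' * gauge x'.
  move=> c0; apply: gauge_le; first by rewrite mulr_ge0 ?gauge_ge0// ltW.
  by move=> v sv; rewrite prism_linZ -mulrN -mulrA ler_pM2l//; exact: gauge_ge.
move=> c0; apply/le_anti; rewrite le1//=.
have := le1 c^-1 (c *: x); rewrite invr_gt0 => /(_ c0).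
by rewrite scalerA mulVf ?gt_eqF// scale1r ler_pdivlMl.
Qed.

(** The gauge bounds the negative coordinates by definition. The coordinates on one
side sum to zero while those of [b] sum to 1, so it bounds the positive ones too. *)
Lemma abs_prism_lin x v : s v -> `|prism_lin x v| <= gauge x.
Proof.
move=> sv; have bge0 w : 0 <= b w.
  by have [/b_gt0/ltW//|/b_off->] := pselect (s w).
have [Q [hQ Qv Qb]] : exists Q, [/\ Q = P \/ Q = ~` P, Q v & wt Q b = 1].
  by have [Pv|Pv] := pselect (P v); [exists P; split => //; left | exists (~` P); split => //; right].
have b1 : b v <= 1.
  by rewrite -Qb; apply: wt_gt0 => //; [exact: (sub_finite_set (supp_sub b_off)) | exact: b_gt0].
have g0 := gauge_ge0 x.
rewrite ler_norml lerNl; apply/andP; split.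
  by apply: le_trans (gauge_ge x sv) _; rewrite ler_piMr.
have := wt_prism_lin x hQ; rewrite wtS; last by move=> w; exact: prism_lin_off.
rewrite (bigD1_seq v)/= ?fset_uniq//; last by apply/mem_S.
rewrite resE// => /eqP; rewrite addr_eq0 => /eqP ->.
rewrite -(mulr1 (gauge x)) -[in leRHS]Qb wtS//.
rewrite [in leRHS](bigD1_seq v)/= ?fset_uniq//; last by apply/mem_S.
rewrite mulrDr; apply: ler_wpDl; first by rewrite mulr_ge0// res_ge0.
rewrite mulr_sumr -sumrN big_seq_cond [leRHS]big_seq_cond.
apply: ler_sum => w /andP[/mem_S sw _]; rewrite /res; case: ifP => _.
  exact: gauge_ge.
by rewrite mulr0 oppr0.
Qed.

Lemma gauge_eq0 x : gauge x = 0 -> x = 0.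
Proof.
move=> g0; apply/rowP => j; rewrite mxE -prism_lin_rest; apply/eqP.
by rewrite -normr_le0 -g0; apply: abs_prism_lin; have [] := restP j.
Qed.

(** The radial rescaling that turns the Euclidean norm into the gauge, and so the
unit disc into the product of simplices. *)
Definition prism_scale (x : 'rV[R]_prism_dim) : R := enorm x / gauge x.
Definition prism_map (x : 'rV[R]_prism_dim) : V -> R := fun v =>
  b v + prism_scale x * prism_lin x v.

Lemma prism_scale_ge0 x : 0 <= prism_scale x.
Proof. by rewrite divr_ge0 ?enorm_ge0 ?gauge_ge0. Qed.

Lemma enorm0 n : enorm (0 : 'rV[R]_n) = 0.
Proof. by rewrite /enorm big1 ?sqrtr0// => j _; rewrite mxE expr0n. Qed.

Lemma prism_scale_gauge x : prism_scale x * gauge x = enorm x.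
Proof.
have [g0|g0] := eqVneq (gauge x) 0; last by rewrite mulfVK.
by rewrite g0 mulr0 (gauge_eq0 g0) enorm0.
Qed.

Lemma prism_map_ge x v : s v -> (1 - enorm x) * b v <= prism_map x v.
Proof.
move=> sv; rewrite /prism_map -prism_scale_gauge mulrBl mul1r lerD2l -mulrA lerNl.
by rewrite -mulrN ler_wpM2l ?prism_scale_ge0// gauge_ge.
Qed.

Lemma prism_map_off x v : ~ s v -> prism_map x v = 0.
Proof. by move=> sv; rewrite /prism_map b_off// prism_lin_off// mulr0 addr0. Qed.

Lemma prism_map_ge0 x v : enorm x <= 1 -> 0 <= prism_map x v.
Proof.
move=> x1; have [sv|/prism_map_off->//] := pselect (s v).
apply: le_trans (prism_map_ge x sv); rewrite mulr_ge0 ?subr_ge0//.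
by rewrite ltW// b_gt0.
Qed.

Lemma prism_map_interior x : enorm x < 1 -> supp (prism_map x) = s.
Proof.
move=> x1; apply/seteqP; split; first by apply: supp_sub => v; exact: prism_map_off.
move=> v sv; rewrite /supp /= gt_eqF//.
by apply: lt_le_trans (prism_map_ge x sv); rewrite mulr_gt0 ?subr_gt0// b_gt0.
Qed.

Lemma prism_map_boundary x : enorm x = 1 -> exists2 v, s v & prism_map x v = 0.
Proof.
move=> x1; have g0 : 0 < gauge x.
  rewrite lt_def gauge_ge0 andbT; apply/eqP => /gauge_eq0 x0.
  by move: x1; rewrite x0 enorm0 => /esym/eqP; rewrite oner_eq0.
have [v sv E] := gauge_attained g0; exists v => //.
have := prism_scale_gauge x; rewrite x1 => h.
by rewrite /prism_map -[prism_lin x v]opprK E mulrN mulrA h mul1r subrr.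
Qed.

Lemma wt_prism_map Q x : Q = P \/ Q = ~` P -> wt Q (prism_map x) = 1.
Proof.
move=> hQ; rewrite wtS; last by move=> v; exact: prism_map_off.
rewrite (_ : \sum_(v <- S) _ = wt Q b + prism_scale x * wt Q (prism_lin x)).
  by rewrite wt_prism_lin// mulr0 addr0; case: hQ => ->.
rewrite !wtS//; last by move=> v; exact: prism_lin_off.
rewrite mulr_sumr -big_split; apply: eq_bigr => v _; rewrite /res; case: ifP => //.
by rewrite /= mulr0 addr0.
Qed.

Lemma prism_map_surj y : (forall v, 0 <= y v) -> (forall v, ~ s v -> y v = 0) ->
  wt P y = 1 -> wt (~` P) y = 1 ->
  exists2 x, enorm x <= 1 & forall v, prism_map x v = y v.
Proof.
move=> y0 y_off yP ynP.
have wtyb Q : wt Q (fun v => y v - b v) = wt Q y - wt Q b.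
  rewrite !wtS//; last by move=> v sv; rewrite y_off// b_off// subrr.
  rewrite -sumrB; apply: eq_bigr => v _; rewrite /res; case: ifP => //.
  by rewrite subrr.
have [x0 x0E] : exists x, forall v, prism_lin x v = y v - b v.
  apply: prism_lin_surj.
  - by move=> v sv; rewrite y_off// b_off// subrr.
  - by rewrite wtyb yP b_P subrr.
  - by rewrite wtyb ynP b_nP subrr.
have g1 : gauge x0 <= 1.
  apply: gauge_le => // v sv; rewrite x0E mul1r opprB lerBlDr lerDl; exact: y0.
have [x00|x00] := eqVneq x0 0.
  exists 0; first by rewrite enorm0.
  move=> v; rewrite /prism_map /prism_scale enorm0 mul0r mul0r addr0.
  have := x0E v; rewrite x00 -[X in prism_lin X](scale0r (0 : 'rV[R]__)) prism_linZ mul0r.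
  by move=> /esym/eqP; rewrite subr_eq0 => /eqP.
have N0 : 0 < enorm x0.
  by rewrite lt_def enorm_ge0 andbT; apply: contra x00 => /eqP/enorm_eq0 ->.
have g0 : 0 < gauge x0.
  by rewrite lt_def gauge_ge0 andbT; apply: contra x00 => /eqP/gauge_eq0 ->.
have c0 : 0 < gauge x0 / enorm x0 by exact: divr_gt0.
exists ((gauge x0 / enorm x0) *: x0).
  by rewrite (enormZ _ (ltW c0)) mulfVK// gt_eqF.
move=> v; rewrite /prism_map /prism_scale prism_linZ (enormZ _ (ltW c0)) gaugeZ// x0E.
have [n1 n2] : gauge x0 != 0 /\ enorm x0 != 0 by rewrite !gt_eqF.
by field; rewrite n1 n2.
Qed.

Lemma prism_map_inj x x' : prism_map x =1 prism_map x' -> x = x'.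
Proof.
move=> E.
have E' : prism_scale x *: x = prism_scale x' *: x'.
  apply/rowP => j; rewrite -!prism_lin_rest !prism_linZ.
  by have := E (nth v1 prism_rest j); rewrite /prism_map => /addrI.
have key z : gauge (prism_scale z *: z) = enorm z.
  have [z0|z0] := eqVneq (prism_scale z) 0.
    rewrite z0 scale0r -(prism_scale_gauge z) z0 mul0r.
    apply/le_anti; rewrite gauge_ge0 andbT; apply: gauge_le => // v sv.
    by rewrite -[X in prism_lin X](scale0r (0 : 'rV[R]__)) prism_linZ !mul0r oppr0.
  by rewrite gaugeZ ?prism_scale_gauge// lt_def z0 prism_scale_ge0.
have N : enorm x = enorm x' by rewrite -!key E'.
have [N0|N0] := eqVneq (enorm x) 0.
  by rewrite (enorm_eq0 N0); symmetry; apply: enorm_eq0; rewrite -N.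
have cN : prism_scale x = prism_scale x'.
  apply: (mulIf N0); rewrite [in RHS]N -!enormZ ?prism_scale_ge0//; congr enorm.
  exact: E'.
have c0 : prism_scale x != 0.
  by apply: contra N0 => /eqP c0; rewrite -prism_scale_gauge c0 mul0r.
by move: E'; rewrite -cN => /(scalerI c0).
Qed.

Lemma cont_prism_lin {Z : topologicalType} (f : Z -> 'rV[R]_prism_dim) v :
  continuous f -> continuous (fun z => prism_lin (f z) v).
Proof.
move=> cf; apply: contsum => i; apply: contM; [exact: cont_coord | exact: contK].
Qed.

Lemma cont_gauge : continuous gauge.
Proof.
rewrite /gauge; elim: S => [|w r ih].
  by under eq_fun do rewrite big_nil; exact: contK.
under eq_fun do rewrite big_cons.
apply: contmax => //; apply: contM; last exact: contK.
by apply: contN; apply: cont_prism_lin => x; exact: cvg_id.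
Qed.

Lemma cont_prism_map v : continuous (fun x => prism_map x v).
Proof.
have cid : continuous (fun x : 'rV[R]_prism_dim => x) by move=> x; exact: cvg_id.
have [sv|sv] := pselect (s v); last first.
  by under eq_fun do rewrite prism_map_off//; exact: contK.
suff cc : continuous (fun x => prism_scale x * prism_lin x v).
  by apply: contD => //; exact: contK.
move=> x.
have [x0|x0] := eqVneq x 0.
  (* at the centre the scaling factor has no limit, but the product tends to 0 *)
  have bd y : `|prism_scale y * prism_lin y v| <= enorm y.
    rewrite normrM ger0_norm ?prism_scale_ge0// -prism_scale_gauge.
    by rewrite ler_wpM2l ?prism_scale_ge0// abs_prism_lin.
  rewrite x0; apply: (squeeze_at (N := fun y => enorm y)) => //.
    exact: (cont_enorm cid).
  exact: enorm0.
have cl : {for x, continuous (fun y => prism_lin y v)} by exact: (cont_prism_lin cid).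
have cg : {for x, continuous (fun y => (gauge y)^-1)}.
  have g0 : gauge x != 0 by apply/eqP => /gauge_eq0 h; rewrite h eqxx in x0.
  by apply: contV_at g0 _; exact: cont_gauge.
have ce : {for x, continuous (fun y : 'rV[R]_prism_dim => enorm y)} by exact: (cont_enorm cid).
exact: (contM_at (contM_at ce cg) cl).
Qed.

End prism_cell.

(** * The middle of a split complex is a CW complex *)

Section middle_space.
Context {R : realType} {V : choiceType}.
Variables (L : set (set V)) (P : set V).

Definition mid : set (V -> R) := [set y | [/\ in_cx L y, wt P y = 1 & wt (~` P) y = 1]].

(** The middle with a disjoint base point, under the final topology of the plots. *)
Definition midp : Type := option (set_type mid).

HB.instance Definition _ := gen_eqMixin midp.
HB.instance Definition _ := gen_choiceMixin midp.

Definition midp_open (O : set midp) := forall (Z : topologicalType) (p : Z -> set_type mid),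
  plot (fun z => val (p z)) -> open [set z | O (Some (p z))].

Lemma midp_openT : midp_open [set: midp].
Proof. by move=> Z p pp; exact: openT. Qed.

Lemma midp_openI : setI_closed midp_open.
Proof. by move=> A B oA oB Z p pp; apply: openI; [exact: oA | exact: oB]. Qed.

Lemma midp_open_bigU (I : Type) (A : I -> set midp) :
  (forall i, midp_open (A i)) -> midp_open (\bigcup_i A i).
Proof.
move=> oA Z p pp.
rewrite (_ : [set z | _] = \bigcup_i [set z | A i (Some (p z))]).
  by apply: bigcup_open => i _; exact: oA.
by apply/seteqP; split => z [i _ Ai]; exists i.
Qed.

HB.instance Definition _ := isOpenTopological.Build midp
  midp_openT midp_openI midp_open_bigU.
HB.instance Definition _ := isPointed.Build midp None.

Lemma midp_openE (A : set midp) : open A = midp_open A.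
Proof. by []. Qed.

Lemma midp_plot {Z : topologicalType} (p : Z -> set_type mid) :
  plot (fun z => val (p z)) -> continuous (fun z => (Some (p z) : midp)).
Proof. by move=> pp; apply/continuousP => A oA; exact: (oA _ _ pp). Qed.

Lemma midp_continuous {Y : topologicalType} (f : midp -> Y) :
  (forall (Z : topologicalType) (p : Z -> set_type mid), plot (fun z => val (p z)) ->
    continuous (fun z => f (Some (p z)))) -> continuous f.
Proof.
move=> cf; apply/continuousP => A oA; rewrite midp_openE => Z p pp.
by have /continuousP/(_ _ oA) := cf _ _ pp.
Qed.

(** The coordinates, with the value 0 at the base point, and the indicator of the
complement of the base point separate points. *)
Definition midp_coord (v : V) (m : midp) : R := if m is Some y then val y v else 0.
Definition midp_some (m : midp) : R := if m is Some y then 1 else 0.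

Lemma midp_hausdorff : hausdorff_space midp.
Proof.
apply: (@hausdorff_separate _ _
  [set f | f = midp_some \/ exists v, f = midp_coord v] (@Rhausdorff R)).
  move=> f [->|[v ->]]; apply: midp_continuous => Z p pp /=; first exact: contK.
  exact: pp.1.
move=> [x|] [y|] h //.
- congr Some; apply: val_inj; apply/funext => v.
  by apply: (h (midp_coord v)); right; exists v.
- have := h midp_some (or_introl erefl); rewrite /midp_some => /eqP.
  by rewrite oner_eq0.
- have := h midp_some (or_introl erefl); rewrite /midp_some => /esym/eqP.
  by rewrite oner_eq0.
Qed.

Hypothesis cL : cx L.

(** The choices made in the construction of a cell. *)
Record prism (s : set V) : Type := Prism {
  pr1 : V; pr2 : V; prb : V -> R;
  pr_L : L s;
  pr_s1 : s pr1; pr_P1 : P pr1; pr_s2 : s pr2; pr_P2 : ~ P pr2;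
  pr_gt0 : forall v, s v -> 0 < prb v;
  pr_off : forall v, ~ s v -> prb v = 0;
  pr_wt1 : wt P prb = 1;
  pr_wt2 : wt (~` P) prb = 1 }.

Definition mixed s := [/\ L s, exists2 v, s v & P v & exists2 v, s v & ~ P v].

(** The centre gives equal weights to the vertices of each side. *)
Lemma mixed_prism s : mixed s -> exists _ : prism s, True.
Proof.
move=> [Ls [v1 s1 P1] [v2 s2 P2]].
have [fs _ _] := cL Ls.
pose y v : R := if `[< s v >] then 1 else 0.
have yin v : s v -> y v = 1 by move=> /asboolT sv; rewrite /y sv.
have yout v : ~ s v -> y v = 0 by move=> /asboolF sv; rewrite /y sv.
have y0 v : 0 <= y v by rewrite /y; case: ifP.
have sy : supp y `<=` s by exact: supp_sub.
have fy : finite_set (supp y) := sub_finite_set sy fs.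
have w1 : 0 < wt P y by apply/wt_gt0P => //; exists v1; rewrite // yin.
have w2 : 0 < wt (~` P) y by apply/wt_gt0P => //; exists v2; rewrite // yin.
pose c v := if `[< P v >] then (wt P y)^-1 else (wt (~` P) y)^-1.
pose b v := c v * y v.
have c0 v : 0 < c v by rewrite /c; case: ifP; rewrite invr_gt0.
have boff v : ~ s v -> b v = 0 by move=> /yout yv; rewrite /b yv mulr0.
have fb : finite_set (supp b) := sub_finite_set (supp_sub boff) fs.
unshelve eexists (@Prism s v1 v2 b Ls s1 P1 s2 P2 _ boff _ _) => //.
- by move=> v sv; rewrite /b yin// mulr1.
- rewrite (@wt_scale _ _ P y b (wt P y)^-1)// ?mulVf ?gt_eqF//.
  by move=> v /asboolT Pv; rewrite /b /c Pv.
- rewrite (@wt_scale _ _ (~` P) y b (wt (~` P) y)^-1)// ?mulVf ?gt_eqF//.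
  by move=> v /asboolF Pv; rewrite /b /c Pv.
Qed.

Definition the_prism (c : {s | mixed s}) : prism (sval c) :=
  sval (cid (mixed_prism (svalP c))).

Definition pdim (c : {s | mixed s}) : nat :=
  prism_dim (sval c) (pr1 (the_prism c)) (pr2 (the_prism c)).

Definition pmapc (c : {s | mixed s}) : 'rV[R]_(pdim c) -> V -> R :=
  @prism_map R V P (sval c) (pr1 (the_prism c)) (pr2 (the_prism c)) (prb (the_prism c)).

Lemma mixed_finite (c : {s | mixed s}) : finite_set (sval c).
Proof. by have [/cL[]] := svalP c. Qed.

Ltac prism_hyps c :=
  have h1 := pr_s1 (the_prism c); have h2 := pr_P1 (the_prism c);
  have h3 := pr_s2 (the_prism c); have h4 := @pr_P2 _ (the_prism c);
  have h5 := @pr_gt0 _ (the_prism c); have h6 := @pr_off _ (the_prism c);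
  have h7 := pr_wt1 (the_prism c); have h8 := pr_wt2 (the_prism c).

Lemma pmapc_off c (x : 'rV[R]_(pdim c)) v : ~ sval c v -> pmapc x v = 0.
Proof.
have fs := mixed_finite c.
prism_hyps c.
exact: (@prism_map_off _ _ P _ _ _ _ fs h1 h3 h6).
Qed.

Lemma pmapc_interior c (x : 'rV[R]_(pdim c)) : enorm x < 1 -> supp (pmapc x) = sval c.
Proof.
have := mixed_finite c.
prism_hyps c. move=> fs x1.
exact: (prism_map_interior fs h1 h2 h3 h4 h5 h6 h7 h8).
Qed.

Lemma pmapc_boundary c (x : 'rV[R]_(pdim c)) : enorm x = 1 -> supp (pmapc x) != sval c.
Proof.
have := mixed_finite c.
prism_hyps c. move=> fs x1.
have [v sv v0] := prism_map_boundary fs h1 h2 h3 h4 h5 h6 h7 h8 x1.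
have {}v0 : pmapc x v = 0 := v0.
by apply/eqP => E; move: sv; rewrite -E /supp /= v0 eqxx.
Qed.

Lemma pmapc_mid c (x : 'rV[R]_(pdim c)) : enorm x <= 1 -> mid (pmapc x).
Proof.
have := mixed_finite c; have [Ls _ _] := svalP c.
have off := @pmapc_off c.
prism_hyps c. move=> fs x1.
have w1 : wt P (pmapc x) = 1 by apply: (wt_prism_map fs h1 h2 h3 h4 h6 h7 h8); left.
have ge0 v : 0 <= pmapc x v by exact: (prism_map_ge0 fs h1 h2 h3 h4 h5 h6 h7 h8).
split => //; last by apply: (wt_prism_map fs h1 h2 h3 h4 h6 h7 h8); right.
have sx : supp (pmapc x) `<=` sval c by apply: supp_sub => v; exact: off.
split => //; have [_ _] := cL Ls; apply => //.
have /wt_gt0P[|//|v _ v0] : 0 < wt P (pmapc x) by rewrite w1.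
  exact: sub_finite_set sx fs.
by exists v; rewrite /supp /= gt_eqF.
Qed.

Lemma pmapc_surj c y : mid y -> supp y `<=` sval c ->
  exists2 x : 'rV[R]_(pdim c), enorm x <= 1 & pmapc x = y.
Proof.
move=> [[y0 _] yP ynP] ys.
have := mixed_finite c.
prism_hyps c. move=> fs.
have [|x x1 xE] := prism_map_surj fs h1 h2 h3 h4 h5 h6 h7 h8 y0 _ yP ynP; last first.
  by exists x => //=; apply/funext.
by move=> v; apply: contra_notP => /eqP; exact: ys.
Qed.

Lemma pmapc_inj c : injective (@pmapc c).
Proof.
have := mixed_finite c.
prism_hyps c. move=> fs x x' /= E.
by apply: (prism_map_inj fs h1 h2 h3 h4 h5 h6 h7 h8) => v; exact: (congr1 (fun f => f v) E).
Qed.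

Lemma cont_pmapc c v : continuous (fun x => @pmapc c x v).
Proof.
have := mixed_finite c.
prism_hyps c. move=> fs.
exact: (cont_prism_map fs h1 h2 h3 h4 h5 h6 h7 h8).
Qed.

(** Two vertices are spent on the normalisations, so that a proper face has a
smaller dimension. *)
Lemma pdim_card c : (pdim c).+2 = #|` fset_set (sval c)|.
Proof.
have := mixed_finite c.
prism_hyps c. move=> fs.
have n12 : pr1 (the_prism c) != pr2 (the_prism c) by apply/eqP => E; apply: h4; rewrite -E.
have u : uniq (pr1 (the_prism c) :: pr2 (the_prism c) ::
    prism_rest (sval c) (pr1 (the_prism c)) (pr2 (the_prism c))).
  by rewrite /= !inE (negbTE n12) !mem_filter !eqxx /= andbF filter_uniq ?fset_uniq.
have /perm_size <- // : perm_eq (pr1 (the_prism c) :: pr2 (the_prism c) ::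
    prism_rest (sval c) (pr1 (the_prism c)) (pr2 (the_prism c))) (fset_set (sval c)).
apply: uniq_perm => // v; rewrite !inE mem_filter.
have [->|n1] := eqVneq v (pr1 (the_prism c)); first by symmetry; apply/mem_S.
have [->|n2] := eqVneq v (pr2 (the_prism c)); first by symmetry; apply/mem_S.
by [].
Qed.

(** [None] is the base vertex. *)
Definition mcell := option {s : set V | mixed s}.
Definition mdim (e : mcell) : nat := if e is Some c then pdim c else 0.

Lemma disc_enorm n (x : disc R n) : enorm (val x) <= 1.
Proof. by rewrite enorm_le1; have := set_mem (valP x). Qed.

Definition mchar (e : mcell) : disc R (mdim e) -> midp :=
  match e with
  | Some c => fun x => Some (SigSub (mem_set (pmapc_mid (disc_enorm x))))
  | None => fun _ => None
  end.

Lemma mchar_continuous e : continuous (@mchar e).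
Proof.
case: e => [c|] /=; last exact: (@cst_continuous _ midp None).
apply: midp_plot => /=; split.
  by move=> v; apply: (cont_comp (@cont_pmapc c v)); exact: initial_continuous.
exists (sval c); first exact: mixed_finite.
by move=> x; apply: supp_sub => v; exact: pmapc_off.
Qed.

Lemma mchar_inj e : {in disc_interior R (mdim e) &, injective (@mchar e)}.
Proof.
case: e => [c|] x x' _ _ /=; last first.
  by move=> _; apply: val_inj; apply/rowP => -[].
by move=> [] /pmapc_inj E; exact: val_inj.
Qed.

Lemma mchar_open c : @mchar (Some c) @` disc_interior R (mdim (Some c)) =
  [set m | exists2 y, m = Some y & supp (val y) = sval c].
Proof.
apply/seteqP; split => m.
  move=> [x xi <-]; eexists; first by [].
  by rewrite /=; apply: pmapc_interior; rewrite enorm_lt1.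
move=> [y -> E]; have sy : supp (val y) `<=` sval c by rewrite E.
have [x x1 xE] := pmapc_surj (set_mem (valP y)) sy.
have xd : x \in disc R (pdim c) by rewrite inE /disc /= -enorm_le1.
exists (SigSub xd).
  rewrite /disc_interior /= -enorm_lt1 lt_neqAle x1 andbT.
  by apply/eqP => /pmapc_boundary; rewrite xE E eqxx.
by rewrite /=; congr Some; apply: val_inj.
Qed.

Lemma mchar_open_none : @mchar None @` disc_interior R (mdim None) = [set None].
Proof.
apply/seteqP; split => m; first by move=> [x _ <-].
move=> ->; have x0 : (0 : 'rV[R]_0) \in disc R 0 by rewrite inE /disc /= big_ord0.
by exists (SigSub x0) => //; rewrite /disc_interior /= big_ord0.
Qed.

Lemma mid_mixed y : mid y -> mixed (supp y).
Proof.
move=> [yL yP ynP]; have fy : finite_set (supp y) by have [] := cL yL.2.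
have sp v : 0 < y v -> supp y v by move=> yv; rewrite /supp /= gt_eqF.
split; first exact: yL.2.
  have /wt_gt0P[//| |v Pv yv] : 0 < wt P y by rewrite yP.
    exact: yL.1.
  by exists v => //; exact: sp.
have /wt_gt0P[//| |v Pv yv] : 0 < wt (~` P) y by rewrite ynP.
  exact: yL.1.
by exists v => //; exact: sp.
Qed.

Lemma mixed_ext (c c' : {s | mixed s}) : sval c = sval c' -> c = c'.
Proof. by case: c c' => [s ms] [s' ms'] /= E; exact: eq_exist. Qed.

Lemma mchar_trivIset :
  trivIset [set: mcell] (fun e => @mchar e @` disc_interior R (mdim e)).
Proof.
have oS c m : (@mchar (Some c) @` disc_interior R (mdim (Some c))) m ->
    exists2 y, m = Some y & supp (val y) = sval c by rewrite mchar_open.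
have oN m : (@mchar None @` disc_interior R (mdim None)) m -> m = None.
  by rewrite mchar_open_none.
move=> [c|] [c'|] _ _ [m [h h']] //.
- have [y mE E] := oS _ _ h; have [y' mE' E'] := oS _ _ h'.
  by move: mE'; rewrite mE => -[yy]; congr Some; apply: mixed_ext; rewrite -E -E' yy.
- by have [y mE _] := oS _ _ h; move: mE; rewrite (oN _ h').
- by have [y mE _] := oS _ _ h'; move: mE; rewrite (oN _ h).
Qed.

Lemma mchar_cover :
  \bigcup_e (@mchar e @` disc_interior R (mdim e)) = [set: midp].
Proof.
apply/seteqP; split => // -[y|] _.
  have my := mid_mixed (set_mem (valP y)).
  by exists (Some (exist _ _ my)) => //; rewrite (mchar_open (exist _ _ my)); exists y.
by exists None => //; rewrite mchar_open_none.
Qed.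

Lemma mchar_closure_finite e : exists F : set mcell,
  [/\ finite_set F, forall e', F e' -> (mdim e' < mdim e)%N &
   @mchar e @` disc_boundary R (mdim e) `<=`
     \bigcup_(e' in F) (@mchar e' @` disc_interior R (mdim e'))].
Proof.
case: e => [c|]; last first.
  exists set0; split => // m [x]; rewrite /disc_boundary /= big_ord0 => /eqP.
  by rewrite eq_sym oner_eq0.
pose F : set mcell := [set e | if e is Some c' then
  sval c' `<=` sval c /\ sval c' != sval c else False].
exists F; split.
- pose f (t : {fset V}) : mcell := if pselect (mixed [set` t]) is left h
    then Some (exist _ _ h) else None.
  apply: (@sub_finite_set _ _ (f @` [set` fpowerset (fset_set (sval c))])); last first.
    by apply: finite_image; exact: finite_fset.
  move=> [[t mt]|]//= [tc _].
  have ft : finite_set t := sub_finite_set tc (mixed_finite c).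
  exists (fset_set t).
    rewrite /= fpowersetE; apply/fsubsetP => v.
    rewrite !in_fset_set ?inE//; [exact: tc|exact: mixed_finite].
  have E : [set` fset_set t] = t by rewrite fset_setK.
  rewrite /f; case: pselect => [h|]; last by rewrite E.
  by congr Some; exact: mixed_ext.
- move=> [c'|]//= [sub ne]; rewrite -2!ltnS !pdim_card.
  apply: fproper_ltn_card; rewrite fproperEneq; apply/andP; split.
    apply: contra ne => /eqP E.
    by rewrite -(fset_setK (mixed_finite c')) E fset_setK//; exact: mixed_finite.
  apply/fsubsetP => v; rewrite !in_fset_set ?inE; try exact: mixed_finite.
  exact: sub.
- move=> m [x xb <-].
  have x1 : enorm (val x) = 1 by apply/enorm_eq1.
  have mx := pmapc_mid (disc_enorm x).
  exists (Some (exist _ _ (mid_mixed mx))).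
    split; last exact: pmapc_boundary.
    by apply: supp_sub => v; exact: pmapc_off.
  by rewrite mchar_open /=; eexists.
Qed.

(** A plot meets finitely many simplices. On the part of [Z] over one simplex, [C] is
described by finitely many coordinates, as the image of a closed subset of a disc,
which is compact. *)
Lemma mchar_weak (C : set midp) :
  (forall e, closed (@mchar e @^-1` C)) -> closed C.
Proof.
move=> clC; rewrite -openC midp_openE => Z p pp.
rewrite -closedC.
rewrite (_ : ~` _ = [set z | C (Some (p z))]); last first.
  by apply/seteqP; split => z /=; [move/contrapT | move=> h; exact].
have pL z : in_cx L (val (p z)) by have [] := set_mem (valP (p z)).
have [D [fD DL clD cov]] := plot_cover cL pp pL.
rewrite (_ : [set z | _] =
  \bigcup_(k in D) ([set z | supp (val (p z)) `<=` [set` k]] `&` [set z | C (Some (p z))])).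
  apply: closed_bigcup => // k Dk.
  have [mk|nmk] := pselect (mixed [set` k]); last first.
    rewrite (_ : _ `&` _ = set0); first exact: closed0.
    apply/seteqP; split => // z [/= zk _]; apply: nmk.
    have [_ h1 h2] := mid_mixed (set_mem (valP (p z))).
    split; first exact: DL.
      by have [v v1 v2] := h1; exists v => //; exact: zk.
    by have [v v1 v2] := h2; exists v => //; exact: zk.
  pose c : {s | mixed s} := exist _ _ mk.
  (* the coordinates in the simplex k, in which compactness is used *)
  pose co (y : V -> R) : 'rV[R]_(size k) := \row_j y (nth (pr1 (the_prism c)) k j).
  have co_inj y y' : (forall v, v \notin k -> y v = 0) -> (forall v, v \notin k -> y' v = 0) ->
      co y = co y' -> y = y'.
    move=> y0 y'0 E; apply/funext => v; have [vk|vk] := boolP (v \in k); last first.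
      by rewrite y0// y'0.
    have lt : (index v k < size k)%N by rewrite index_mem.
    have /rowP/(_ (Ordinal lt)) := E; rewrite !mxE /=.
    by rewrite nth_index.
  have cK : compact (co @` (@pmapc c @` (val @` (@mchar (Some c) @^-1` C)))).
    rewrite image_comp image_comp; apply: continuous_compact.
      apply: continuous_subspaceT => x; move: x; apply: rv_cont => j.
      have E : (fun z : disc R (pdim c) => (co \o @pmapc c \o val) z 0 j) =
          fun z => pmapc (val z) (nth (pr1 (the_prism c)) k j).
        by apply/funext => z; rewrite /= mxE.
      have h : continuous (fun z : disc R (pdim c) => pmapc (val z) (nth (pr1 (the_prism c)) k j)).
        by apply: (cont_comp (@cont_pmapc c _)); exact: initial_continuous.
      by rewrite -E in h.
    exact: (subclosed_compact (clC (Some c)) (compact_set_type (@compact_disc R (pdim c)))).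
  rewrite (_ : _ `&` _ = [set z | supp (val (p z)) `<=` [set` k]] `&`
    (fun z => co (val (p z))) @^-1` (co @` (@pmapc c @` (val @` (@mchar (Some c) @^-1` C))))).
    apply: closedI; first exact: clD.
    have cco : continuous (fun z => co (val (p z))).
      apply: rv_cont => j; under eq_fun do rewrite /= mxE; exact: pp.1.
    have clK := compact_closed (@norm_hausdorff R 'rV[R]_(size k)) cK.
    move/continuous_closedP: cco => cco; exact: cco _ clK.
  apply/seteqP; split => z [/= zk h]; split => //.
    have [x x1 xE] := @pmapc_surj c _ (set_mem (valP (p z))) zk.
    have xd : x \in disc R (pdim c) by rewrite inE /disc /= -enorm_le1.
    exists (val (p z)) => //; exists x => //; exists (SigSub xd) => //=.
    rewrite (_ : SigSub _ = p z)//; exact: val_inj.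
  move: h => [_ [_ [x Cx <-] <-] E].
  have {}E : pmapc (val x) = val (p z).
    apply: co_inj E => v vk.
      by apply: (@pmapc_off c) => /= ; apply/negP.
    by apply/eqP; apply: contraNT vk => h; exact: zk.
  move: Cx; rewrite /preimage /=.
  by rewrite (_ : SigSub _ = p z)//; exact: val_inj.
apply/seteqP; split => [z Cz|z [k _ []//]].
by have [k Dk zk] := cov z; exists k.
Qed.

Definition midp_cw : cw_structure R midp :=
  CWStructure midp_hausdorff mchar_continuous mchar_inj mchar_trivIset mchar_cover
    mchar_closure_finite mchar_weak.

Lemma midp_cw_type : has_cw_type R midp.
Proof.
exists midp; last first.
  by exists (hid R midp), (hid R midp); rewrite hcomp1h.
exists midp_cw, (None : mcell); split => //.
change ((@mchar None @` disc_interior R (mdim None)) None).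
by rewrite mchar_open_none.
Qed.

End middle_space.

(** * Loops over the middle and suspensions *)

Section unit_interval_lift.
Context {R : realType}.

Definition toI (t : R) : unitI R := insubd I0 t.

Lemma val_toI t : 0 <= t <= 1 -> val (toI t) = t.
Proof. by move=> t01; rewrite /toI /insubd insubT ?inE//= => h; rewrite t01 in h. Qed.

Lemma toI0 : toI 0 = I0.
Proof. by apply: val_inj; rewrite val_toI//= lexx ler01. Qed.

Lemma toI1 : toI 1 = I1.
Proof. by apply: val_inj; rewrite val_toI//= lexx ler01. Qed.

Lemma unitIP (u : unitI R) : 0 <= (val u : R) <= 1.
Proof. exact: set_mem (valP u). Qed.

Lemma cont_toI {Z : topologicalType} (t : Z -> R) :
  continuous t -> (forall z, 0 <= t z <= 1) -> continuous (fun z => toI (t z)).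
Proof.
move=> ct t01; apply: continuous_comp_initial.
rewrite (_ : _ \o _ = t)//; apply/funext => z /=; exact: val_toI.
Qed.

Lemma compact_unitI : compact [set: unitI R].
Proof.
apply: compact_set_type; rewrite (_ : unitI R = `[0, 1]%classic).
  exact: segment_compact.
by apply/seteqP; split => t; rewrite /unitI /= in_itv.
Qed.

Lemma regular_unitI : regular_space (unitI R).
Proof. exact: uniform_regular. Qed.

Lemma cont_valI {Z : topologicalType} (f : Z -> unitI R) :
  continuous f -> continuous (fun z => val (f z) : R).
Proof. by move=> cf; apply: (cont_comp (@initial_continuous _ _ _)). Qed.

End unit_interval_lift.

Lemma based_ex (X Y : ptopologicalType) (f : X -> Y) : continuous f ->
  f point = point -> exists g : basedMap X Y, forall x, g x = f x.
Proof.
move=> cf pf.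
pose m1 := isContinuous.Build X Y f cf.
pose m2 := isBased.Build X Y f pf.
pose g : basedMap X Y := HB.pack f m1 m2.
by exists g.
Qed.

Section suspension_factor.
Context {R : realType} {V : choiceType} {X : ptopologicalType}.
Variables (L : set (set V)) (P : set V).
Hypothesis cL : cx L.

Lemma insub_plot {Z : topologicalType} (p : Z -> V -> R) :
  plot p -> (forall z, mid L P (p z)) ->
  continuous (fun z => (insub (p z) : @midp R V L P)).
Proof.
move=> pp pm.
pose p' z : set_type (mid L P) := SigSub (mem_set (pm z)).
rewrite (_ : (fun _ => _) = fun z => (Some (p' z) : @midp R V L P)); first exact: midp_plot.
by apply/funext => z; rewrite insubT ?inE//= => ?; congr Some; apply: val_inj.
Qed.

(** A family of loops parametrised by the middle is a based map from the suspension
of the middle with a disjoint base point. It becomes null after composition with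
[f], and a based null homotopy keeps both ends of every loop at the base point. *)
Lemma susp_kill (f : basedMap X X) (m : (V -> R) -> R -> X) :
  Z_Sigma R X (hpi R f) ->
  (forall (Z : topologicalType) (p : Z -> V -> R) (t : Z -> R),
     plot p -> (forall z, mid L P (p z)) -> continuous t ->
     (forall z, 0 <= t z <= 1) -> continuous (fun z => m (p z) (t z))) ->
  (forall y, mid L P y -> m y 0 = point) -> (forall y, mid L P y -> m y 1 = point) ->
  exists M : (V -> R) -> R -> R -> X,
  [/\ forall (Z : topologicalType) (p : Z -> V -> R) (t u : Z -> R),
       plot p -> (forall z, mid L P (p z)) -> continuous t ->
       (forall z, 0 <= t z <= 1) -> continuous u -> (forall z, 0 <= u z <= 1) ->
       continuous (fun z => M (p z) (t z) (u z)),
     forall y t, mid L P y -> 0 <= t <= 1 -> M y t 0 = f (m y t),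
     forall y t, mid L P y -> 0 <= t <= 1 -> M y t 1 = point &
     forall y u, mid L P y -> 0 <= u <= 1 -> M y 0 u = point /\ M y 1 u = point].
Proof.
move=> Zf cm m0 m1.
pose A : ptopologicalType := @midp R V L P.
pose mm (q : A * unitI R) : X := if q.1 is Some y then m (val y) (val q.2) else point.
have cmm : continuous mm.
  apply: (@final_prod_continuous A (unitI R) X (mcell L P)
    (fun e => disc R (mdim cL e)) (fun e => @mchar R V L P cL e) mm).
  - exact: compact_unitI.
  - exact: regular_unitI.
  - exact: mchar_weak.
  - move=> a; have : [set: @midp R V L P] a by [].
    by rewrite -(@mchar_cover R V L P cL) => -[e _ [x _ xE]]; exists e, x.
  - move=> [c|]; rewrite /mm /=; last exact: (@cst_continuous _ X point).
    apply: cm.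
    + split; last first.
        exists (sval c); first exact: (mixed_finite cL).
        by move=> z; apply: supp_sub => v; exact: pmapc_off.
      move=> v; apply: (cont_comp (@cont_pmapc _ _ L P cL c v)).
      apply: (cont_comp (@initial_continuous _ _ _)).
      by move=> z; exact: cvg_fst.
    + by move=> z; apply: pmapc_mid; exact: disc_enorm.
    + by apply: cont_valI => z; exact: cvg_snd.
    + by move=> z; exact: unitIP.
have mm_col q : susp_collapsed q -> mm q = point.
  case: q => [[y|] t] //; rewrite /susp_collapsed /= => -[//|[->|->]]; rewrite /mm /=.
    by apply: m0; exact: set_mem (valP y).
  by apply: m1; exact: set_mem (valP y).
pose pis (q : A * unitI R) : susp R A := (\pi_(quotient_topology {eq_quot (susp_equiv R A)}) q).
pose g0 (q : susp R A) : X := mm (repr q).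
have g0pi q : g0 (pis q) = mm q.
  have : susp_rel (repr (pis q)) q.
    have /eqmodP : pis (repr (pis q)) = pis q by exact: reprK.
    by [].
  by rewrite /g0 => /asboolP[->//|[c1 c2]]; rewrite !mm_col.
(* the loop family descends to the suspension through representatives *)
have cg0 : continuous g0.
  apply/quotient_continuous; rewrite (_ : _ \o _ = mm)//.
  by apply/funext => q; exact: g0pi.
have pg0 : g0 point = point.
  by rewrite (_ : point = pis (point, I0))// g0pi.
have [g gE] := based_ex cg0 pg0.
have := Zf A (@midp_cw_type R V L P cL) (hpi R g).
rewrite hcompE => /hpiP[H [cH H0 H1 Hp]].
have cpis : continuous pis by exact: pi_continuous.
exists (fun y t u => H (pis ((insub y : @midp R V L P), toI t), toI u)); split.
- move=> Z p t u pp pm ct t01 cu u01; apply: (cont_comp cH).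
  apply: pair_continuous; last exact: cont_toI.
  apply: (cont_comp cpis); apply: pair_continuous; last exact: cont_toI.
  exact: insub_plot.
- move=> y t my t01; rewrite toI0 H0 /= gE g0pi /mm /=.
  by rewrite insubT ?inE//= val_toI.
- by move=> y t my t01; rewrite toI1 H1.
- move=> y u my u01; rewrite toI0 toI1; split.
    rewrite (_ : pis _ = point) ?Hp//.
    by apply/eqmodP/asboolP; right; split; [right; left | left].
  rewrite (_ : pis _ = point) ?Hp//.
  by apply/eqmodP/asboolP; right; split; [right; right | left].
Qed.

End suspension_factor.

(** * Reweighting the two sides of a split complex *)

Section split_complex.
Context {R : realType} {V : choiceType}.
Variables (L : set (set V)) (P : set V).
Hypothesis cL : cx L.
Implicit Types y : V -> R.

Definition within_cx (Q : set V) : set (set V) := [set s | L s /\ s `<=` Q].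

Lemma cx_within Q : cx (within_cx Q).
Proof.
move=> s [Ls sQ]; have [fs ns dn] := cL Ls; split => // s' s's ns'.
by split; [exact: dn | exact: subset_trans s's sQ].
Qed.

Lemma in_cx_fin y : in_cx L y -> finite_set (supp y).
Proof. by move=> [_ Ly]; have [] := cL Ly. Qed.

Local Notation wa y := (wt P y).
Local Notation wb y := (wt (~` P) y).

Lemma wa_ge0 y : in_cx L y -> 0 <= wa y.
Proof. by move=> yL; apply: wt_ge0; [exact: in_cx_fin | exact: yL.1]. Qed.

Lemma wb_ge0 y : in_cx L y -> 0 <= wb y.
Proof. by move=> yL; apply: wt_ge0; [exact: in_cx_fin | exact: yL.1]. Qed.

Lemma wab_gt0 y : in_cx L y -> 0 < wa y + wb y.
Proof.
move=> yL; have [v yv] := in_cx_ex cL yL.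
have [Pv|Pv] := pselect (P v).
  apply: ltr_pwDl; last exact: wb_ge0.
  by apply/wt_gt0P; [exact: in_cx_fin | exact: yL.1 | exists v].
apply: ltr_wpDl; first exact: wa_ge0.
by apply/wt_gt0P; [exact: in_cx_fin | exact: yL.1 | exists v].
Qed.

(** The deformations of a split complex multiply the weights inside [P] by one factor and those
outside [P] by another. *)
Definition blend (c1 c2 : R) y : V -> R := fun v => c1 * res P y v + c2 * res (~` P) y v.

Lemma blend_P c1 c2 y v : P v -> blend c1 c2 y v = c1 * y v.
Proof. by move=> Pv; rewrite /blend resE// resN ?mulr0 ?addr0//; exact. Qed.

Lemma blend_nP c1 c2 y v : ~ P v -> blend c1 c2 y v = c2 * y v.
Proof. by move=> Pv; rewrite /blend resN// resE ?mulr0 ?add0r. Qed.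

Lemma supp_blend c1 c2 y : supp (blend c1 c2 y) `<=` supp y.
Proof.
move=> v; rewrite /supp /=; have [Pv|Pv] := pselect (P v).
  by rewrite blend_P// mulf_eq0 negb_or => /andP[].
by rewrite blend_nP// mulf_eq0 negb_or => /andP[].
Qed.

Lemma supp_blend1 c1 y : supp (blend c1 0 y) `<=` P.
Proof.
move=> v; rewrite /supp /=; apply: contra_neqP => Pv.
by rewrite blend_nP// mul0r.
Qed.

Lemma supp_blend2 c2 y : supp (blend 0 c2 y) `<=` ~` P.
Proof.
move=> v; rewrite /supp /=; apply: contra_neqP => /contrapT Pv.
by rewrite blend_P// mul0r.
Qed.

Lemma blend_ge0 c1 c2 y : 0 <= c1 -> 0 <= c2 -> (forall v, 0 <= y v) ->
  forall v, 0 <= blend c1 c2 y v.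
Proof. by move=> h1 h2 y0 v; rewrite addr_ge0// mulr_ge0// res_ge0. Qed.

Lemma plot_blend {Z : topologicalType} (c1 c2 : Z -> R) (p : Z -> V -> R) :
  continuous c1 -> continuous c2 -> plot p ->
  plot (fun z => blend (c1 z) (c2 z) (p z)).
Proof. by move=> h1 h2 pp; apply: plot_lin => //; exact: plot_res. Qed.

Lemma wa_blend c1 c2 y : in_cx L y -> wa (blend c1 c2 y) = c1 * wa y.
Proof.
move=> yL; have fy := in_cx_fin yL; apply: wt_scale => //.
  by apply: (sub_finite_set _ fy); exact: supp_blend.
by move=> v Pv; rewrite blend_P.
Qed.

Lemma wb_blend c1 c2 y : in_cx L y -> wb (blend c1 c2 y) = c2 * wb y.
Proof.
move=> yL; have fy := in_cx_fin yL; apply: wt_scale => //.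
  by apply: (sub_finite_set _ fy); exact: supp_blend.
by move=> v Pv; rewrite blend_nP.
Qed.

Lemma blend_in c1 c2 y : in_cx L y -> 0 <= c1 -> 0 <= c2 ->
  0 < c1 * wa y + c2 * wb y -> in_cx L (blend c1 c2 y).
Proof.
move=> yL h1 h2 pos; apply: (in_cx_sub cL yL).
- by apply: blend_ge0 => //; exact: yL.1.
- exact: supp_blend.
- have fy := in_cx_fin yL.
  have [h|h] := ltP 0 (c1 * wa y).
    have a0 : 0 < wa y by rewrite lt_def wa_ge0// andbT; apply: contraTneq h => ->; rewrite mulr0 ltxx.
    have c0 : 0 < c1 by move: h; rewrite pmulr_lgt0.
    have /wt_gt0P[//||v Pv yv] := a0; first exact: yL.1.
    by exists v; rewrite blend_P// mulr_gt0.
  have {}h : 0 < c2 * wb y by lra.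
  have b0 : 0 < wb y by rewrite lt_def wb_ge0// andbT; apply: contraTneq h => ->; rewrite mulr0 ltxx.
  have c0 : 0 < c2 by move: h; rewrite pmulr_lgt0.
  have /wt_gt0P[//||v Pv yv] := b0; first exact: yL.1.
  by exists v; rewrite blend_nP// mulr_gt0.
Qed.

Lemma in_within Q y : in_cx L y -> supp y `<=` Q -> in_cx (within_cx Q) y.
Proof. by move=> [y0 Ly] yQ; split. Qed.

Lemma fhom_blend {X : topologicalType} (c1 c2 : (V -> R) -> R) (f : (V -> R) -> X) :
  fcont L f -> fcont L c1 -> fcont L c2 ->
  (forall y, in_cx L y -> [/\ 0 <= c1 y, 0 <= c2 y & 0 < c1 y * wa y + c2 y * wb y]) ->
  fhom L f (fun y => f (blend (c1 y) (c2 y) y)).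
Proof.
move=> cf k1 k2 pos; apply: (fhom_lin (q := fun y => blend (c1 y) (c2 y) y)) => //.
  split; last by move=> y yL; have [? ? ?] := pos y yL; exact: blend_in.
  by move=> Z p pp pL; apply: plot_blend => //; [exact: k1 | exact: k2].
move=> y yL; rewrite setUidl; last exact: supp_blend.
exact: yL.2.
Qed.

End split_complex.

(** * A map that is null on both sides *)

Section gluing_null_homotopies.
Context {R : realType} {V : choiceType} {X : ptopologicalType}.
Variables (L : set (set V)) (P : set V) (g : (V -> R) -> X) (f : basedMap X X).
Hypotheses (cL : cx L) (cg : fcont L g) (Zf : Z_Sigma R X (hpi R f)).
Variables G1 G2 : (V -> R) -> R -> X.
Hypotheses (cG1 : hcont (within_cx L P) G1) (cG2 : hcont (within_cx L (~` P)) G2).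
Hypotheses (G10 : forall y, in_cx (within_cx L P) y -> G1 y 0 = g y)
  (G11 : forall y, in_cx (within_cx L P) y -> G1 y 1 = point)
  (G20 : forall y, in_cx (within_cx L (~` P)) y -> G2 y 0 = g y)
  (G21 : forall y, in_cx (within_cx L (~` P)) y -> G2 y 1 = point).

Local Notation wa y := (wt P y).
Local Notation wb y := (wt (~` P) y).

(** Write [a] and [b] for the weights inside and outside [P]. The points with
[2 * b <= a] are pushed into the subcomplex on [P], where [G1] is defined, those with
[2 * a <= b] into the one on the complement, where [G2] is defined, and the others
stay in the middle. *)
Definition push1 (y : V -> R) : R := Num.max 0 (2 * wa y - wb y).
Definition push2 (y : V -> R) : R := Num.max 0 (2 * wb y - wa y).
Definition push (y : V -> R) : V -> R := blend P (push1 y) (push2 y) y.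

Lemma push_pos y : in_cx L y -> [/\ 0 <= push1 y, 0 <= push2 y &
  0 < push1 y * wa y + push2 y * wb y].
Proof.
move=> yL; have a0 := wa_ge0 P cL yL; have b0 := wb_ge0 P cL yL; have ab := wab_gt0 P cL yL.
rewrite /push1 /push2 !le_max !lexx; split => //.
have [h|h] := ltP (wb y) (2 * wa y).
  apply: ltr_pwDl; last by rewrite mulr_ge0// le_max lexx.
  by rewrite mulr_gt0 ?lt_max; [|apply/orP; right|]; lra.
apply: ltr_wpDl; first by rewrite mulr_ge0// le_max lexx.
by rewrite mulr_gt0 ?lt_max; [|apply/orP; right|]; lra.
Qed.

Lemma fcont_push1 : fcont L push1.
Proof.
move=> Z p pp pL; apply: contmax; first exact: contK.
by apply: contD; [apply: contM; [exact: contK|]|apply: contN]; exact: wt_cont.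
Qed.

Lemma fcont_push2 : fcont L push2.
Proof.
move=> Z p pp pL; apply: contmax; first exact: contK.
by apply: contD; [apply: contM; [exact: contK|]|apply: contN]; exact: wt_cont.
Qed.

Lemma push_in1 y : in_cx L y -> 2 * wb y <= wa y -> in_cx (within_cx L P) (push y).
Proof.
move=> yL h; have [h1 h2 h3] := push_pos yL; apply: in_within; first exact: blend_in.
rewrite /push (_ : push2 y = 0); first exact: supp_blend1.
by rewrite /push2; apply/max_idPl; lra.
Qed.

Lemma push_in2 y : in_cx L y -> 2 * wa y <= wb y -> in_cx (within_cx L (~` P)) (push y).
Proof.
move=> yL h; have [h1 h2 h3] := push_pos yL; apply: in_within; first exact: blend_in.
rewrite /push (_ : push1 y = 0); first exact: supp_blend2.
by rewrite /push1; apply/max_idPl; lra.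
Qed.

(** The null homotopies run for a time proportional to the distance from the middle
region: not at all at its border, where [g \o push] is kept, and completely at the
far ends. *)
Definition collapse (y : V -> R) (t : R) : X :=
  if 2 * wb y <= wa y then G1 (push y) (t * ((wa y - 2 * wb y) / (wa y + wb y)))
  else if 2 * wa y <= wb y then G2 (push y) (t * ((wb y - 2 * wa y) / (wa y + wb y)))
  else g (push y).

Lemma plot_push {Z : topologicalType} (p : Z -> V -> R) :
  plot p -> (forall z, in_cx L (p z)) -> plot (fun z => push (p z)).
Proof.
by move=> pp pL; apply: plot_blend => //; [exact: fcont_push1 | exact: fcont_push2].
Qed.

Lemma push_in y : in_cx L y -> in_cx L (push y).
Proof. by move=> yL; have [h1 h2 h3] := push_pos yL; exact: blend_in. Qed.

Lemma hcont_collapse : hcont L collapse.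
Proof.
move=> Z p t pp pL ct t01.
have ca := wt_cont P pp; have cb := wt_cont (~` P) pp.
have cpush := plot_push pp pL.
have c2 : continuous (fun _ : Z => 2 : R) by exact: contK.
have ab z := wab_gt0 P cL (pL z).
have cabV : continuous (fun z => (wa (p z) + wb (p z))^-1).
  by apply: contV; [move=> z; rewrite gt_eqF | exact: contD].
apply: (glue_le (c := fun z => 2 * wb (p z)) (d := fun z => wa (p z))) => //.
- exact: contM.
- move=> Y j cj h; rewrite /collapse; under eq_fun do rewrite h.
  apply: (cG1 (p := fun z => push (p (j z)))
    (t := fun z => t (j z) * ((wa (p (j z)) - 2 * wb (p (j z))) / (wa (p (j z)) + wb (p (j z)))))).
  + exact: (plot_comp cj cpush).
  + by move=> z; exact: push_in1.
  + apply: (cont_comp (g := fun z => t z * ((wa (p z) - 2 * wb (p z)) / (wa (p z) + wb (p z)))) _ cj).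
    by apply: contM => //; apply: contM => //; apply: contD => //; apply: contN; exact: contM.
  + move=> z; have /andP[t0 t1] := t01 (j z); have hz := h z; have abz := ab (j z).
    have b0 := wb_ge0 P cL (pL (j z)).
    have d0 : 0 <= (wa (p (j z)) - 2 * wb (p (j z))) / (wa (p (j z)) + wb (p (j z))).
      by apply: divr_ge0; [lra | exact: ltW].
    rewrite mulr_ge0//= mulr_ile1// ler_pdivrMr//; lra.
move=> Y j cj h.
apply: (glue_le (c := fun z => 2 * wa (p (j z))) (d := fun z => wb (p (j z)))).
- apply: (cont_comp (g := fun z => 2 * wa (p z)) _ cj); exact: contM.
- by apply: (cont_comp (g := fun z => wb (p z)) _ cj).
- move=> Y' j' cj' h'.
  rewrite (_ : (fun _ => _) = fun z => G2 (push (p (j (j' z))))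
    (t (j (j' z)) * ((wb (p (j (j' z))) - 2 * wa (p (j (j' z)))) / (wa (p (j (j' z))) + wb (p (j (j' z))))))); last first.
    apply/funext => z; rewrite /collapse h'; case: ifPn => // hz.
    by exfalso; have := ab (j (j' z)); have := h' z; lra.
  apply: (cG2 (p := fun z => push (p (j (j' z))))
    (t := fun z => t (j (j' z)) * ((wb (p (j (j' z))) - 2 * wa (p (j (j' z)))) /
      (wa (p (j (j' z))) + wb (p (j (j' z))))))).
  + exact: (plot_comp cj' (plot_comp cj cpush)).
  + by move=> z; exact: push_in2.
  + apply: (cont_comp (g := fun z => t z * ((wb (p z) - 2 * wa (p z)) / (wa (p z) + wb (p z))))).
      by apply: contM => //; apply: contM => //; apply: contD => //; apply: contN; exact: contM.
    exact: (cont_comp cj cj').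
  + move=> z; have /andP[t0 t1] := t01 (j (j' z)); have hz := h' z; have abz := ab (j (j' z)).
    have b0 := wa_ge0 P cL (pL (j (j' z))).
    have d0 : 0 <= (wb (p (j (j' z))) - 2 * wa (p (j (j' z)))) / (wa (p (j (j' z))) + wb (p (j (j' z)))).
      by apply: divr_ge0; [lra | exact: ltW].
    rewrite mulr_ge0//= mulr_ile1// ler_pdivrMr//; lra.
- move=> Y' j' cj' h'.
  rewrite (_ : (fun _ => _) = fun z => g (push (p (j (j' z))))).
    apply: (cg (p := fun z => push (p (j (j' z))))).
      exact: (plot_comp cj' (plot_comp cj cpush)).
    by move=> z; exact: push_in.
  apply/funext => z; rewrite /collapse.
  have hz := h (j' z); have hz' := h' z.
  case: ifPn => [e|_].
    rewrite (_ : wa _ - 2 * wb _ = 0); last by lra.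
    by rewrite mul0r mulr0 G10//; exact: push_in1.
  case: ifPn => // e.
  rewrite (_ : wb _ - 2 * wa _ = 0); last by lra.
  by rewrite mul0r mulr0 G20//; exact: push_in2.
Qed.

(** Homotopic to [g], and constant on each of the two subcomplexes. *)
Definition flat (y : V -> R) : X := collapse y 1.

Lemma fcont_flat : fcont L flat.
Proof.
move=> Z p pp pL; apply: (hcont_collapse pp pL (t := fun=> 1)); first exact: contK.
by move=> z; rewrite ler01 lexx.
Qed.

Lemma fhom_flat : fhom L g flat.
Proof.
apply: (@fhom_trans _ _ _ _ _ (fun y => g (push y))).
  apply: (@fhom_blend _ _ L P cL _ push1 push2) => //.
  - exact: fcont_push1.
  - exact: fcont_push2.
  - exact: push_pos.
exists collapse; split => //; first exact: hcont_collapse.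
move=> y yL; rewrite /collapse !mul0r; case: ifPn => [e|_].
  by rewrite G10//; exact: push_in1.
by case: ifPn => // e; rewrite G20//; exact: push_in2.
Qed.

Lemma flat1 y : in_cx L y -> wb y = 0 -> flat y = point.
Proof.
move=> yL b0; have a0 : 0 < wa y by have := wab_gt0 P cL yL; rewrite b0 addr0.
rewrite /flat /collapse b0 mulr0 (ltW a0) subr0 addr0 mul1r divff ?gt_eqF// G11//.
by apply: push_in1 => //; rewrite b0 mulr0 ltW.
Qed.

Lemma flat2 y : in_cx L y -> wa y = 0 -> flat y = point.
Proof.
move=> yL a0; have b0 : 0 < wb y by have := wab_gt0 P cL yL; rewrite a0 add0r.
rewrite /flat /collapse a0 leNgt mulr_gt0//= mulr0 subr0 add0r (ltW b0) mul1r.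
rewrite divff ?gt_eqF// G21//.
by apply: push_in2 => //; rewrite a0 mulr0 ltW.
Qed.

(** The position between the two sides: 0 for [2 * a <= b], 1 for [2 * b <= a]. The
reweighting by [spread1] and [spread2] moves a point of the middle region to the
point with weights [ratio] and [1 - ratio] over the same point of the middle, and
all other points into one of the two subcomplexes. The second argument of the
maxima only prevents division by zero: it is not larger than the first wherever
the numerator is not zero. *)
Definition ratio (y : V -> R) : R :=
  Num.max 0 (Num.min 1 ((2 * wa y - wb y) / (wa y + wb y))).
Definition spread1 (y : V -> R) : R := ratio y / Num.max (wa y) ((wa y + wb y) / 3).
Definition spread2 (y : V -> R) : R := (1 - ratio y) / Num.max (wb y) ((wa y + wb y) / 3).

Lemma ratio01 y : 0 <= ratio y <= 1.
Proof. by rewrite /ratio le_max lexx ge_max ler01 ge_min lexx. Qed.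

Lemma fcont_ratio : fcont L ratio.
Proof.
move=> Z p pp pL; have ca := wt_cont P pp; have cb := wt_cont (~` P) pp.
apply: contmax; first exact: contK; apply: contmin; first exact: contK.
apply: contM.
  by apply: contD; [apply: contM => //; exact: contK | exact: contN].
by apply: contV; [move=> z; rewrite gt_eqF// (wab_gt0 P cL) | exact: contD].
Qed.

Lemma spread_den (y : V -> R) (w : R) : in_cx L y -> 0 < Num.max w ((wa y + wb y) / 3).
Proof. by move=> yL; rewrite lt_max divr_gt0 ?orbT ?(wab_gt0 P cL). Qed.

Lemma fcont_spread1 : fcont L spread1.
Proof.
move=> Z p pp pL; have ca := wt_cont P pp; have cb := wt_cont (~` P) pp.
apply: contM; first exact: fcont_ratio.
apply: contV; first by move=> z; rewrite gt_eqF// spread_den.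
by apply: contmax => //; apply: contM; [exact: contD | exact: contK].
Qed.

Lemma fcont_spread2 : fcont L spread2.
Proof.
move=> Z p pp pL; have ca := wt_cont P pp; have cb := wt_cont (~` P) pp.
apply: contM.
  by apply: contD; [exact: contK | apply: contN; exact: fcont_ratio].
apply: contV; first by move=> z; rewrite gt_eqF// spread_den.
by apply: contmax => //; apply: contM; [exact: contD | exact: contK].
Qed.

Lemma ratio_le y : in_cx L y -> 0 < ratio y -> wb y < 2 * wa y.
Proof.
move=> yL; rewrite /ratio lt_max ltxx /= lt_min ltr01 /= pmulr_lgt0 ?invr_gt0 ?(wab_gt0 P cL)//.
lra.
Qed.

Lemma ratio_ge y : in_cx L y -> ratio y < 1 -> wa y < 2 * wb y.
Proof.
move=> yL; rewrite /ratio gt_max ltr01 /= gt_min ltxx /= ltr_pdivrMr ?(wab_gt0 P cL)//.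
lra.
Qed.

Lemma spread1E y : in_cx L y -> wb y <= 2 * wa y -> spread1 y = ratio y / wa y.
Proof. by move=> yL h; rewrite /spread1 (max_idPl _)//; lra. Qed.

Lemma spread2E y : in_cx L y -> wa y <= 2 * wb y -> spread2 y = (1 - ratio y) / wb y.
Proof. by move=> yL h; rewrite /spread2 (max_idPl _)//; lra. Qed.

Lemma spread_pos y : in_cx L y -> [/\ 0 <= spread1 y, 0 <= spread2 y &
  0 < spread1 y * wa y + spread2 y * wb y].
Proof.
move=> yL; have a0 := wa_ge0 P cL yL; have b0 := wb_ge0 P cL yL; have ab := wab_gt0 P cL yL.
have /andP[r0 r1] := ratio01 y.
have s1 : 0 <= spread1 y by rewrite divr_ge0// ltW// spread_den.
have s2 : 0 <= spread2 y by rewrite divr_ge0 ?subr_ge0// ltW// spread_den.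
split => //; have [rp|rn] := ltP 0 (ratio y).
  apply: ltr_pwDl; last exact: mulr_ge0.
  have := ratio_le yL rp => h.
  by rewrite mulr_gt0 ?divr_gt0 ?spread_den//; lra.
apply: ltr_wpDl; first exact: mulr_ge0.
have r11 : ratio y < 1 by lra.
have := ratio_ge yL r11 => h.
by rewrite mulr_gt0 ?divr_gt0 ?spread_den//; lra.
Qed.

(** The projection of the points with weight on both sides to the middle. *)
Definition center (y : V -> R) : V -> R := blend P (wa y)^-1 (wb y)^-1 y.

Lemma center_mid y : in_cx L y -> 0 < wa y -> 0 < wb y -> mid L P (center y).
Proof.
move=> yL a0 b0; split.
- by apply: blend_in => //; rewrite ?invr_ge0 ?ltW// !mulVf ?gt_eqF// ltr0n.
- by rewrite (wa_blend P cL)// mulVf// gt_eqF.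
- by rewrite (wb_blend P cL)// mulVf// gt_eqF.
Qed.

(** The segment through a point of the middle, from one subcomplex to the other; its
image is a loop because [flat] is constant on the subcomplexes. *)
Definition prism_path (y : V -> R) (t : R) : X := flat (blend P t (1 - t) y).

Lemma blend_mid (y : V -> R) (t : R) : mid L P y -> 0 <= t <= 1 ->
  [/\ in_cx L (blend P t (1 - t) y), wa (blend P t (1 - t) y) = t &
     wb (blend P t (1 - t) y) = 1 - t].
Proof.
move=> [yL yP ynP] /andP[t0 t1]; split.
- by apply: blend_in => //; rewrite ?subr_ge0// yP ynP; lra.
- by rewrite (wa_blend P cL)// yP mulr1.
- by rewrite (wb_blend P cL)// ynP mulr1.
Qed.

(** After the reweighting, [flat] is constant outside the middle region, and inside it
is the family of loops [prism_path], which [f] makes null by [susp_kill]. Since the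
null homotopy fixes the ends of the loops, it extends by the base point. *)
Lemma glue_null : fhom L (fun y => f (g y)) (fun=> point).
Proof.
apply: (@fhom_trans _ _ _ _ _ (fun y => f (flat (blend P (spread1 y) (spread2 y) y)))).
  apply: (fhom_comp (@cts_fun _ _ f)); apply: fhom_trans fhom_flat _.
  apply: fhom_blend => //.
  - exact: fcont_flat.
  - exact: fcont_spread1.
  - exact: fcont_spread2.
  - exact: spread_pos.
have [M [cM M0 M1 Mb]] : exists M : (V -> R) -> R -> R -> X,
  [/\ forall (Z : topologicalType) (p : Z -> V -> R) (t u : Z -> R),
       plot p -> (forall z, mid L P (p z)) -> continuous t ->
       (forall z, 0 <= t z <= 1) -> continuous u -> (forall z, 0 <= u z <= 1) ->
       continuous (fun z => M (p z) (t z) (u z)),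
     forall y t, mid L P y -> 0 <= t <= 1 -> M y t 0 = f (prism_path y t),
     forall y t, mid L P y -> 0 <= t <= 1 -> M y t 1 = point &
     forall y u, mid L P y -> 0 <= u <= 1 -> M y 0 u = point /\ M y 1 u = point].
  apply: (susp_kill cL Zf).
  - move=> Z p t pp pm ct t01.
    apply: (fcont_flat (p := fun z => blend P (t z) (1 - t z) (p z))).
      by apply: plot_blend => //; apply: contD; [exact: contK | exact: contN].
    by move=> z; have [] := blend_mid (pm z) (t01 z).
  - move=> y my; have [|h1 h2 h3] := @blend_mid y 0 my; first by rewrite lexx ler01.
    exact: flat2.
  - move=> y my; have [|h1 h2 h3] := @blend_mid y 1 my; first by rewrite lexx ler01.
    by apply: flat1 => //; rewrite h3 subrr.
(* the null homotopy of the loops on the middle region, the base point elsewhere *)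
pose N (y : V -> R) (u : R) := if wb y <= 2 * wa y then if wa y <= 2 * wb y then
  M (center y) (ratio y) u else point else point.
have mid_pos (y : V -> R) : in_cx L y -> wb y <= 2 * wa y -> wa y <= 2 * wb y -> 0 < wa y /\ 0 < wb y.
  by move=> yL h1 h2; have := wab_gt0 P cL yL; split; lra.
have r0 (y : V -> R) : in_cx L y -> 2 * wa y <= wb y -> ratio y = 0.
  move=> yL h; apply/eqP; rewrite eq_le; have /andP[-> _] := ratio01 y; rewrite andbT leNgt.
  by apply/negP => /(ratio_le yL); lra.
have r1 (y : V -> R) : in_cx L y -> 2 * wb y <= wa y -> ratio y = 1.
  move=> yL h; apply/eqP; rewrite eq_le; have /andP[_ ->] := ratio01 y; rewrite /= leNgt.
  by apply/negP => /(ratio_ge yL); lra.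
exists N; split.
- move=> Z p t pp pL ct t01.
  have ca := wt_cont P pp; have cb := wt_cont (~` P) pp.
  have c2 : continuous (fun _ : Z => 2 : R) by exact: contK.
  apply: (glue_le (c := fun z => wb (p z)) (d := fun z => 2 * wa (p z))) => //.
  + exact: contM.
  + move=> Y j cj h; rewrite /N; under eq_fun do rewrite h.
    apply: (glue_le (c := fun z => wa (p (j z))) (d := fun z => 2 * wb (p (j z)))).
    * exact: (cont_comp ca cj).
    * by apply: (cont_comp (g := fun z => 2 * wb (p z)) _ cj); exact: contM.
    * move=> Y' j' cj' h'; under eq_fun do rewrite h'.
      have pp' := plot_comp cj' (plot_comp cj pp).
      have pos z := mid_pos _ (pL (j (j' z))) (h (j' z)) (h' z).
      apply: (cM _ (fun z => center (p (j (j' z)))) (fun z => ratio (p (j (j' z)))) (fun z => t (j (j' z)))).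
      - apply: plot_blend => //; apply: contV; rewrite /=; try (by move=> z; rewrite gt_eqF//; have [] := pos z);
        exact: wt_cont pp'.
      - by move=> z; have [? ?] := pos z; exact: center_mid.
      - by apply: (fcont_ratio pp').
      - by move=> z; exact: ratio01.
      - exact: (cont_comp ct (cont_comp cj cj')).
      - by [].
    * move=> Y' j' cj' h'; rewrite (_ : (fun _ => _) = fun=> point); first exact: cst_continuous.
      apply/funext => z; case: ifPn => // e.
      have [a0 b0] := mid_pos _ (pL (j (j' z))) (h (j' z)) e.
      rewrite r1//.
      by have [] := Mb _ (t (j (j' z))) (center_mid (pL (j (j' z))) a0 b0) (t01 _).
  + move=> Y j cj h; rewrite (_ : (fun _ => _) = fun=> point); first exact: cst_continuous.
    apply/funext => z; rewrite /N; case: ifPn => // e; case: ifPn => // e'.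
    have [a0 b0] := mid_pos _ (pL (j z)) e e'.
    rewrite r0//.
    by have [] := Mb _ (t (j z)) (center_mid (pL (j z)) a0 b0) (t01 _).
- move=> y yL; rewrite /N; have [s1 s2 s12] := spread_pos yL.
  have bin := blend_in cL yL s1 s2 s12.
  case: ifPn => [e|]; last first.
    rewrite -ltNge => e; rewrite flat2 ?map_point//.
    by rewrite (wa_blend P cL)// /spread1 r0 ?mul0r// ltW.
  case: ifPn => [e'|]; last first.
    rewrite -ltNge => e'; rewrite flat1 ?map_point//.
    by rewrite (wb_blend P cL)// /spread2 r1 ?subrr ?mul0r// ltW.
  have [a0 b0] := mid_pos _ yL e e'.
  rewrite M0; [|exact: center_mid|exact: ratio01].
  congr (f (flat _)); apply/funext => v.
  have [Pv|Pv] := pselect (P v).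
    by rewrite /center !blend_P// spread1E// mulrA.
  by rewrite /center !blend_nP// spread2E// mulrA.
- move=> y yL; rewrite /N; case: ifPn => // e; case: ifPn => // e'.
  have [a0 b0] := mid_pos _ yL e e'.
  by rewrite M1//; [exact: center_mid | exact: ratio01].
Qed.

End gluing_null_homotopies.

(** * Induction over the labels *)

Definition joined {R : realType} {Y : topologicalType} (x y : Y) :=
  exists2 c : unitI R -> Y, continuous c & c I0 = x /\ c I1 = y.

Definition path_connected (R : realType) (X : ptopologicalType) :=
  forall x : X, joined (R := R) x point.

Section labels.
Context {R : realType} {V : choiceType} {X : ptopologicalType} {k : nat}.
Variables (U : 'I_k -> set X) (L : set (set V)) (r : (V -> R) -> X) (l : V -> 'I_k).
Hypotheses (gL : good U L r l) (pX : path_connected R X).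
Hypothesis cU : forall j, contractible_in R (U j).

Definition on_labels (J : {set 'I_k}) := within_cx L [set v | l v \in J].

Lemma cx_on_labels J : cx (on_labels J).
Proof. by apply: cx_within; exact: good_cx gL. Qed.

Lemma fcont_on_labels J : fcont (on_labels J) r.
Proof.
move=> Z p pp pL; apply: (good_fcont gL) => // z.
by have [y0 [Ls _]] := pL z.
Qed.

(** All stars of the subcomplex go into the contractible set [U j]; a path joins the
point to which it contracts to the base point. *)
Lemma null_on_label j : fhom (on_labels [set j]) r (fun=> point).
Proof.
have [c [H [cH H0 H1]]] := cU j; have [d cd [d0 d1]] := pX c.
have rU y : in_cx (on_labels [set j]) y -> U j (r y).
  move=> yL; have [v yv] := in_cx_ex (@cx_on_labels _) yL.
  have lv : l v = j.
    by have := yL.2.2 v; rewrite /supp /= gt_eqF// inE => /(_ isT)/eqP.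
  have {}yL : in_cx L y by have [y0 [Ls _]] := yL.
  by rewrite -lv; exact: (good_lab gL).
apply: (@fhom_trans _ _ _ _ _ (fun=> c)).
  exists (fun y t => if (insub (r y) : option (U j)) is Some u then H (u, toI t) else point).
  have E y t (yU : U j (r y)) :
      (if (insub (r y) : option (U j)) is Some u then H (u, toI t) else point) =
      H (SigSub (mem_set yU), toI t).
    rewrite insubT ?inE// => ry; congr (H (_, _)); exact: val_inj.
  split.
  - move=> Z p t pp pL ct t01.
    have pU z := rU _ (pL z).
    under eq_fun do rewrite (E _ _ (pU _)).
    apply: (cont_comp cH); apply: pair_continuous; last exact: cont_toI.
    apply: continuous_comp_initial; exact: fcont_on_labels pL.
  - by move=> y yL; rewrite (E _ _ (rU _ yL)) toI0 H0.
  - by move=> y yL; rewrite (E _ _ (rU _ yL)) toI1 H1.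
exists (fun _ t => d (toI t)); split => [Z p t pp pL ct t01|y _|y _].
- by apply: (cont_comp cd); exact: cont_toI.
- by rewrite toI0.
- by rewrite toI1.
Qed.

Lemma split_labels (J : {set 'I_k}) n : (#|J| <= n + n)%N ->
  exists J1 : {set 'I_k}, (#|J1| <= n)%N /\ (#|J :\: J1| <= n)%N.
Proof.
move=> Jn; pose J1 := [set x in take n (enum J)]; exists J1.
have c1 : (#|J1| <= n)%N.
  by rewrite cardsE (leq_trans (card_size _))// size_take_min geq_minl.
split => //.
have -> : J :\: J1 = [set x in drop n (enum J)].
  apply/setP => x; rewrite !inE -[x \in J]mem_enum -{2}(cat_take_drop n (enum J)) mem_cat.
  have := enum_uniq J; rewrite -{1}(cat_take_drop n (enum J)) cat_uniq => /and3P[_ /hasPn h _].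
  case: (boolP (x \in take n (enum J))) => //= xt.
  by apply/esym/negP => /h /=; rewrite xt.
rewrite cardsE (leq_trans (card_size _))// size_drop -cardE.
by rewrite leq_subLR.
Qed.

(** The labels are split into two halves. The induction hypothesis applies to the
inner composite on each half, and the outermost map merges them. *)
Lemma null_on_labels (fs : seq (basedMap X X)) (J : {set 'I_k}) :
  (forall f, List.In f fs -> Z_Sigma R X (hpi R f)) -> (#|J| <= 2 ^ size fs)%N ->
  fhom (on_labels J) (fun y => foldr (fun (f : basedMap X X) x => f x) (r y) fs)
    (fun=> point).
Proof.
elim: fs J => [|f fs ih] J Zfs /=.
  rewrite expn0; case: (set_0Vmem J) => [->|[j jJ]] J1.
    have no y : in_cx (on_labels finset.set0) y -> False.
      move=> yL; have [v yv] := in_cx_ex (@cx_on_labels _) yL.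
      by have := yL.2.2 v; rewrite /supp /= gt_eqF// inE => /(_ isT).
    exists (fun _ _ => point); split.
    - by move=> Z p t pp pL ct t01; exact: cst_continuous.
    - by move=> y /no.
    - by [].
  have -> : J = [set j]%SET.
    by apply/esym/eqP; rewrite finset.eqEcard finset.sub1set jJ finset.cards1.
  exact: null_on_label.
rewrite expnS mul2n -addnn => /split_labels[J1 [c1 c2]].
have cJ := @cx_on_labels J.
have Zfs' g : List.In g fs -> Z_Sigma R X (hpi R g) by move=> h; apply: Zfs; right.
have s1 : within_cx (on_labels J) [set v | l v \in J1] `<=` on_labels J1.
  by move=> s [[Ls _] sJ].
have s2 : within_cx (on_labels J) (~` [set v | l v \in J1]) `<=` on_labels (J :\: J1).
  move=> s [[Ls sJ] sJ1]; split => // v sv /=; rewrite finset.in_setD.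
  by rewrite (sJ _ sv) andbT; apply/negP; exact: sJ1.
have [H1 [cH1 H10 H11]] := fhom_subcx s1 (ih J1 Zfs' c1).
have [H2 [cH2 H20 H21]] := fhom_subcx s2 (ih (J :\: J1) Zfs' c2).
apply: (@glue_null R V X (on_labels J) [set v | l v \in J1]
  (fun y => foldr (fun (f : basedMap X X) x => f x) (r y) fs) f cJ _ _ H1 H2) => //.
  move=> Z p pp pL.
  have cu := fcont_on_labels pp pL.
  elim: (fs) => [|f' fs' ih'] /=; first exact: cu.
  by apply: (cont_comp (@cts_fun _ _ f') ih').
by apply: Zfs; left.
Qed.

End labels.

(** * From free to based null homotopies *)

Section based_end.
Context {R : realType} {V : choiceType} {X : ptopologicalType}.
Variables (L : set (set V)) (v0 : V) (g : (V -> R) -> X).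
Hypotheses (cL : cx L) (cg : fcont L g) (Lv0 : L [set v0]).

Definition vertex : V -> R := fun v => (v == v0)%:R.

Lemma supp_vertex : supp vertex = [set v0].
Proof.
apply/seteqP; split => v; rewrite /supp /vertex /=.
  by case: (eqVneq v v0) => // _; rewrite eqxx.
by move=> ->; rewrite eqxx oner_eq0.
Qed.

Lemma vertex_in : in_cx L vertex.
Proof. by split; [move=> v; rewrite /vertex ler0n | rewrite supp_vertex]. Qed.

Local Notation P := [set v0].
Local Notation wa y := (wt P y).
Local Notation wb y := (wt (~` P) y).

Lemma waE (y : V -> R) : in_cx L y -> wa y = y v0.
Proof.
move=> yL; have fy := in_cx_fin cL yL.
have fU : finite_set (supp y `|` P) by rewrite finite_setU; split.
have yU : supp y `<=` supp y `|` P by move=> v; left.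
rewrite (wtE P fU yU) (bigD1_seq v0) ?fset_uniq//=; last first.
  by rewrite in_fset_set// inE; right.
rewrite resE// big1 ?addr0// => v /eqP vn; rewrite resN//.
Qed.

Lemma wa_vertex : wa vertex = 1.
Proof. by rewrite (waE vertex_in) /vertex eqxx. Qed.

Lemma wb_vertex : wb vertex = 0.
Proof.
apply/eqP; rewrite eq_le (wb_ge0 _ cL vertex_in) andbT leNgt; apply/negP.
move/wt_gt0P => -[||v vn]; [exact: (in_cx_fin cL vertex_in)|exact: vertex_in.1|].
by rewrite /vertex; move/eqP/negbTE: vn => ->; rewrite ltxx.
Qed.

(** [pinch] sends the points near the vertex, those with at least as much weight at
[v0] as elsewhere, to the vertex itself, and is a deformation of the identity.
[slack] is 0 at the vertex and 1 away from this neighbourhood. *)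
Definition pinch1 (y : V -> R) : R := (Num.max (wa y) ((wa y + wb y) / 2))^-1.
Definition pinch2 (y : V -> R) : R := Num.max 0 (wb y - wa y).
Definition pinch (y : V -> R) : V -> R := blend P (pinch1 y) (pinch2 y) y.
Definition slack (y : V -> R) : R := Num.min 1 (2 * wb y / (wa y + wb y)).

Lemma pinch_den (y : V -> R) : in_cx L y -> 0 < Num.max (wa y) ((wa y + wb y) / 2).
Proof. by move=> yL; rewrite lt_max divr_gt0 ?orbT ?(wab_gt0 P cL). Qed.

Lemma pinch_pos (y : V -> R) : in_cx L y -> [/\ 0 <= pinch1 y, 0 <= pinch2 y &
  0 < pinch1 y * wa y + pinch2 y * wb y].
Proof.
move=> yL; have a0 := wa_ge0 P cL yL; have b0 := wb_ge0 P cL yL; have ab := wab_gt0 P cL yL.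
have p1 : 0 < pinch1 y by rewrite invr_gt0 pinch_den.
have p2 : 0 <= pinch2 y by rewrite le_max lexx.
split => //; first exact: ltW.
have [ap|an] := ltP 0 (wa y).
  by apply: ltr_pwDl; [exact: mulr_gt0 | exact: mulr_ge0].
apply: ltr_wpDl; first by rewrite mulr_ge0// ltW.
by rewrite mulr_gt0 ?lt_max; [|apply/orP; right|]; lra.
Qed.

Lemma fcont_pinch1 : fcont L pinch1.
Proof.
move=> Z p pp pL; have ca := wt_cont P pp; have cb := wt_cont (~` P) pp.
apply: contV; first by move=> z; rewrite gt_eqF// pinch_den.
by apply: contmax => //; apply: contM; [exact: contD | exact: contK].
Qed.

Lemma fcont_pinch2 : fcont L pinch2.
Proof.
move=> Z p pp pL; have ca := wt_cont P pp; have cb := wt_cont (~` P) pp.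
by apply: contmax; [exact: contK | apply: contD => //; exact: contN].
Qed.

Lemma fcont_slack : fcont L slack.
Proof.
move=> Z p pp pL; have ca := wt_cont P pp; have cb := wt_cont (~` P) pp.
apply: contmin; first exact: contK; apply: contM.
  by apply: contM => //; exact: contK.
by apply: contV; [move=> z; rewrite gt_eqF// (wab_gt0 P cL) | exact: contD].
Qed.

Lemma slack01 (y : V -> R) : in_cx L y -> 0 <= slack y <= 1.
Proof.
move=> yL; rewrite /slack ge_min lexx le_min ler01 /= andbT.
by rewrite divr_ge0 ?mulr_ge0 ?(wb_ge0 P cL)// ltW// (wab_gt0 P cL).
Qed.

Lemma slack_vertex : slack vertex = 0.
Proof. by rewrite /slack wb_vertex mulr0 mul0r; apply/min_idPr; exact: ler01. Qed.

Lemma pinch_vertexE (y : V -> R) : in_cx L y -> wb y <= wa y -> pinch y = vertex.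
Proof.
move=> yL h; apply/funext => v; rewrite /pinch /vertex.
have [->|/eqP vn] := eqVneq v v0.
  rewrite blend_P// /pinch1 (max_idPl _); last by lra.
  by rewrite -(waE yL) mulVf// gt_eqF//; have := wab_gt0 P cL yL; lra.
by rewrite blend_nP// /pinch2 (max_idPl _) ?mul0r//; lra.
Qed.

Lemma slack1 (y : V -> R) : in_cx L y -> wa y <= wb y -> slack y = 1.
Proof.
move=> yL h; apply/min_idPl; rewrite ler_pdivlMr ?(wab_gt0 P cL)//; lra.
Qed.

Lemma pinch_in (y : V -> R) : in_cx L y -> in_cx L (pinch y).
Proof. by move=> yL; have [? ? ?] := pinch_pos yL; exact: blend_in. Qed.

Lemma plot_pinch {Z : topologicalType} (p : Z -> V -> R) :
  plot p -> (forall z, in_cx L (p z)) -> plot (fun z => pinch (p z)).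
Proof.
by move=> pp pL; apply: plot_blend => //; [exact: fcont_pinch1 | exact: fcont_pinch2].
Qed.

(** A free null homotopy moves the vertex along a loop. After pinching, the points of
a collar of the vertex can follow this loop for a time that decreases to 0 at the
vertex, while all points outside the collar reach the base point, which is the end
of the loop; then every point lies on the loop and is moved back along it. *)
Lemma fhom_based : g vertex = point -> fhom L g (fun=> point) ->
  exists H, [/\ hcont L H, forall y, in_cx L y -> H y 0 = g y,
    forall y, in_cx L y -> H y 1 = point &
    forall t, 0 <= t <= 1 -> H vertex t = point].
Proof.
move=> gv [G [cG G0 G1]].
pose H1 (y : V -> R) (t : R) := g (fun v => (1 - t) * y v + t * pinch y v).
pose H2 y t := G (pinch y) (t * slack y).
pose H3 y t := G vertex ((1 - t) * slack y).
pose cat (A B : (V -> R) -> R -> X) y (t : R) := if t <= 2^-1 then A y (2 * t) else B y (2 * t - 1).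
have vin := vertex_in.
have pv : pinch vertex = vertex.
  by apply: pinch_vertexE => //; rewrite wa_vertex wb_vertex ler01.
have cH1 : hcont L H1.
  apply: hcont_lin => //.
    split; last exact: pinch_in.
    by move=> Z p pp pL; exact: plot_pinch.
  move=> y yL; rewrite setUidl; [exact: yL.2 | exact: supp_blend].
have cH2 : hcont L H2.
  move=> Z p t pp pL ct t01; apply: (cG _ (fun z => pinch (p z)) (fun z => t z * slack (p z))).
  - exact: plot_pinch.
  - by move=> z; exact: pinch_in.
  - by apply: contM => //; exact: fcont_slack.
  - move=> z; have /andP[t0 t1] := t01 z; have /andP[s0 s1] := slack01 (pL z).
    by rewrite mulr_ge0//= mulr_ile1.
have cH3 : hcont L H3.
  move=> Z p t pp pL ct t01; apply: (cG _ (fun=> vertex) (fun z => (1 - t z) * slack (p z))).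
  - split; first by move=> v; exact: contK.
    by exists [set v0]; [exact: finite_set1 | move=> _; rewrite supp_vertex].
  - by [].
  - apply: contM; last exact: fcont_slack.
    by apply: contD; [exact: contK | exact: contN].
  - move=> z; have /andP[t0 t1] := t01 z; have /andP[s0 s1] := slack01 (pL z).
    by rewrite mulr_ge0 ?subr_ge0//= mulr_ile1// ?subr_ge0//; lra.
have H12 y : in_cx L y -> H1 y 1 = H2 y 0.
  move=> yL; rewrite /H1 /H2 mul0r G0; last exact: pinch_in.
  by congr g; apply/funext => v; rewrite subrr mul0r add0r mul1r.
have H23 y : in_cx L y -> cat H1 H2 y 1 = H3 y 0.
  move=> yL; rewrite /cat leNgt invf_lt1 ?ltr0n// ltr1n /= mulr1.
  rewrite (_ : 2 - 1 = 1 :> R); last by ring.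
  rewrite /H2 /H3 subr0 !mul1r.
  have [h|h] := leP (wa y) (wb y).
    by rewrite slack1// !G1//; exact: pinch_in.
  by rewrite pinch_vertexE// ltW.
exists (cat (cat H1 H2) H3); split.
- by apply: hcont_concat => //; exact: hcont_concat.
- move=> y yL; rewrite /cat !mulr0 !invr_ge0 ler0n /H1.
  by congr g; apply/funext => v; rewrite subr0 mul1r mul0r addr0.
- move=> y yL; rewrite /cat leNgt invf_lt1 ?ltr0n// ltr1n /= mulr1.
  rewrite (_ : 2 - 1 = 1 :> R); last by ring.
  by rewrite /H3 subrr mul0r G0.
- have G00 : G vertex 0 = point by rewrite G0.
  have E2 t : H2 vertex t = point by rewrite /H2 pv slack_vertex mulr0.
  have E3 t : H3 vertex t = point by rewrite /H3 slack_vertex mulr0.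
  have E1 t : H1 vertex t = point.
    rewrite /H1 pv (_ : (fun _ => _) = vertex)//; apply/funext => v; ring.
  by move=> t _; rewrite /cat; case: ifP => _; [case: ifP|].
Qed.

End based_end.

(** * The map over a disc and a net for it *)

Section vectors.
Context {R : realType} {Z : topologicalType}.

Lemma contvD n (f g : Z -> 'rV[R]_n) : continuous f -> continuous g ->
  continuous (fun z => f z + g z).
Proof.
move=> cf cg; apply: rv_cont => j; under eq_fun do rewrite mxE.
by apply: contD; exact: cont_coord.
Qed.

Lemma contvZ n (a : Z -> R) (f : Z -> 'rV[R]_n) : continuous a -> continuous f ->
  continuous (fun z => a z *: f z).
Proof.
move=> ca cf; apply: rv_cont => j; under eq_fun do rewrite mxE.
by apply: contM => //; exact: cont_coord.
Qed.

Lemma contvnorm n (f : Z -> 'rV[R]_n) : continuous f -> continuous (fun z => `|f z|).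
Proof. by move=> cf z; apply: cvg_norm; exact: cf. Qed.

Lemma contvsum n (I : Type) (r : seq I) (P : pred I) (F : I -> Z -> 'rV[R]_n) :
  (forall i, continuous (F i)) -> continuous (fun z => \sum_(i <- r | P i) F i z).
Proof.
move=> cF; elim: r => [|i r ih].
  by under eq_fun do rewrite big_nil; exact: cst_continuous.
under eq_fun do rewrite big_cons.
by case: (P i) => //; apply: contvD.
Qed.

End vectors.

Lemma open_at {Z T Y : topologicalType} (A : set T) (g : T -> Y) x :
  open A -> A x -> continuous (fun a : A => g (val a)) -> {for x, continuous g}.
Proof.
move=> oA Ax cg O nO.
have [_ [[B oB <-] Bx] sB] := cg (SigSub (mem_set Ax)) O nO.
apply: (filterS (P := B `&` A)).
  by move=> y [By Ay]; apply: (sB (SigSub (mem_set Ay))).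
by apply: open_nbhs_nbhs; split; [exact: openI | split].
Qed.

Section direction.
Context {R : realType} {n : nat}.
Implicit Types x : 'rV[R]_n.

Definition dir x : 'rV[R]_n := (enorm x)^-1 *: x.

Lemma enorm_dir x : 0 < enorm x -> enorm (dir x) = 1.
Proof. by move=> x0; rewrite enormZ ?invr_ge0 ?ltW// mulVf// gt_eqF. Qed.

Lemma dir_id x : enorm x = 1 -> dir x = x.
Proof. by move=> x1; rewrite /dir x1 invr1 scale1r. Qed.

Lemma dirZ (c : R) x : 0 < c -> dir (c *: x) = dir x.
Proof.
move=> c0; rewrite /dir enormZ ?ltW// scalerA; congr (_ *: _).
by rewrite invfM mulrAC mulVf ?mul1r// gt_eqF.
Qed.

Lemma cont_dir {Z : topologicalType} (f : Z -> 'rV[R]_n) : continuous f ->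
  (forall z, 0 < enorm (f z)) -> continuous (fun z => dir (f z)).
Proof.
move=> cf f0; apply: contvZ => //; apply: contV; last exact: cont_enorm.
by move=> z; rewrite gt_eqF.
Qed.

End direction.

(** The data for attaching a cell of dimension [n] to a complex [L0] over the cover.
[Phi] is the map to be approximated on the disc, [q] the map to [L0] already
constructed on the sphere, and [eta] a homotopy from [r0 \o q] to [Phi] on the sphere,
constant up to the time [c]. *)
Section cell_setup.
Context {R : realType} {V : choiceType} {X : topologicalType} {k : nat}.
Variables (U : 'I_k -> set X) (L0 : set (set V)) (r0 : (V -> R) -> X) (l0 : V -> 'I_k).
Hypotheses (g0 : good U L0 r0 l0) (oU : forall j, open (U j)).
Hypothesis covU : \bigcup_j U j = [set: X].
Variables (n : nat) (Phi : 'rV[R]_n -> X) (q : 'rV[R]_n -> V -> R).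
Variables (eta : 'rV[R]_n -> R -> X) (c : R).
Hypothesis cPhi : forall (Z : topologicalType) (f : Z -> 'rV[R]_n), continuous f ->
  (forall z, enorm (f z) <= 1) -> continuous (fun z => Phi (f z)).
Hypothesis pq : forall (Z : topologicalType) (f : Z -> 'rV[R]_n), continuous f ->
  (forall z, enorm (f z) = 1) -> plot (fun z => q (f z)).
Hypothesis qL : forall x, enorm x = 1 -> in_cx L0 (q x).
Hypothesis ceta : forall (Z : topologicalType) (f : Z -> 'rV[R]_n) (t : Z -> R),
  continuous f -> (forall z, enorm (f z) = 1) -> continuous t ->
  (forall z, 0 <= t z <= 1) -> continuous (fun z => eta (f z) (t z)).
Hypotheses (c_gt0 : 0 < c) (c_le1 : c <= 1).
Hypothesis eta0 : forall x t, enorm x = 1 -> 0 <= t <= c -> eta x t = r0 (q x).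
Hypothesis eta1 : forall x, enorm x = 1 -> eta x 1 = Phi x.

(** [Phi] extended to the whole space by following [eta] backwards along the rays;
beyond the radius [2 - c] it is [r0 \o q] of the direction. *)
Definition Psi (x : 'rV[R]_n) : X :=
  if enorm x <= 1 then Phi x
  else if enorm x <= 2 then eta (dir x) (2 - enorm x) else r0 (q (dir x)).

Lemma cont_rq {Z : topologicalType} (f : Z -> 'rV[R]_n) : continuous f ->
  (forall z, 0 < enorm (f z)) -> continuous (fun z => r0 (q (dir (f z)))).
Proof.
move=> cf f0; have cd := cont_dir cf f0; have d1 z := enorm_dir (f0 z).
by apply: (good_fcont g0 (p := fun z => q (dir (f z)))); [exact: pq | move=> z; exact: qL].
Qed.

Lemma cont_Psi {Z : topologicalType} (f : Z -> 'rV[R]_n) :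
  continuous f -> continuous (fun z => Psi (f z)).
Proof.
move=> cf; have cN := cont_enorm cf.
apply: (glue_le (c := fun z => enorm (f z)) (d := fun=> 1)) => //; first exact: contK.
- move=> Y j cj h; rewrite /Psi; under eq_fun do rewrite h.
  by apply: cPhi => //; exact: cont_comp cf cj.
move=> Y j cj h; have cfj := cont_comp cf cj.
have pos y : 0 < enorm (f (j y)) by exact: lt_le_trans (h y).
apply: (glue_le (c := fun y => enorm (f (j y))) (d := fun=> 2)).
- exact: cont_comp cN cj.
- exact: contK.
- move=> Y' j' cj' h'.
  rewrite (_ : (fun _ => _) = fun y => eta (dir (f (j (j' y)))) (2 - enorm (f (j (j' y))))).
    have cfj' := cont_comp cfj cj'.
    apply: ceta.
    + by apply: cont_dir => // y; exact: pos.
    + by move=> y; exact: enorm_dir.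
    + by apply: contD; [exact: contK | apply: contN; exact: cont_enorm].
    + by move=> y; have := h (j' y); have := h' y; lra.
  apply/funext => y; rewrite /Psi h'; case: ifPn => // e.
  have e1 : enorm (f (j (j' y))) = 1 by apply/le_anti; rewrite e h.
  by rewrite e1 dir_id// (_ : 2 - 1 = 1 :> R) ?eta1//; ring.
- move=> Y' j' cj' h'.
  rewrite (_ : (fun _ => _) = fun y => r0 (q (dir (f (j (j' y)))))).
    by apply: cont_rq; [exact: cont_comp cfj cj' | move=> y; exact: pos].
  apply/funext => y; rewrite /Psi.
  have -> : (enorm (f (j (j' y))) <= 1) = false.
    by apply/negbTE; rewrite -ltNge; have /= := h' y; lra.
  case: ifPn => // e.
  have e2 : enorm (f (j (j' y))) = 2 by apply/le_anti; rewrite e h'.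
  by rewrite eta0 ?enorm_dir// e2 subrr lexx ltW.
Qed.

Lemma Psi_in x : enorm x <= 1 -> Psi x = Phi x.
Proof. by rewrite /Psi => ->. Qed.

Lemma Psi_out x : 2 - c <= enorm x -> Psi x = r0 (q (dir x)).
Proof.
move=> h; rewrite /Psi; have x0 : 0 < enorm x by move: h c_le1; lra.
have cc := c_le1; have cc0 := c_gt0.
case: ifPn => [e|].
  have e1 : enorm x = 1 by apply/le_anti; rewrite e /=; lra.
  by rewrite -eta1// dir_id// eta0//; lra.
move=> e; case: ifPn => // e'.
by rewrite eta0 ?enorm_dir//; lra.
Qed.

Lemma Psi_mid x t : enorm x = 1 -> 0 <= t <= 1 -> Psi ((2 - t) *: x) = eta x t.
Proof.
move=> x1 t01; have cc := c_le1; have cc0 := c_gt0; rewrite /Psi enormZ ?x1; last by lra.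
rewrite mulr1 dirZ; last by lra.
rewrite dir_id//; case: ifPn => [e|].
  have -> : t = 1 by lra.
  by rewrite eta1// (_ : 2 - 1 = 1 :> R) ?scale1r//; ring.
move=> e; have -> : 2 - t <= 2 by lra.
by congr eta; ring.
Qed.

(** Rescaled so that [r0 \o q] is reached at the radius 1/2: the collar of the disc
between this radius and 1 is the place where the old and the new complex meet. *)
Definition Rim (x : 'rV[R]_n) : X := Psi (4 *: x).

Lemma cont_Rim {Z : topologicalType} (f : Z -> 'rV[R]_n) :
  continuous f -> continuous (fun z => Rim (f z)).
Proof. by move=> cf; apply: cont_Psi; apply: contvZ => //; exact: contK. Qed.

Lemma Rim_out x : 2^-1 <= enorm x -> Rim x = r0 (q (dir x)).
Proof.
move=> h; rewrite /Rim Psi_out; first by rewrite dirZ// ltr0n.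
rewrite enormZ ?ler0n//; have : 4 * 2^-1 = 2 :> R by field.
by have := c_gt0; lra.
Qed.

(** A reason for a label at [x]: a member of the cover around [Rim x] for points inside
the disc, a vertex [w] of the old complex whose star contains [q (dir x)] near the
sphere. *)
Definition spot (a : 'I_k + V) (x : 'rV[R]_n) : Prop :=
  match a with
  | inl j => U j (Rim x) /\ enorm x < 1
  | inr w => 2^-1 < enorm x /\ 0 < q (dir x) w
  end.

Lemma rv_id n' : continuous (fun x : 'rV[R]_n' => x). Proof. by move=> x; exact: cvg_id. Qed.

Lemma open_lt_pre {Z : topologicalType} (f : Z -> R) (e : R) :
  continuous f -> open [set z | f z < e].
Proof. by move=> /continuousP cf; exact: (cf _ (@open_lt _ e)). Qed.

Lemma open_gt_pre {Z : topologicalType} (f : Z -> R) (e : R) :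
  continuous f -> open [set z | e < f z].
Proof. by move=> /continuousP cf; exact: (cf _ (@open_gt _ e)). Qed.

Lemma open_enorm_lt (e : R) : open [set x : 'rV[R]_n | enorm x < e].
Proof. by apply: open_lt_pre; exact: (cont_enorm (@rv_id n)). Qed.

Lemma open_enorm_gt (e : R) : open [set x : 'rV[R]_n | e < enorm x].
Proof. by apply: open_gt_pre; exact: (cont_enorm (@rv_id n)). Qed.

Lemma spot_nbhs x : enorm x <= 1 -> exists a, nbhs x (spot a).
Proof.
rewrite le_eqVlt => /orP[/eqP x1|x1].
  have [w xw] := in_cx_ex (good_cx g0) (qL x1).
  exists (inr w).
  pose A := [set y : 'rV[R]_n | 2^-1 < enorm y].
  have Ax : A x by rewrite /A /= x1 invf_lt1 ?ltr0n// ltr1n.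
  have oA : open A by exact: open_enorm_gt.
  have A0 (a : A) : 0 < enorm (val a).
    by apply: lt_trans (set_mem (valP a)); rewrite invr_gt0 ltr0n.
  have cq : {for x, continuous (fun y => q (dir y) w)}.
    have cd : continuous (fun a : A => dir (val a)).
      by apply: cont_dir => //; exact: initial_continuous.
    have [h _] := pq cd (fun a => enorm_dir (A0 a)).
    exact: (open_at oA Ax (h w)).
  have nq : nbhs x [set y | 0 < q (dir y) w].
    have n0 : nbhs (q (dir x) w) [set t : R | 0 < t].
      by apply: open_nbhs_nbhs; split; [exact: open_gt | rewrite /= dir_id].
    exact: (cq _ n0).
  have nA : nbhs x A by exact: open_nbhs_nbhs.
  by apply: filterS (filterI nA nq) => y [].
have : [set: X] (Rim x) by [].
rewrite -covU => -[j _ Uj]; exists (inl j).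
have n1 : nbhs x [set y | U j (Rim y)].
  by apply: (cont_Rim (@rv_id n) (x := x)); exact: open_nbhs_nbhs.
have n2 : nbhs x [set y | enorm y < 1].
  by apply: open_nbhs_nbhs; split => //; exact: open_enorm_lt.
by apply: filterS (filterI n1 n2) => y [].
Qed.

(** The Lebesgue number of the cover of the disc by the sets with a common reason. *)
Lemma spot_lebesgue : exists2 d : R, 0 < d &
  forall x, enorm x <= 1 -> exists a, forall y, `|y - x| < d -> spot a y.
Proof.
pose Q (d : R) (x : 'rV[R]_n) := exists a, forall y, `|y - x| < d -> spot a y.
have := @compact_disc R n; rewrite compact_near_coveringP.
move=> /(_ R (0^'+)%R Q _) [].
  move=> x; rewrite /disc /= -enorm_le1 => /spot_nbhs[a].
  move=> /nbhs_ballP[e /= e0 eS].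
  exists (ball x (e / 2), [set d | 0 < d < e / 2]); first split => /=.
  - by apply: nbhsx_ballx; exact: divr_gt0.
  - near=> d; apply/andP; split => //.
    near: d; apply: nbhs_right_lt; exact: divr_gt0.
  - move=> [y d] /= [xy /andP[d0 de]]; exists a => w wy; apply: eS.
    rewrite mx_norm_ball /ball_ /=; move: xy; rewrite mx_norm_ball /ball_ /= => xy.
    have -> : x - w = (x - y) + (y - w) by rewrite addrA subrK.
    apply: le_lt_trans (ler_normD _ _) _; rewrite (distrC y w); lra.
move=> e e0 eQ.
exists (e / 2); first exact: divr_gt0.
move=> x x1; apply: (eQ (e / 2)); rewrite /= ?sub0r ?normrN; first last.
- by rewrite /disc /= -enorm_le1.
- exact: divr_gt0.
- by rewrite gtr0_norm ?divr_gt0// ltr_pdivrMr// ltr_pMr// ltr1n.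
Unshelve. all: by end_near. Qed.

(** A net of the disc in which ball [i] carries the label [lab i] on the concentric ball
with radius [4 * d]. The balls with [isb i] are those near the sphere; they also carry
the vertex [psi i] of the old complex, to which their new vertex will be joined. The
other balls keep away from the sphere. *)
Definition cell_net (d : R) (m : nat) (F : nat -> 'rV[R]_n) (lab : nat -> 'I_k)
    (isb : nat -> bool) (psi : nat -> V) : Prop :=
  [/\ 0 < d, forall x, enorm x <= 1 -> exists2 i, (i < m)%N & `|x - F i| < d,
    forall i x, (i < m)%N -> `|x - F i| < 4 * d -> U (lab i) (Rim x),
    forall i x, (i < m)%N -> isb i -> `|x - F i| < 4 * d ->
      2^-1 < enorm x /\ 0 < q (dir x) (psi i) &
    (forall i, (i < m)%N -> isb i -> lab i = l0 (psi i)) /\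
    forall i x, (i < m)%N -> ~~ isb i -> enorm x = 1 -> 4 * d <= `|x - F i| ].

Lemma cell_net_ex : (exists v : V, True) -> exists d m F lab isb psi, cell_net d m F lab isb psi.
Proof.
move=> [v0 _].
have [d d0 dS] := spot_lebesgue.
have d40 : 0 < d / 4 by exact: divr_gt0.
have [D DI Dcov] : exists2 D : {fset 'rV[R]_n}, {subset D <= [pred x | enorm x <= 1]} &
    forall x, enorm x <= 1 -> exists2 y, y \in D & `|x - y| < d / 4.
  have := @compact_disc R n; rewrite compact_cover.
  move=> /(_ _ (disc R n) (fun x => [set y | `|y - x| < d / 4])) [].
  - move=> x _; apply: open_lt_pre; apply: contvnorm; apply: contvD; first exact: rv_id.
    exact: cst_continuous.
  - by move=> x xD; exists x => //=; rewrite subrr normr0.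
  move=> D DI Dcov; exists D.
    by move=> x /DI; rewrite inE /disc /= -enorm_le1.
  by move=> x; rewrite enorm_le1 => /Dcov[y yD xy]; exists y.
have [a aS] : exists a : 'rV[R]_n -> 'I_k + V,
    forall x, enorm x <= 1 -> forall y, `|y - x| < d -> spot (a x) y.
  have [|a aS] := @choice _ _ (fun x a => enorm x <= 1 -> forall y, `|y - x| < d -> spot a y).
    move=> x; have [x1|x1] := pselect (enorm x <= 1).
      by have [a aS] := dS x x1; exists a.
    by exists (inr v0).
  by exists a.
pose F i := nth 0 D i.
have FD i : (i < size D)%N -> enorm (F i) <= 1.
  by move=> iD; have /DI := mem_nth 0 iD; rewrite inE.
have E4 : 4 * (d / 4) = d by field.
exists (d / 4), (size D), F,
  (fun i => match a (F i) with inl j => j | inr w => l0 w end),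
  (fun i => if a (F i) is inr _ then true else false),
  (fun i => if a (F i) is inr w then w else v0).
split => //.
- move=> x /Dcov[y yD xy]; exists (index y D); first by rewrite index_mem.
  by rewrite /F nth_index.
- move=> i x iD; rewrite E4 => xF; have := aS _ (FD i iD) x xF.
  case: (a (F i)) => [j [] //|w [h qw]]; rewrite Rim_out ?ltW//.
  have x0 : 0 < enorm x by apply: lt_trans h; rewrite invr_gt0 ltr0n.
  by apply: (good_lab g0) => //; apply: qL; exact: enorm_dir.
- move=> i x iD; rewrite E4 => + xF; have := aS _ (FD i iD) x xF.
  by case: (a (F i)).
- split; first by move=> i iD; case: (a (F i)).
  move=> i x iD ib x1; rewrite E4 leNgt; apply/negP => xF.
  have := aS _ (FD i iD) x xF; move: ib; case: (a (F i)) => // j _ [_].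
  by rewrite x1 ltxx.
Qed.

(** * The new simplices and the map on them *)

Lemma sum_gt0 (p : nat) (Q : pred 'I_p) (a : 'I_p -> R) i0 :
  (forall i, 0 <= a i) -> Q i0 -> 0 < a i0 -> 0 < \sum_(i < p | Q i) a i.
Proof.
move=> a0 Qi ai; rewrite (bigD1 i0)//=; apply: ltr_pwDl => //.
by apply: sumr_ge0 => i _.
Qed.

Lemma sum_gt0_ex (p : nat) (Q : pred 'I_p) (a : 'I_p -> R) :
  (forall i, 0 <= a i) -> 0 < \sum_(i < p | Q i) a i -> exists2 i, Q i & 0 < a i.
Proof.
move=> a0 S0; apply: contrapT => h; move: S0; rewrite big1 ?ltxx// => i Qi.
apply/eqP; rewrite eq_le a0 andbT leNgt; apply/negP => ai.
by apply: h; exists i.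
Qed.

Variables (d : R) (m : nat) (F : nat -> 'rV[R]_n) (lab : nat -> 'I_k).
Variables (isb : nat -> bool) (psi : nat -> V) (iota : nat -> V).
Hypothesis net : cell_net d m F lab isb psi.
Hypotheses (iota_inj : injective iota) (fresh : forall s, L0 s -> forall i, ~ s (iota i)).

Let d0 : 0 < d. Proof. by have [] := net. Qed.

Lemma q_in x : 0 < enorm x -> in_cx L0 (q (dir x)).
Proof. by move=> x0; apply: qL; exact: enorm_dir. Qed.

Lemma half_pos (x : R) : 2^-1 < x -> 0 < x.
Proof. by apply: lt_trans; rewrite invr_gt0 ltr0n. Qed.

Lemma old_not_new (y : V -> R) v i : in_cx L0 y -> 0 < y v -> v <> iota i.
Proof.
by move=> [y0 Ly] yv E; apply: (fresh Ly (i := i)); rewrite -E /supp /= gt_eqF.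
Qed.

Lemma psi_old i j : (i < m)%N -> isb i -> psi i <> iota j.
Proof.
move=> im ib; have [_ _ _ h _] := net.
have [|h1 h2] := h i (F i) im ib; first by rewrite subrr normr0 mulr_gt0.
exact: (old_not_new (q_in (half_pos h1)) h2).
Qed.

(** For a point [z] of a new simplex, [tnew z] is the weight of the new vertices and
[bary z] their barycentre in the disc, where [iota i] sits at the centre of ball [i].
The weight of the old vertices is measured by [told z], as a sum over the balls, so
that a vertex counts once for each ball that carries it. *)
Definition news : set V := [set v | exists j, v = iota j].
Definition tnew (z : V -> R) : R := \sum_(i < m) z (iota i).
Definition told (z : V -> R) : R := \sum_(i < m | isb i) z (psi i).
Definition bary (z : V -> R) : 'rV[R]_n := (tnew z)^-1 *: \sum_(i < m) z (iota i) *: F i.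
Definition pushf (w : nat -> R) : V -> R := fun v => \sum_(i < m | isb i) w i * (psi i == v)%:R.
Definition excess (z : V -> R) : R := Num.max 0 (tnew z - told z) ^+ 2.
(** The point of the old complex that represents [z] over the sphere. Both terms are
quadratic in [z], so that [mix] is compatible with scaling. When there are only new
vertices the first term vanishes and the second gives [q] at the barycentre, in
agreement with [Rim]; when the old weights dominate, the second term vanishes. *)
Definition mix (z : V -> R) : V -> R := fun v =>
  told z * (res (~` news) z v + pushf (fun i => z (iota i)) v) + excess z * q (dir (bary z)) v.

(** The vertices near [x]: the new vertices of the balls around [x] and, if [x] lies on the
sphere, the old vertices of these balls. *)
Definition star (x : 'rV[R]_n) (s : set V) : Prop := forall v, s v ->
  (exists i, [/\ (i < m)%N, v = iota i & `|x - F i| < d]) \/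
  (enorm x = 1 /\ exists i, [/\ (i < m)%N, isb i, v = psi i & `|x - F i| < d]).

(** The nerve of the balls, and over the sphere the mapping cylinder of [psi]. *)
Definition Lnew (s : set V) : Prop := exists x,
  [/\ enorm x <= 1, exists2 i, (i < m)%N & s (iota i) & star x s].

Definition L1 (s : set V) : Prop := L0 s \/ Lnew s.

Lemma near_isb x i : enorm x = 1 -> (i < m)%N -> `|x - F i| < d -> isb i.
Proof.
move=> x1 im xi; apply: contrapT => /negP ib.
by have [_ _ _ _ [_ h]] := net; have := h i x im ib x1; have := d0; lra.
Qed.

(** Why the old vertices fit together: close to a point [x] of the sphere, the vertices
of all balls around [x] belong to the support of a single [q (dir y)], for every
nearby [y]. *)
Lemma near_out x y : enorm x = 1 -> `|x - y| < d -> 2^-1 < enorm y /\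
  forall i, (i < m)%N -> isb i -> `|x - F i| < d -> 0 < q (dir y) (psi i).
Proof.
move=> x1 xy; have [_ hcov _ h _] := net.
have near i : `|x - F i| < d -> `|y - F i| < 4 * d.
  move=> xi; have -> : y - F i = (y - x) + (x - F i) by rewrite addrA subrK.
  by apply: le_lt_trans (ler_normD _ _) _; rewrite distrC; have := d0; lra.
split.
  have [|i im xi] := hcov x; first by rewrite x1.
  by have [] := h i y im (near_isb x1 im xi) (near _ xi).
by move=> i im ib xi; have [] := h i y im ib (near _ xi).
Qed.

Lemma mean_near (x : 'rV[R]_n) (w : nat -> R) : (forall i, 0 <= w i) ->
  0 < \sum_(i < m) w i -> (forall i, (i < m)%N -> 0 < w i -> `|x - F i| < d) ->
  `|x - (\sum_(i < m) w i)^-1 *: (\sum_(i < m) w i *: F i)| < d.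
Proof.
move=> w0 T0 near; set T := \sum_(i < m) w i in T0 *.
have -> : x - T^-1 *: (\sum_(i < m) w i *: F i) = T^-1 *: (\sum_(i < m) w i *: (x - F i)).
  rewrite -[in LHS](scale1r x) -(mulVf (lt0r_neq0 T0)) -scalerA -scalerBr; congr (_ *: _).
  rewrite /T scaler_suml -sumrB; apply: eq_bigr => i _; by rewrite scalerBr.
rewrite normrZ gtr0_norm ?invr_gt0// ltr_pdivrMl//.
apply: le_lt_trans (ler_norm_sum _ _ _) _.
rewrite -subr_gt0 /T mulr_suml -sumrB.
have [i _ wi] := sum_gt0_ex (fun i : 'I_m => w0 i) T0.
have tm (j : 'I_m) : 0 < w j -> 0 < w j * d - `|w j *: (x - F j)|.
  by move=> wj; rewrite normrZ gtr0_norm// -mulrBr mulr_gt0// subr_gt0 near.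
apply: (sum_gt0 (i0 := i)) => //; last exact: tm.
move=> j; have := w0 j; rewrite le_eqVlt => /orP[/eqP <-|/tm/ltW//].
by rewrite scale0r normr0 mul0r subr0.
Qed.

Section point_of_star.
Variables (x : 'rV[R]_n) (z : V -> R).
Hypotheses (z0 : forall v, 0 <= z v) (zM : star x (supp z)).

Lemma new_near i : 0 < z (iota i) -> (i < m)%N /\ `|x - F i| < d.
Proof.
move=> zi; have [|[i' [im' /iota_inj ->]]|[_ [i' [im' ib' E]]]] := zM (v := iota i).
- by rewrite /supp /= gt_eqF.
- by [].
- by exfalso; apply: (psi_old (j := i) im' ib').
Qed.

Lemma tnew_ge0 : 0 <= tnew z. Proof. exact: sumr_ge0. Qed.
Lemma told_ge0 : 0 <= told z. Proof. exact: sumr_ge0. Qed.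

Lemma bary_near : 0 < tnew z -> `|x - bary z| < d.
Proof.
move=> t0; apply: (mean_near (w := fun i => z (iota i))) => // i im zi.
by have [] := new_near zi.
Qed.

Lemma tnew_gt0 i : 0 < z (iota i) -> 0 < tnew z.
Proof.
move=> zi; have [im _] := new_near zi.
by apply: (@sum_gt0 _ predT (fun i : 'I_m => z (iota i)) (Ordinal im)).
Qed.

Lemma told_gt0 i : (i < m)%N -> isb i -> 0 < z (psi i) -> 0 < told z.
Proof.
by move=> im ib zi; apply: (@sum_gt0 _ (fun i : 'I_m => isb i) (fun i : 'I_m => z (psi i)) (Ordinal im)).
Qed.

Lemma star_case v : 0 < z v -> (exists i, v = iota i /\ 0 < tnew z) \/
  (enorm x = 1 /\ exists i, [/\ (i < m)%N, isb i, v = psi i, `|x - F i| < d & 0 < told z]).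
Proof.
move=> zv; have [|[i [im E xi]]|[x1 [i [im ib E xi]]]] := zM (v := v).
- by rewrite /supp /= gt_eqF.
- by left; exists i; split => //; apply: (tnew_gt0 (i := i)); rewrite -E.
- by right; split => //; exists i; split => //; apply: (told_gt0 (i := i)); rewrite -?E.
Qed.

Lemma told_out : 0 < told z -> enorm x = 1.
Proof.
move=> /(sum_gt0_ex (fun i : 'I_m => z0 _))[i ib zi].
have [[j [E _]]|[]//] := star_case zi.
by exfalso; exact: (psi_old (ltn_ord i) ib E).
Qed.

Lemma pushf_ge0 (w : nat -> R) v : (forall i, 0 <= w i) -> 0 <= pushf w v.
Proof. by move=> w0; apply: sumr_ge0 => i _; rewrite mulr_ge0. Qed.

Lemma pushf_pos (w : nat -> R) v : (forall i, 0 <= w i) -> pushf w v != 0 ->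
  exists i, [/\ (i < m)%N, isb i, psi i = v & 0 < w i].
Proof.
move=> w0 h; have : 0 < pushf w v by rewrite lt_def h pushf_ge0.
move=> /sum_gt0_ex[|i ib]; first by move=> i; rewrite mulr_ge0.
case: eqP => [E|_]; rewrite ?mulr0 ?ltxx// mulr1 => wi.
by exists i.
Qed.

Lemma excess_ge0 : 0 <= excess z. Proof. exact: sqr_ge0. Qed.

Hypothesis ne : exists v, 0 < z v.

Lemma tnew_or_told : 0 < tnew z \/ 0 < told z.
Proof.
have [v zv] := ne; have [[i [_ ?]]|[_ [i []]]] := star_case zv; first by left.
by right.
Qed.

Lemma excess_bary : enorm x = 1 -> excess z != 0 -> tnew z != 0 /\ 0 < enorm (bary z).
Proof.
move=> x1 e; have t0 : tnew z != 0.
  apply: contraNneq e => t0.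
  by rewrite /excess t0 sub0r (max_idPl _) ?oppr_le0 ?told_ge0// expr0n.
split => //; apply: half_pos; have [] // := near_out x1 (bary_near _).
by rewrite lt_def tnew_ge0 andbT.
Qed.

Lemma excess_q_ge0 : enorm x = 1 -> forall v, 0 <= excess z * q (dir (bary z)) v.
Proof.
move=> x1 v; have [->|/(excess_bary x1)[_ bo]] := eqVneq (excess z) 0; first by rewrite mul0r.
by rewrite mulr_ge0 ?excess_ge0// (q_in bo).1.
Qed.

Lemma mix_gt0 v : enorm x = 1 -> 0 < told z ->
  0 < res (~` news) z v + pushf (fun i => z (iota i)) v -> 0 < mix z v.
Proof. by move=> x1 o0 h; rewrite /mix ltr_pwDl ?mulr_gt0 ?excess_q_ge0. Qed.

(** All the vertices that occur belong to the support of [q (dir y)], where [y] is the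
barycentre if there are new vertices and [x] otherwise. *)
Lemma mix_in : enorm x = 1 -> in_cx L0 (mix z).
Proof.
move=> x1; pose y := if tnew z == 0 then x else bary z.
have xy : `|x - y| < d.
  rewrite /y; case: eqP => [_|/eqP t0]; first by rewrite subrr normr0.
  by apply: bary_near; rewrite lt_def t0 tnew_ge0.
have [yout yq] := near_out x1 xy.
have qy := q_in (half_pos yout).
have oldq v : z v != 0 -> ~ news v -> 0 < q (dir y) v.
  move=> zv nv; have zv0 : 0 < z v by rewrite lt_def zv z0.
  have [[i [E _]]|[_ [i [im ib -> xi _]]]] := star_case zv0; last exact: yq.
  by exfalso; apply: nv; exists i.
have pushq v : pushf (fun i => z (iota i)) v != 0 -> 0 < q (dir y) v.
  move=> /pushf_pos[//|i [im ib <- zi]].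
  by apply: yq => //; have [] := new_near zi.
have ebo := excess_bary x1.
have exq v : excess z * q (dir (bary z)) v != 0 -> 0 < q (dir y) v.
  rewrite mulf_eq0 negb_or => /andP[/ebo[t0 bo] qv].
  by rewrite /y (negbTE t0) lt_def qv (q_in bo).1.
have ex0 := excess_q_ge0 x1.
have mid0 v : 0 <= told z * (res (~` news) z v + pushf (fun i => z (iota i)) v).
  by rewrite mulr_ge0 ?told_ge0// addr_ge0 ?res_ge0 ?pushf_ge0.
apply: (in_cx_sub (good_cx g0) qy).
- by move=> v; rewrite /mix addr_ge0.
- move=> v; rewrite /supp /= /mix => h.
  suff : 0 < q (dir y) v by move=> ?; rewrite gt_eqF.
  have [E1|/exq//] := eqVneq (excess z * q (dir (bary z)) v) 0.
  move: h; rewrite E1 addr0 mulf_eq0 negb_or => /andP[_ h].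
  have [E2|/pushq//] := eqVneq (pushf (fun i => z (iota i)) v) 0.
  move: h; rewrite E2 addr0 /res; case: asboolP => [nv|]; last by rewrite eqxx.
  by move=> zv; exact: oldq.
- have [pos_o|o0] := ltP 0 (told z).
    have [i ib zi] := sum_gt0_ex (fun i : 'I_m => z0 _) pos_o.
    exists (psi i); apply: ltr_pwDl; last exact: ex0.
    rewrite mulr_gt0// ltr_pwDl ?pushf_ge0// resE//= => -[j].
    exact: psi_old.
  have {}o0 : told z = 0 by apply/le_anti; rewrite o0 told_ge0.
  have t0 : 0 < tnew z by case: tnew_or_told => //; rewrite o0 ltxx.
  have e0 : 0 < excess z by rewrite /excess o0 subr0 exprn_gt0// lt_max t0 orbT.
  have [_ bo] := ebo (lt0r_neq0 e0).
  have [v qv] := in_cx_ex (good_cx g0) (q_in bo).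
  by exists v; rewrite /mix ltr_wpDl// mulr_gt0.
Qed.

Lemma Rim_mix : enorm x = 1 -> 0 < tnew z -> told z = 0 -> Rim (bary z) = r0 (mix z).
Proof.
move=> x1 t0 o0; have [bo _] := near_out x1 (bary_near t0).
rewrite Rim_out ?ltW// -(good_scale g0 (c := excess z)); first last.
- exact: q_in (half_pos bo).
- by rewrite /excess o0 subr0 exprn_gt0// lt_max t0 orbT.
by congr r0; apply/funext => v; rewrite /mix o0 mul0r add0r.
Qed.

End point_of_star.

(** The middle case is that of simplices with new vertices only, where the map is the
one on the disc at the barycentre. By [r1_mix], over the sphere all three cases agree
with [r0 \o mix]. *)
Definition r1 (z : V -> R) : X :=
  if tnew z == 0 then r0 z else if told z == 0 then Rim (bary z) else r0 (mix z).

Lemma tnew_old z : in_cx L0 z -> tnew z = 0.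
Proof.
move=> [z0 Lz]; rewrite /tnew big1// => i _; apply/eqP; apply: contrapT => /negP zi.
exact: (fresh Lz (i := i)).
Qed.

Lemma r1_old z : in_cx L0 z -> r1 z = r0 z.
Proof. by move=> /tnew_old t0; rewrite /r1 t0 eqxx. Qed.

Lemma r1_mix x z : (forall v, 0 <= z v) -> star x (supp z) -> (exists v, 0 < z v) ->
  enorm x = 1 -> r1 z = r0 (mix z).
Proof.
move=> z0 zM ne x1; rewrite /r1; case: eqP => [t0|/eqP t0]; last first.
  case: eqP => // o0; apply: (Rim_mix z0 zM x1) => //.
  by rewrite lt_def t0 tnew_ge0.
have o0 : 0 < told z by case: (tnew_or_told z0 zM ne) => //; rewrite t0 ltxx.
have E : mix z = fun v => told z * z v.
  apply/funext => v; rewrite /mix /excess t0 sub0r (max_idPl _) ?oppr_le0 ?ltW//.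
  rewrite expr0n mul0r addr0; congr (_ * _).
  have zi i : (i < m)%N -> z (iota i) = 0.
    move=> im; apply/eqP; rewrite eq_le z0 andbT leNgt; apply/negP => zi.
    by have := tnew_gt0 z0 zM zi; rewrite t0 ltxx.
  rewrite /pushf big1 ?addr0; last by move=> i _; rewrite zi// mul0r.
  rewrite /res; case: asboolP => // /contrapT[j E].
  apply/eqP; rewrite eq_le z0 leNgt E; apply/negP => zv.
  by have := tnew_gt0 z0 zM zv; rewrite t0 ltxx.
have zL : in_cx L0 z.
  apply: (in_cx_sub (good_cx g0) (qL x1)) => // v sv.
  have zv : 0 < z v by rewrite lt_def z0 andbT.
  have [[i [_]]|[_ [i [im ib -> xi _]]]] := star_case z0 zM zv; first by rewrite t0 ltxx.
  have [|_ h] := near_out (y := x) x1; first by rewrite subrr normr0.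
  by have := h i im ib xi; rewrite dir_id// /supp /= => /gt_eqF ->.
by rewrite E (good_scale g0).
Qed.

Lemma cx_L1 : cx L1.
Proof.
move=> s [Ls|[x [x1 [i im si] st]]].
  have [fs ns dn] := good_cx g0 Ls; split => // s' sub' ns'; left; exact: dn.
split.
- apply: (@sub_finite_set _ _ ((iota @` `I_m) `|` (psi @` `I_m))).
    by move=> v /st[[j [jm -> _]]|[_ [j [jm _ -> _]]]]; [left|right]; exists j.
  by rewrite finite_setU; split; apply: finite_image; exact: finite_II.
- by exists (iota i).
- move=> s' sub' ns'.
  have star' : star x s' by move=> v /sub'; exact: st.
  have [[j jm sj]|no] := pselect (exists2 i, (i < m)%N & s' (iota i)).
    by right; exists x; split => //; exists j.
  left; have x_out v : s' v -> enorm x = 1 /\ supp (q x) v.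
    move=> sv; have [[j [jm E _]]|[xx [j [jm ib E xj]]]] := star' _ sv.
      by exfalso; apply: no; exists j; rewrite -?E.
    split => //; have [|_ h] := near_out (y := x) xx; first by rewrite subrr normr0.
    by have := h j jm ib xj; rewrite dir_id// E /supp /= => /gt_eqF ->.
  have [v sv] := ns'; have [xx _] := x_out v sv.
  have [_ _ dn] := good_cx g0 (qL xx).2; apply: dn => // w /x_out[].
  by [].
Qed.

Definition l1 (v : V) : 'I_k :=
  if [pick i : 'I_m | v == iota i] is Some i then lab i else l0 v.

Lemma l1_new i : (i < m)%N -> l1 (iota i) = lab i.
Proof.
move=> im; rewrite /l1; case: pickP => [j /eqP/iota_inj->//|/(_ (Ordinal im))].
by rewrite eqxx.
Qed.

Lemma l1_old v : ~ news v -> l1 v = l0 v.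
Proof.
by move=> nv; rewrite /l1; case: pickP => // i /eqP E; exfalso; apply: nv; exists i.
Qed.

Lemma star_pt z : in_cx L1 z -> ~ L0 (supp z) -> exists x,
  [/\ enorm x <= 1, star x (supp z) & 0 < tnew z].
Proof.
move=> [z0 [//|[x [x1 [i im si] st]]]] _; exists x; split => //.
apply: (tnew_gt0 z0 st (i := i)).
by rewrite lt_def z0 andbT.
Qed.

Lemma tnew_scale (e : R) z : tnew (fun v => e * z v) = e * tnew z.
Proof. by rewrite /tnew mulr_sumr. Qed.

Lemma told_scale (e : R) z : told (fun v => e * z v) = e * told z.
Proof. by rewrite /told mulr_sumr. Qed.

Lemma bary_scale (e : R) z : 0 < e -> bary (fun v => e * z v) = bary z.
Proof.
move=> e0; rewrite /bary tnew_scale.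
under eq_bigr do rewrite -scalerA.
by rewrite -scaler_sumr scalerA invfM mulrAC mulVf ?mul1r// gt_eqF.
Qed.

Lemma mix_scale (e : R) z : 0 < e -> mix (fun v => e * z v) = fun v => e ^+ 2 * mix z v.
Proof.
move=> e0; apply/funext => v; rewrite /mix bary_scale// told_scale.
have -> : excess (fun v => e * z v) = e ^+ 2 * excess z.
  rewrite /excess tnew_scale told_scale -mulrBr -exprMn; congr (_ ^+ 2).
  by rewrite maxr_pMr ?ltW// mulr0.
have -> : res (~` news) (fun v => e * z v) v = e * res (~` news) z v.
  by rewrite /res; case: ifP => //; rewrite mulr0.
have -> : pushf (fun i => e * z (iota i)) v = e * pushf (fun i => z (iota i)) v.
  by rewrite /pushf mulr_sumr; apply: eq_bigr => i _; rewrite mulrA.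
ring.
Qed.

Lemma plot_pushf {Z : topologicalType} (w : Z -> nat -> R) :
  (forall i, continuous (fun z => w z i)) -> plot (fun z => pushf (w z)).
Proof.
move=> cw; split.
  by move=> v; apply: contsum => i; apply: contM; [exact: cw | exact: contK].
exists (psi @` `I_m); first by apply: finite_image; exact: finite_II.
move=> z v; rewrite /supp /= => h; apply: contrapT => nv; move: h.
rewrite /pushf big1 ?eqxx// => i _; case: eqP => [E|]; last by rewrite mulr0.
by exfalso; apply: nv; exists i => /=.
Qed.

Lemma cont_bary {Z : topologicalType} (p : Z -> V -> R) :
  (forall v, continuous (fun z => p z v)) -> (forall z, 0 < tnew (p z)) ->
  continuous (fun z => bary (p z)).
Proof.
move=> cp t0; apply: contvZ.
  by apply: contV; [move=> z; rewrite gt_eqF | exact: contsum].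
by apply: contvsum => i; apply: contvZ => //; exact: cst_continuous.
Qed.

Lemma plot_mix {Z : topologicalType} (p : Z -> V -> R) : plot p ->
  plot (fun z => q (dir (bary (p z)))) -> plot (fun z => mix (p z)).
Proof.
move=> pp pq'; have ct : continuous (fun z => tnew (p z)) by apply: contsum => i; exact: pp.1.
have co : continuous (fun z => told (p z)) by apply: contsum => i; exact: pp.1.
apply: plotD; apply: plotZ => //.
  apply: plotD; first exact: plot_res.
  by apply: (plot_pushf (w := fun z i => p z (iota i))) => i; exact: pp.1.
apply: contX; apply: contmax; first exact: contK.
by apply: contD => //; exact: contN.
Qed.

Lemma plot_mix0 {Z : topologicalType} (p : Z -> V -> R) : plot p ->
  (forall z, excess (p z) = 0) -> plot (fun z => mix (p z)).
Proof.
move=> pp e0; have co : continuous (fun z => told (p z)) by apply: contsum => i; exact: pp.1.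
rewrite (_ : (fun _ => _) = fun z v => told (p z) *
    (res (~` news) (p z) v + pushf (fun i => p z (iota i)) v)).
  apply: plotZ => //; apply: plotD; first exact: plot_res.
  by apply: (plot_pushf (w := fun z i => p z (iota i))) => i; exact: pp.1.
by apply/funext => z; apply/funext => v; rewrite /mix e0 mul0r addr0.
Qed.

(** Over an interior point of the disc only the barycentre matters. Over the sphere
[mix] is a plot where the new weight is at most the old one, because the excess
vanishes, and where it is at least the old one, because the barycentre is defined. *)
Lemma r1_cont s : L1 s -> forall (Z : topologicalType) (p : Z -> V -> R),
  (forall v, continuous (fun z => p z v)) -> (forall z, in_cx L1 (p z)) ->
  (forall z, supp (p z) `<=` s) -> continuous (fun z => r1 (p z)).
Proof.
move=> L1s Z p cp pL ps.
have ne z : exists v, 0 < p z v := in_cx_ex cx_L1 (pL z).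
have pos z v : 0 <= p z v := (pL z).1 v.
have nes z : supp (p z) !=set0 by have [v pv] := ne z; exists v; rewrite /supp /= gt_eqF.
have pp : plot p by split => //; exists s => //; have [] := cx_L1 L1s.
have ct : continuous (fun z => tnew (p z)) by exact: contsum.
have co : continuous (fun z => told (p z)) by exact: contsum.
case: L1s => [Ls|[x [x1 [i im si] st]]].
  have pL0 z : in_cx L0 (p z).
    by split => //; have [_ _ dn] := good_cx g0 Ls; exact: dn.
  under eq_fun do rewrite r1_old//.
  exact: (good_cont g0 Ls).
have stz z : star x (supp (p z)) by move=> v /ps; exact: st.
have [xx|xx] := pselect (enorm x = 1); last first.
  have o0 z : told (p z) = 0.
    apply/eqP; rewrite eq_le told_ge0// andbT leNgt; apply/negP.
    by move/(told_out (pos z) (stz z)).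
  have t0 z : 0 < tnew (p z).
    by case: (tnew_or_told (pos z) (stz z) (ne z)) => //; rewrite o0 ltxx.
  rewrite (_ : (fun _ => _) = fun z => Rim (bary (p z))).
    by apply: cont_Rim; exact: cont_bary.
  by apply/funext => z; rewrite /r1 o0 eqxx gt_eqF.
under eq_fun => z do rewrite (r1_mix (pos z) (stz z) (ne z) xx).
have mL z := mix_in (pos z) (stz z) (ne z) xx.
apply: (glue_le (c := fun z => tnew (p z)) (d := fun z => told (p z))) => //.
- move=> Y j cj h; apply: (good_fcont g0 (p := fun y => mix (p (j y)))) => //.
  apply: plot_mix0; first exact: (plot_comp cj pp).
  by move=> y; rewrite /excess (max_idPl _) ?expr0n// subr_le0.
- move=> Y j cj h; apply: (good_fcont g0 (p := fun y => mix (p (j y)))) => //.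
  have t0 y : 0 < tnew (p (j y)).
    case: (tnew_or_told (pos (j y)) (stz (j y)) (ne (j y))) => // o0.
    exact: lt_le_trans o0 (h y).
  have bo y : 0 < enorm (bary (p (j y))).
    by apply: half_pos; have [] := near_out xx (bary_near (pos (j y)) (stz (j y)) (t0 y)).
  apply: plot_mix; first exact: (plot_comp cj pp).
  apply: pq; last by move=> y; exact: enorm_dir.
  apply: cont_dir => //; apply: (cont_bary (p := fun y => p (j y))) => //.
  by move=> v; exact: (cont_comp (cp v) cj).
Qed.

Lemma r1_scale (e : R) y : 0 < e -> in_cx L1 y -> r1 (fun v => e * y v) = r1 y.
Proof.
move=> e0 yL; have [Ly|nLy] := pselect (L0 (supp y)).
  have yL0 : in_cx L0 y by split => //; exact: yL.1.
  rewrite !r1_old//; first exact: (good_scale g0).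
  split; first by move=> v; apply: mulr_ge0; [exact: ltW | exact: yL.1].
  rewrite (_ : supp _ = supp y)//.
  by apply/seteqP; split => v; rewrite /supp /= mulf_eq0 (gt_eqF e0).
have [x [x1 st t0]] := star_pt yL nLy.
have ne := in_cx_ex cx_L1 yL.
rewrite /r1 tnew_scale told_scale !mulf_eq0 !(gt_eqF e0) /= (gt_eqF t0) bary_scale//.
case: eqP => // o0.
have xx : enorm x = 1.
  apply: (told_out yL.1 st); rewrite lt_def (told_ge0 yL.1) andbT; exact/eqP.
rewrite mix_scale// (good_scale g0) ?exprn_gt0//.
exact: (mix_in yL.1 st ne xx).
Qed.

Lemma r1_lab y v : in_cx L1 y -> 0 < y v -> U (l1 v) (r1 y).
Proof.
move=> yL yv; have [Ly|nLy] := pselect (L0 (supp y)).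
  have yL0 : in_cx L0 y by split => //; exact: yL.1.
  rewrite r1_old// l1_old; first exact: (good_lab g0).
  by move=> [i]; exact: old_not_new yv.
have [x [x1 st t0]] := star_pt yL nLy.
have ne := in_cx_ex cx_L1 yL.
have [_ _ hb _ [hlab _]] := net.
have [told_y|/eqP told_y] := eqVneq (told y) 0.
  have [[i [E _]]|[_ [i [_ _ _ _]]]] := star_case yL.1 st yv; last by rewrite told_y ltxx.
  rewrite /r1 (gt_eqF t0) told_y eqxx E.
  have [|im xi] := new_near st (i := i); first by rewrite -E.
  rewrite l1_new//; apply: hb => //.
  have bx := bary_near yL.1 st t0.
  have -> : bary y - F i = (bary y - x) + (x - F i) by rewrite addrA subrK.
  by apply: le_lt_trans (ler_normD _ _) _; rewrite distrC; have := d0; lra.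
have pos_o : 0 < told y by rewrite lt_def (told_ge0 yL.1) andbT; exact/eqP.
have xx := told_out yL.1 st pos_o.
rewrite (r1_mix yL.1 st ne xx).
have mL := mix_in yL.1 st ne xx.
have push0 w : 0 <= pushf (fun i => y (iota i)) w by apply: pushf_ge0 => i; exact: yL.1.
have [[i [E _]]|[_ [i [im ib E xi _]]]] := star_case yL.1 st yv.
  have [|im xi] := new_near st (i := i); first by rewrite -E.
  have ib := near_isb xx im xi.
  rewrite E l1_new// hlab//; apply: (good_lab g0) => //.
  apply: (mix_gt0 yL.1 st xx pos_o); apply: ltr_wpDl; first exact: (res_ge0 _ yL.1).
  rewrite /pushf; apply: (@sum_gt0 _ (fun i : 'I_m => isb i)
    (fun j : 'I_m => y (iota j) * (psi j == psi i)%:R) (Ordinal im)) => //.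
    by move=> j; rewrite mulr_ge0// yL.1.
  by rewrite /= eqxx mulr1 -E.
have nv : ~ news v by move=> [j]; rewrite E; exact: psi_old.
rewrite l1_old//; apply: (good_lab g0) => //.
apply: (mix_gt0 yL.1 st xx pos_o); apply: ltr_pwDl; last exact: push0.
by rewrite resE.
Qed.

Lemma good_L1 : good U L1 r1 l1.
Proof. split; [exact: cx_L1 | exact: r1_cont | exact: r1_scale | exact: r1_lab]. Qed.

(** * The point and the homotopy over the disc *)

(** The partition of unity of the net, before normalisation. [bnew] and [bpush] use it
as weights on the new vertices and on the old vertices of the balls near the
sphere; [bmean] is the barycentre. *)
Definition beta (x : 'rV[R]_n) (i : nat) : R := Num.max 0 (d - `|x - F i|).
Definition bnew (x : 'rV[R]_n) : V -> R := fun v => \sum_(i < m) beta x i * (v == iota i)%:R.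
Definition bpush (x : 'rV[R]_n) : V -> R := pushf (beta x).
Definition btot (x : 'rV[R]_n) : R := \sum_(i < m) beta x i.
Definition bmean (x : 'rV[R]_n) : 'rV[R]_n := (btot x)^-1 *: \sum_(i < m) beta x i *: F i.

Lemma beta_ge0 x i : 0 <= beta x i.
Proof. by rewrite /beta le_max lexx. Qed.

Lemma beta_near x i : 0 < beta x i -> `|x - F i| < d.
Proof. by rewrite /beta lt_max ltxx /= subr_gt0. Qed.

Lemma btot_gt0 x : enorm x <= 1 -> 0 < btot x.
Proof.
move=> x1; have [_ /(_ x x1)[i im xi] _ _ _] := net.
apply: (@sum_gt0 _ predT (fun i : 'I_m => beta x i) (Ordinal im)) => //.
  by move=> j; exact: beta_ge0.
by rewrite /beta lt_max subr_gt0 xi orbT.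
Qed.

Lemma bmean_near x : enorm x <= 1 -> `|x - bmean x| < d.
Proof.
move=> x1; apply: mean_near; first exact: beta_ge0; first exact: btot_gt0.
by move=> i _; exact: beta_near.
Qed.

Lemma cont_beta {Z : topologicalType} (f : Z -> 'rV[R]_n) i : continuous f ->
  continuous (fun z => beta (f z) i).
Proof.
move=> cf; apply: contmax; first exact: contK.
apply: contD; first exact: contK; apply: contN; apply: contvnorm.
by apply: contvD => //; exact: cst_continuous.
Qed.

Lemma cont_btot {Z : topologicalType} (f : Z -> 'rV[R]_n) : continuous f ->
  continuous (fun z => btot (f z)).
Proof. by move=> cf; apply: contsum => i; exact: cont_beta. Qed.

Lemma cont_bmean {Z : topologicalType} (f : Z -> 'rV[R]_n) : continuous f ->
  (forall z, enorm (f z) <= 1) -> continuous (fun z => bmean (f z)).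
Proof.
move=> cf f1; apply: contvZ.
  by apply: contV; [move=> z; rewrite gt_eqF// btot_gt0 | exact: cont_btot].
by apply: contvsum => i; apply: contvZ; [exact: cont_beta | exact: cst_continuous].
Qed.

Lemma bnew_iota x i : (i < m)%N -> bnew x (iota i) = beta x i.
Proof.
move=> im; rewrite /bnew (bigD1 (Ordinal im))//= eqxx mulr1 big1 ?addr0// => j.
rewrite -val_eqE /= => ji; case: eqP => [/iota_inj E|_]; last by rewrite mulr0.
by move: ji; rewrite E eqxx.
Qed.

Lemma bnew_old x v : ~ news v -> bnew x v = 0.
Proof.
move=> nv; rewrite /bnew big1// => i _; case: eqP => [E|_]; last by rewrite mulr0.
by exfalso; apply: nv; exists i.
Qed.

Lemma bnew_ge0 x v : 0 <= bnew x v.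
Proof. by apply: sumr_ge0 => i _; rewrite mulr_ge0// beta_ge0. Qed.

Lemma bnew_pos x v : bnew x v != 0 -> exists i, [/\ (i < m)%N, v = iota i & 0 < beta x i].
Proof.
move=> h; have : 0 < bnew x v by rewrite lt_def h bnew_ge0.
move=> /sum_gt0_ex[|i _]; first by move=> i; rewrite mulr_ge0// beta_ge0.
case: eqP => [E|_]; rewrite ?mulr0 ?ltxx// mulr1 => wi.
by exists i.
Qed.

Lemma bpush_ge0 x v : 0 <= bpush x v.
Proof. by apply: pushf_ge0; exact: beta_ge0. Qed.

Lemma bpush_iota x j : bpush x (iota j) = 0.
Proof.
rewrite /bpush /pushf big1// => i ib; case: eqP => [E|_]; last by rewrite mulr0.
by exfalso; exact: (psi_old (ltn_ord i) ib E).
Qed.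

Lemma bpush_near x v : bpush x v != 0 ->
  exists i, [/\ (i < m)%N, isb i, v = psi i & `|x - F i| < d].
Proof.
move=> /pushf_pos[|i [im ib <- wi]]; first exact: beta_ge0.
by exists i; split => //; exact: beta_near.
Qed.

Definition bold x := told (bpush x).

Lemma bpush_ex x : enorm x = 1 -> exists v, 0 < bpush x v.
Proof.
move=> x1; have [_ hcov _ _ _] := net.
have [|i im xi] := hcov x; first by rewrite x1.
exists (psi i); rewrite /bpush /pushf.
apply: (@sum_gt0 _ (fun i : 'I_m => isb i) (fun j : 'I_m => beta x j * (psi j == psi i)%:R) (Ordinal im)) => /=.
- by move=> j; rewrite mulr_ge0// beta_ge0.
- exact: (near_isb x1 im xi).
- by rewrite eqxx mulr1 /beta lt_max subr_gt0 xi orbT.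
Qed.

Lemma bold_gt0 x : enorm x = 1 -> 0 < bold x.
Proof.
move=> x1; have [v bv] := bpush_ex x1.
have [i [im ib E _]] := bpush_near (lt0r_neq0 bv).
apply: (@sum_gt0 _ (fun i : 'I_m => isb i) (fun j : 'I_m => bpush x (psi j)) (Ordinal im)) => //=.
  by move=> j; exact: bpush_ge0.
by rewrite -E.
Qed.

(** Weights on the collar between the radii 1/2 and 1, with [cA], [cB] and [cC] summing to
1: [cB] is 1 at the radius 1/2, [cA] at 3/4, and [cC] at 1. Since [cB] and [cC] are never
positive together, new vertices and [q] do not occur in the same point. *)
Definition cB (x : 'rV[R]_n) : R := Num.max 0 (3 - 4 * enorm x).
Definition cC (x : 'rV[R]_n) : R := Num.max 0 (4 * enorm x - 3).
Definition cA (x : 'rV[R]_n) : R := 1 - cB x - cC x.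

Lemma cABC x : 2^-1 <= enorm x -> enorm x <= 1 ->
  [/\ 0 <= cA x, 0 <= cB x, 0 <= cC x & cB x = 0 \/ cC x = 0].
Proof.
move=> h h1; have e : 4 * 2^-1 = 2 :> R by field.
rewrite /cA /cB /cC !le_max !lexx; split => //.
  by case: (leP 0 (3 - 4 * enorm x)); case: (leP 0 (4 * enorm x - 3)); lra.
case: (leP (3 - 4 * enorm x) 0) => a; first by left.
by right; apply/max_idPl; lra.
Qed.

(** The lift of the disc to the new complex: inside the radius 1/2 by the partition of
unity, at twice the point; across the collar from the new vertices through the old
vertices of their balls to [q]. *)
Definition spoint (x : 'rV[R]_n) : V -> R :=
  if enorm x <= 2^-1 then bnew (2 *: x)
  else fun v => cA x * bpush (dir x) v + cB x * bnew (dir x) v + cC x * q (dir x) v.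

Lemma bnew_in x : enorm x <= 1 -> in_cx L1 (bnew x) /\ star x (supp (bnew x)).
Proof.
move=> x1.
have st : star x (supp (bnew x)).
  by move=> v /bnew_pos[i [im E bi]]; left; exists i; split => //; exact: beta_near.
split => //; split; first exact: bnew_ge0.
right; exists x; split => //.
have [i _ bi] := sum_gt0_ex (fun i : 'I_m => beta_ge0 x i) (btot_gt0 x1).
by exists i => //; rewrite /supp /= bnew_iota// gt_eqF.
Qed.

Lemma tnew_bnew x : tnew (bnew x) = btot x.
Proof. by apply: eq_bigr => i _; rewrite bnew_iota. Qed.

Lemma told_bnew x : told (bnew x) = 0.
Proof.
rewrite /told big1// => i ib; apply: bnew_old => -[j]; exact: (psi_old (ltn_ord i) ib).
Qed.

Lemma bary_bnew x : bary (bnew x) = bmean x.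
Proof. by rewrite /bary tnew_bnew; congr (_ *: _); apply: eq_bigr => i _; rewrite bnew_iota. Qed.

Lemma r1_bnew x : enorm x <= 1 -> r1 (bnew x) = Rim (bmean x).
Proof.
by move=> x1; rewrite /r1 tnew_bnew gt_eqF ?btot_gt0// told_bnew eqxx bary_bnew.
Qed.

Definition ring (x : 'rV[R]_n) : V -> R := fun v =>
  cA x * bpush (dir x) v + cB x * bnew (dir x) v + cC x * q (dir x) v.

Section on_ring.
Variable x : 'rV[R]_n.
Hypotheses (xh : 2^-1 <= enorm x) (xle : enorm x <= 1).

Lemma ring_pos : 0 < enorm x.
Proof. by apply: lt_le_trans xh; rewrite invr_gt0 ltr0n. Qed.

Lemma ring_dir : enorm (dir x) = 1.
Proof. by apply: enorm_dir; exact: ring_pos. Qed.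

Lemma qx_in : in_cx L0 (q (dir x)). Proof. by apply: qL; exact: ring_dir. Qed.

Lemma bpush_q y v : `|dir x - y| < d -> bpush (dir x) v != 0 -> 0 < q (dir y) v.
Proof.
move=> xy /bpush_near[i [im ib -> xi]].
by have [_ h] := near_out ring_dir xy; exact: h.
Qed.

Lemma ring_ge0 v : 0 <= ring x v.
Proof.
have [a0 b0 e0 _] := cABC xh xle.
by rewrite /ring !addr_ge0 ?mulr_ge0 ?bpush_ge0 ?bnew_ge0 ?qx_in.1.
Qed.

Lemma ring_star : cC x = 0 -> star (dir x) (supp (ring x)).
Proof.
move=> e0 v; rewrite /supp /ring /= e0 mul0r addr0 => h.
have [E|/bnew_pos[i [im E bi]]] := eqVneq (bnew (dir x) v) 0; last first.
  by left; exists i; split => //; exact: beta_near.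
right; split; first exact: ring_dir.
apply: bpush_near; apply: contraNneq h => ->; by rewrite E !mulr0 addr0.
Qed.

Lemma ring_ex : exists v, 0 < ring x v.
Proof.
have [a0 b0 e0 _] := cABC xh xle.
have t1 v : 0 <= cA x * bpush (dir x) v by rewrite mulr_ge0 ?bpush_ge0.
have t2 v : 0 <= cB x * bnew (dir x) v by rewrite mulr_ge0 ?bnew_ge0.
have t3 v : 0 <= cC x * q (dir x) v by rewrite mulr_ge0 ?qx_in.1.
have [e1|e1] := ltP 0 (cC x).
  have [v qv] := in_cx_ex (good_cx g0) qx_in.
  by exists v; rewrite /ring ltr_wpDl ?addr_ge0// mulr_gt0.
have [b1|b1] := ltP 0 (cB x).
  have d1 : enorm (dir x) <= 1 by rewrite ring_dir.
  have [i _ bi] := sum_gt0_ex (fun i : 'I_m => beta_ge0 (dir x) i) (btot_gt0 d1).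
  exists (iota i); rewrite /ring ltr_pwDl// ltr_wpDl// bnew_iota//.
  by rewrite mulr_gt0.
have [v bv] := bpush_ex ring_dir.
exists v; rewrite /ring ltr_pwDl// ltr_pwDl// mulr_gt0// /cA; lra.
Qed.

Lemma ring_in : in_cx L1 (ring x).
Proof.
have [a0 b0 e0 alt] := cABC xh xle.
have [b1|b1] := eqVneq (cB x) 0; last first.
  have e1 : cC x = 0 by case: alt => // E; move: b1; rewrite E eqxx.
  split; first exact: ring_ge0.
  right; exists (dir x); split; [by rewrite ring_dir| |exact: ring_star].
  have d1 : enorm (dir x) <= 1 by rewrite ring_dir.
  have [i _ bi] := sum_gt0_ex (fun i : 'I_m => beta_ge0 (dir x) i) (btot_gt0 d1).
  exists i => //; rewrite /supp /ring /= gt_eqF// e1 mul0r addr0 bpush_iota mulr0 add0r.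
  by rewrite bnew_iota// mulr_gt0// lt_def b1.
suff [r_0 Lr] : in_cx L0 (ring x) by split => //; left.
apply: (in_cx_sub (good_cx g0) qx_in ring_ge0 _ ring_ex) => v.
rewrite /supp /ring /= b1 mul0r addr0 => h.
have [E|/(@bpush_q (dir x))] := eqVneq (bpush (dir x) v) 0; last first.
  rewrite subrr normr0 (dir_id ring_dir) => /(_ d0) qv; by rewrite gt_eqF.
by apply: contraNneq h => ->; rewrite E !mulr0 addr0.
Qed.

Definition weight (x : 'rV[R]_n) : R :=
  Num.max 0 (cB x * btot (dir x) - cA x * bold (dir x)) ^+ 2.

(** A path in [L0] from a point that represents [ring x], in the sense of [r1_ring], to a
multiple of [q (dir x)]. It has two phases: [u1] moves the barycentre to [dir x], then
[u2] trades the weights of the old vertices of the balls for [q (dir x)]. *)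
Definition kpt (x : 'rV[R]_n) (u1 u2 : R) : V -> R := fun v =>
  bold (dir x) * ((1 - u2) * cA x * bpush (dir x) v + (cC x + u2) * q (dir x) v) +
  weight x * q (dir ((1 - u1) *: bmean (dir x) + u1 *: dir x)) v.

Lemma weight0 : cB x = 0 -> weight x = 0.
Proof.
have [a0 b0 e0 _] := cABC xh xle; move=> b1.
rewrite /weight b1 mul0r sub0r (max_idPl _) ?expr0n// oppr_le0 mulr_ge0//.
exact: ltW (bold_gt0 ring_dir).
Qed.

(** The segment from [bmean (dir x)] to [dir x] stays within the distance that [near_out]
allows. *)
Lemma mid_near u : 0 <= u <= 1 ->
  `|dir x - ((1 - u) *: bmean (dir x) + u *: dir x)| < d.
Proof.
move=> /andP[u0 u1].
have -> : dir x - ((1 - u) *: bmean (dir x) + u *: dir x) = (1 - u) *: (dir x - bmean (dir x)).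
  by apply/rowP => j; rewrite !mxE; ring.
rewrite normrZ ger0_norm ?subr_ge0//.
have d1 : enorm (dir x) <= 1 by rewrite ring_dir.
apply: le_lt_trans (bmean_near d1).
by rewrite ler_piMl// lerBlDr lerDl.
Qed.

Lemma r1_ring : r1 (ring x) = r0 (kpt x 0 0).
Proof.
have [a0 b0 e0 alt] := cABC xh xle.
have bo := bold_gt0 ring_dir.
have [b1|b1] := eqVneq (cB x) 0.
  have E : kpt x 0 0 = fun v => bold (dir x) * ring x v.
    apply/funext => v; rewrite /kpt weight0// /ring b1; ring.
  suff rL : in_cx L0 (ring x) by rewrite r1_old// E (good_scale g0).
  apply: (in_cx_sub (good_cx g0) qx_in ring_ge0 _ ring_ex) => v.
  rewrite /supp /ring /= b1 mul0r addr0 => h.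
  have [E'|/(@bpush_q (dir x))] := eqVneq (bpush (dir x) v) 0; last first.
    rewrite subrr normr0 (dir_id ring_dir) => /(_ d0) qv; by rewrite gt_eqF.
  by apply: contraNneq h => ->; rewrite E' !mulr0 addr0.
have e1 : cC x = 0 by case: alt => // E; move: b1; rewrite E eqxx.
rewrite (r1_mix ring_ge0 (ring_star e1) ring_ex ring_dir); congr r0; apply/funext => v.
have ring_iota i : (i < m)%N -> ring x (iota i) = cB x * beta (dir x) i.
  by move=> im; rewrite /ring e1 bpush_iota bnew_iota// mul0r addr0 mulr0 add0r.
have Et : tnew (ring x) = cB x * btot (dir x).
  by rewrite /btot mulr_sumr; apply: eq_bigr => i _; rewrite ring_iota.
have Eo : told (ring x) = cA x * bold (dir x).
  rewrite /bold /told mulr_sumr; apply: eq_bigr => i ib.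
  rewrite /ring e1 mul0r addr0 bnew_old ?mulr0 ?addr0// => -[j].
  exact: (psi_old (ltn_ord i) ib).
have Eb : bary (ring x) = bmean (dir x).
  rewrite /bary Et /bmean invfM -scalerA; have bx : cB x != 0 by [].
  rewrite (_ : \sum_(i < m) _ = cB x *: \sum_(i < m) beta (dir x) i *: F i); last first.
    by rewrite scaler_sumr; apply: eq_bigr => i _; rewrite ring_iota// scalerA.
  rewrite !scalerA; congr (_ *: _); rewrite mulrC mulrA mulfV// mul1r; done.
rewrite /mix Eo /excess Et Eo Eb /kpt subr0 scale1r scale0r !addr0 -/(weight x).
congr (_ + _); rewrite e1 mul0r addr0 mul1r.
have -> : res (~` news) (ring x) v = cA x * bpush (dir x) v.
  rewrite /res; case: asboolP => [nv|/contrapT[j ->]]; last by rewrite bpush_iota mulr0.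
  by rewrite /ring e1 mul0r addr0 bnew_old// mulr0 addr0.
have -> : pushf (fun i => ring x (iota i)) v = cB x * bpush (dir x) v.
  by rewrite /bpush /pushf mulr_sumr; apply: eq_bigr => i _; rewrite ring_iota// mulrA.
have -> : cB x = 1 - cA x by rewrite /cA e1; ring.
ring.
Qed.

(** In the first phase everything lies in the support of [q] at the moving point; in the
second one this point has reached [dir x]. *)
Lemma kpt_in u1 u2 : 0 <= u1 <= 1 -> 0 <= u2 <= 1 -> u2 = 0 \/ u1 = 1 ->
  in_cx L0 (kpt x u1 u2).
Proof.
move=> u10 /andP[u20 u21] ualt.
have [a0 b0 e0 alt] := cABC xh xle.
have bo := bold_gt0 ring_dir.
have nx := mid_near u10.
pose x1 := (1 - u1) *: bmean (dir x) + u1 *: dir x.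
have [hx1 _] := near_out ring_dir nx.
have qx1 : in_cx L0 (q (dir x1)) by apply: q_in; exact: half_pos.
have w0 : 0 <= weight x by exact: sqr_ge0.
have t1 v : 0 <= (1 - u2) * cA x * bpush (dir x) v.
  apply: mulr_ge0; last exact: bpush_ge0.
  by apply: mulr_ge0 => //; rewrite subr_ge0.
have t2 v : 0 <= (cC x + u2) * q (dir x) v by rewrite mulr_ge0 ?addr_ge0 ?qx_in.1.
have t3 v : 0 <= weight x * q (dir x1) v by rewrite mulr_ge0 ?qx1.1.
have t12 v : 0 <= bold (dir x) * ((1 - u2) * cA x * bpush (dir x) v + (cC x + u2) * q (dir x) v).
  by rewrite mulr_ge0 ?addr_ge0// ltW.
have k0 v : 0 <= kpt x u1 u2 v by rewrite /kpt addr_ge0.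
have kex : exists v, 0 < kpt x u1 u2 v.
  have [h1|h1] := ltP 0 ((1 - u2) * cA x).
    have [v bv] := bpush_ex ring_dir; exists v.
    by rewrite /kpt ltr_pwDl// mulr_gt0// ltr_pwDl// mulr_gt0.
  have [h2|h2] := ltP 0 (cC x + u2).
    have [v qv] := in_cx_ex (good_cx g0) qx_in; exists v.
    by rewrite /kpt ltr_pwDl// mulr_gt0// ltr_wpDl// mulr_gt0.
  have [v qv] := in_cx_ex (good_cx g0) qx1; exists v.
  have u2E : u2 = 0 by lra.
  have cE : cC x = 0 by lra.
  have aE : cA x = 0 by move: h1; rewrite u2E subr0 mul1r; lra.
  have bE : cB x = 1 by move: aE; rewrite /cA cE; lra.
  rewrite /kpt ltr_wpDl// mulr_gt0// /weight bE aE mul1r mul0r subr0.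
  by rewrite exprn_gt0// lt_max btot_gt0 ?orbT// ring_dir.
have bq y v : `|dir x - y| < d -> bold (dir x) * ((1 - u2) * cA x * bpush (dir x) v) != 0 ->
    supp (q (dir y)) v.
  move=> xy; rewrite !mulf_eq0 !negb_or => /andP[_ /andP[_ bv]].
  by rewrite /supp /= gt_eqF// (bpush_q xy).
have [h|h] := eqVneq (cC x + u2) 0.
  apply: (in_cx_sub (good_cx g0) qx1 k0 _ kex) => v.
  rewrite {1}/supp /kpt /= h mul0r addr0.
  have [->|/(bq _ _ nx)//] := eqVneq (bold (dir x) * ((1 - u2) * cA x * bpush (dir x) v)) 0.
  by rewrite add0r mulf_eq0 negb_or => /andP[].
apply: (in_cx_sub (good_cx g0) qx_in k0 _ kex) => v.
rewrite {1}/supp /kpt /= mulrDr.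
have nx' : `|dir x - dir x| < d by rewrite subrr normr0.
have [->|/(bq _ _ nx')] := eqVneq (bold (dir x) * ((1 - u2) * cA x * bpush (dir x) v)) 0.
  rewrite add0r /supp /=.
  have [qv|//] := eqVneq (q (dir x) v) 0.
  rewrite qv !mulr0 add0r -/x1.
  have [b1|b1] := eqVneq (cB x) 0; first by rewrite weight0// mul0r eqxx.
  have e1 : cC x = 0 by case: alt => // E; move: b1; rewrite E eqxx.
  case: ualt => [uE|uE]; first by move: h; rewrite uE e1 addr0 eqxx.
  by rewrite /x1 uE subrr scale0r add0r scale1r (dir_id ring_dir) qv mulr0 eqxx.
by rewrite (dir_id ring_dir).
Qed.

Lemma kpt_scaled (e : R) u1 u2 : 0 < e -> kpt x u1 u2 = (fun v => e * q (dir x) v) ->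
  r0 (kpt x u1 u2) = r0 (q (dir x)).
Proof. by move=> e0 ->; rewrite (good_scale g0)//; exact: qx_in. Qed.

Lemma r0_kpt1 : r0 (kpt x 1 1) = r0 (q (dir x)).
Proof.
have [a0 b0 e0 _] := cABC xh xle.
have bo := bold_gt0 ring_dir.
have w0 : 0 <= weight x by exact: sqr_ge0.
apply: (kpt_scaled (e := bold (dir x) * (cC x + 1) + weight x)).
  by rewrite ltr_pwDl// mulr_gt0//; lra.
apply/funext => v; rewrite /kpt subrr scale0r add0r scale1r (dir_id ring_dir); ring.
Qed.

End on_ring.

Lemma r0_kpt_edge x u1 u2 : enorm x = 1 -> 0 <= u2 -> r0 (kpt x u1 u2) = r0 (q x).
Proof.
move=> x1; have xh : 2^-1 <= enorm x by rewrite x1 invf_le1 ?ltr0n// ler1n.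
have xle : enorm x <= 1 by rewrite x1.
move=> u20; have bE : cB x = 0 by apply/max_idPl; rewrite x1; lra.
have cE : cC x = 1 by rewrite /cC x1 (max_idPr _); lra.
have aE : cA x = 0 by rewrite /cA bE cE; ring.
rewrite -[in RHS](dir_id x1).
apply: (kpt_scaled xh (e := bold (dir x) * (1 + u2))).
  by rewrite mulr_gt0 ?(bold_gt0 (ring_dir xh))//; lra.
apply/funext => v; rewrite /kpt (weight0 xh xle bE) cE aE; ring.
Qed.

Lemma Rim_kpt x u1 u2 : enorm x = 2^-1 -> 0 <= u1 <= 1 -> 0 <= u2 <= 1 ->
  u2 = 0 \/ u1 = 1 ->
  Rim ((1 - u1) *: bmean (2 *: x) + u1 *: (2 *: x)) = r0 (kpt x u1 u2).
Proof.
move=> x1 u10 u20 ualt.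
have xh : 2^-1 <= enorm x by rewrite x1.
have hh : 2^-1 < 1 :> R by rewrite invf_lt1 ?ltr0n// ltr1n.
have xle : enorm x <= 1 by rewrite x1 ltW.
have dE : dir x = 2 *: x by rewrite /dir x1 invrK.
have bo := bold_gt0 (ring_dir xh).
have e2 : 4 * 2^-1 = 2 :> R by field.
have bE : cB x = 1 by rewrite /cB x1 e2 (max_idPr _); lra.
have cE : cC x = 0 by apply/max_idPl; rewrite x1 e2; lra.
have aE : cA x = 0 by rewrite /cA bE cE; ring.
have wE : weight x = btot (dir x) ^+ 2.
  by rewrite /weight aE bE mul1r mul0r subr0 (max_idPr _)// ltW// btot_gt0// (ring_dir xh).
have wp : 0 < weight x by rewrite wE exprn_gt0// btot_gt0// (ring_dir xh).
rewrite -dE; have nx := mid_near xh u10.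
have [hx1 _] := near_out (ring_dir xh) nx.
rewrite Rim_out ?ltW//; have qx1 := q_in (half_pos hx1).
case: ualt => uE.
  rewrite -(good_scale g0 wp qx1); congr r0; apply/funext => v.
  rewrite /kpt uE cE aE; ring.
rewrite (kpt_scaled xh (e := bold (dir x) * u2 + weight x)).
- by rewrite uE subrr scale0r add0r scale1r (dir_id (ring_dir xh)).
- by have /andP[? _] := u20; rewrite ltr_wpDl// mulr_ge0// ltW.
- apply/funext => v; rewrite /kpt uE subrr scale0r scale1r cE aE.
  rewrite (_ : 0 + dir x = dir x); last by rewrite add0r.
  rewrite (dir_id (ring_dir xh)); ring.
Qed.

(** The homotopy from [r1 (spoint x)] to [Psi (8 * x)]: inside the radius 1/2 along the
segment from the barycentre of the partition of unity, on the collar along [kpt]. *)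
Definition ktop (x : 'rV[R]_n) (u : R) : X :=
  if enorm x <= 2^-1
  then Rim ((1 - Num.min 1 (2 * u)) *: bmean (2 *: x) + Num.min 1 (2 * u) *: (2 *: x))
  else r0 (kpt x (Num.min 1 (2 * u)) (Num.max 0 (2 * u - 1))).

Lemma phases (u : R) : 0 <= u <= 1 -> [/\ 0 <= Num.min 1 (2 * u) <= 1,
  0 <= Num.max 0 (2 * u - 1) <= 1 & Num.max 0 (2 * u - 1) = 0 \/ Num.min 1 (2 * u) = 1].
Proof.
move=> /andP[u0 u1]; rewrite le_min ler01 ge_min lexx le_max lexx ge_max ler01 /= andbT.
split; [lra|lra|].
case: (leP (2 * u - 1) 0) => h; first by left.
by right; apply/min_idPl; lra.
Qed.

Section plots_near_cell.
Context {Z : topologicalType}.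
Variable f : Z -> 'rV[R]_n.
Hypotheses (cf : continuous f) (f1 : forall z, enorm (f z) <= 1).

Lemma plot_bnew : plot (fun z => bnew (f z)).
Proof.
split.
  by move=> v; apply: contsum => i; apply: contM; [exact: cont_beta | exact: contK].
exists (iota @` `I_m); first by apply: finite_image; exact: finite_II.
by move=> z v /bnew_pos[i [im -> _]]; exists i.
Qed.

Lemma plot_bpush : plot (fun z => bpush (f z)).
Proof. by apply: (plot_pushf (w := fun z => beta (f z))) => i; exact: cont_beta. Qed.

End plots_near_cell.

Section plots_near_ring.
Context {Z : topologicalType}.
Variable f : Z -> 'rV[R]_n.
Hypotheses (cf : continuous f) (fh : forall z, 2^-1 <= enorm (f z)) (f1 : forall z, enorm (f z) <= 1).

Lemma cont_fdir : continuous (fun z => dir (f z)).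
Proof. by apply: cont_dir => // z; exact: ring_pos. Qed.

Lemma cont_cB : continuous (fun z => cB (f z)).
Proof.
apply: contmax; first exact: contK; apply: contD; first exact: contK.
by apply: contN; apply: contM; [exact: contK | exact: cont_enorm].
Qed.

Lemma cont_cC : continuous (fun z => cC (f z)).
Proof.
apply: contmax; first exact: contK; apply: contD; last exact: contK.
by apply: contM; [exact: contK | exact: cont_enorm].
Qed.

Lemma cont_cA : continuous (fun z => cA (f z)).
Proof.
apply: contD; last by apply: contN; exact: cont_cC.
by apply: contD; [exact: contK | apply: contN; exact: cont_cB].
Qed.

Lemma plot_fq : plot (fun z => q (dir (f z))).
Proof. by apply: pq; [exact: cont_fdir | move=> z; exact: ring_dir]. Qed.

Lemma plot_ring : plot (fun z => ring (f z)).
Proof.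
apply: plotD; last by apply: plotZ; [exact: cont_cC | exact: plot_fq].
apply: plotD; apply: plotZ.
- exact: cont_cA.
- exact: (plot_bpush cont_fdir).
- exact: cont_cB.
- exact: (plot_bnew cont_fdir).
Qed.

Lemma cont_bold : continuous (fun z => bold (dir (f z))).
Proof.
apply: contsum => i; exact: (plot_bpush cont_fdir).1.
Qed.

Lemma plot_kpt (u1 u2 : Z -> R) : continuous u1 -> continuous u2 ->
  (forall z, 0 <= u1 z <= 1) -> plot (fun z => kpt (f z) (u1 z) (u2 z)).
Proof.
move=> c1 c2 u10; apply: plotD; apply: plotZ.
- exact: cont_bold.
- apply: plotD; apply: plotZ.
  + by apply: contM; [apply: contD; [exact: contK | exact: contN] | exact: cont_cA].
  + exact: (plot_bpush cont_fdir).
  + by apply: contD => //; exact: cont_cC.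
  + exact: plot_fq.
- apply: contX; apply: contmax; first exact: contK.
  apply: contD; first by apply: contM; [exact: cont_cB | exact: (cont_btot cont_fdir)].
  by apply: contN; apply: contM; [exact: cont_cA | exact: cont_bold].
- have pos z : 0 < enorm ((1 - u1 z) *: bmean (dir (f z)) + u1 z *: dir (f z)).
    by apply: half_pos; have [] := near_out (ring_dir (fh z)) (mid_near (fh z) (u10 z)).
  apply: pq; last by move=> z; exact: enorm_dir.
  apply: cont_dir => //; apply: contvD; apply: contvZ => //.
  + by apply: contD; [exact: contK | exact: contN].
  + by apply: cont_bmean; [exact: cont_fdir | move=> z; rewrite ring_dir].
  + exact: cont_fdir.
Qed.

End plots_near_ring.

Lemma spoint_in x : enorm x <= 1 -> in_cx L1 (spoint x).
Proof.
move=> x1; rewrite /spoint; case: ifPn => [h|].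
  have [] // := @bnew_in (2 *: x).
  have e2 : 2 * 2^-1 = 1 :> R by field.
  by rewrite enormZ ?ler0n//; lra.
by rewrite -ltNge => h; exact: (ring_in (ltW h) x1).
Qed.

Lemma spoint_edge x : enorm x = 1 -> spoint x = q x.
Proof.
move=> x1; rewrite /spoint x1.
have -> : (1 <= 2^-1 :> R) = false by apply/negbTE; rewrite -ltNge invf_lt1 ?ltr0n// ltr1n.
apply/funext => v.
have bE : cB x = 0 by apply/max_idPl; rewrite x1; lra.
have cE : cC x = 1 by rewrite /cC x1 (max_idPr _); lra.
by rewrite /cA bE cE (dir_id x1) mul1r mul0r addr0 subr0 subrr mul0r add0r.
Qed.

Lemma ring_half x : enorm x = 2^-1 -> ring x = bnew (2 *: x).
Proof.
move=> x1; have e2 : 4 * 2^-1 = 2 :> R by field.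
have bE : cB x = 1 by rewrite /cB x1 e2 (max_idPr _); lra.
have cE : cC x = 0 by apply/max_idPl; rewrite x1 e2; lra.
have dE : dir x = 2 *: x by rewrite /dir x1 invrK.
by apply/funext => v; rewrite /ring /cA bE cE dE; ring.
Qed.

Lemma plot_spoint {Z : topologicalType} (f : Z -> 'rV[R]_n) : continuous f ->
  (forall z, enorm (f z) <= 1) -> plot (fun z => spoint (f z)).
Proof.
move=> cf f1; have cN := cont_enorm cf.
pose A := [set z | 2^-1 <= enorm (f z)].
have cfA : continuous (fun a : A => f (val a)).
  by apply: (cont_comp cf); exact: initial_continuous.
have [cr [W fW rW]] := plot_ring cfA (fun a => set_mem (valP a)).
have e2 : 2 * 2^-1 = 1 :> R by rewrite mulfV// pnatr_eq0.
split; last first.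
  exists (W `|` iota @` `I_m).
    by rewrite finite_setU; split => //; apply: finite_image; exact: finite_II.
  move=> z v; rewrite /spoint; case: ifPn => [h|].
    by move=> /bnew_pos[i [im -> _]]; right; exists i.
  rewrite -ltNge => /ltW h; left; apply: (rW (SigSub (mem_set (h : A z)))).
  by [].
move=> v; apply: (glue_le (c := fun z => enorm (f z)) (d := fun=> 2^-1)) => //; first exact: contK.
- move=> Y j cj h; rewrite /spoint; under eq_fun do rewrite h.
  have c2 : continuous (fun y => 2 *: f (j y)).
    by apply: contvZ; [exact: contK | exact: (cont_comp cf cj)].
  exact: (plot_bnew c2).1.
- move=> Y j cj h; rewrite (_ : (fun _ => _) = fun y => ring (f (j y)) v).
    exact: (plot_ring (cont_comp cf cj) h).1.
  apply/funext => y; rewrite /spoint; case: ifPn => // e.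
  by rewrite -/(ring _) ring_half//; apply/le_anti; rewrite e /= h.
Qed.

Lemma cont_ktop {Z : topologicalType} (f : Z -> 'rV[R]_n) (u : Z -> R) : continuous f ->
  (forall z, enorm (f z) <= 1) -> continuous u -> (forall z, 0 <= u z <= 1) ->
  continuous (fun z => ktop (f z) (u z)).
Proof.
move=> cf f1 cu u01; have cN := cont_enorm cf.
have e2 : 2 * 2^-1 = 1 :> R by rewrite mulfV// pnatr_eq0.
have cp1 (Y : topologicalType) (w : Y -> R) : continuous w -> continuous (fun y => Num.min 1 (2 * w y)).
  by move=> cw; apply: contmin; [exact: contK | apply: contM => //; exact: contK].
have cp2 (Y : topologicalType) (w : Y -> R) : continuous w -> continuous (fun y => Num.max 0 (2 * w y - 1)).
  move=> cw; apply: contmax; first exact: contK.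
  by apply: contD; [apply: contM => //; exact: contK | exact: contK].
apply: (glue_le (c := fun z => enorm (f z)) (d := fun=> 2^-1)) => //; first exact: contK.
- move=> Y j cj h; rewrite /ktop; under eq_fun do rewrite h.
  have c2 : continuous (fun y => 2 *: f (j y)).
    by apply: contvZ; [exact: contK | exact: (cont_comp cf cj)].
  have c1 := cp1 _ _ (cont_comp cu cj).
  apply: cont_Rim; apply: contvD; apply: contvZ => //.
    by apply: contD; [exact: contK | exact: contN].
  apply: cont_bmean => // y; rewrite enormZ ?ler0n//.
  by have := h y; lra.
- move=> Y j cj h.
  rewrite (_ : (fun _ => _) = fun y => r0 (kpt (f (j y)) (Num.min 1 (2 * u (j y))) (Num.max 0 (2 * u (j y) - 1)))).
    apply: (good_fcont g0 (p := fun y => kpt (f (j y)) _ _)).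
      apply: (plot_kpt (cont_comp cf cj) h (u1 := fun y => Num.min 1 (2 * u (j y)))
        (u2 := fun y => Num.max 0 (2 * u (j y) - 1))).
      + exact: cp1 (cont_comp cu cj).
      + exact: cp2 (cont_comp cu cj).
      + by move=> y; have [] := phases (u01 (j y)).
    move=> y; have [h1 h2 h3] := phases (u01 (j y)).
    exact: kpt_in.
  apply/funext => y; rewrite /ktop; case: ifPn => // e.
  have [h1 h2 h3] := phases (u01 (j y)).
  by apply: Rim_kpt => //; apply/le_anti; rewrite e /= h.
Qed.

Lemma ktop0 x : enorm x <= 1 -> ktop x 0 = r1 (spoint x).
Proof.
move=> x1; rewrite /ktop /spoint mulr0 (min_idPr ler01) sub0r (max_idPl _) ?lerN10//.
case: ifPn => [h|].
  rewrite subr0 scale1r scale0r addr0 r1_bnew//.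
  have e2 : 2 * 2^-1 = 1 :> R by field.
  by rewrite enormZ ?ler0n//; lra.
by rewrite -ltNge => h; rewrite -/(ring x) (r1_ring (ltW h) x1).
Qed.

Lemma ktop1 x : enorm x <= 1 -> ktop x 1 = Psi (8 *: x).
Proof.
move=> x1; rewrite /ktop mulr1 (min_idPl _); last by rewrite ler1n.
rewrite (_ : 2 - 1 = 1 :> R); last by ring.
rewrite (max_idPr ler01) subrr scale0r add0r scale1r.
case: ifPn => [h|].
  by rewrite /Rim scalerA; congr (Psi (_ *: x)); ring.
rewrite -ltNge => h; rewrite (r0_kpt1 (ltW h) x1) Psi_out; first by rewrite dirZ// ltr0n.
rewrite enormZ ?ler0n//; have := c_gt0; have : 8 * 2^-1 = 4 :> R by field.
lra.
Qed.

Lemma ktop_edge x u : enorm x = 1 -> ktop x u = r0 (q x).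
Proof.
move=> x1; rewrite /ktop x1.
have -> : (1 <= 2^-1 :> R) = false by apply/negbTE; rewrite -ltNge invf_lt1 ?ltr0n// ltr1n.
by apply: r0_kpt_edge => //; rewrite le_max lexx.
Qed.

(** The time is spent as follows: nothing happens up to [c / 2], then [ktop] runs up to
[3 * c / 4], and finally the factor in [Psi (blowup t *: x)] decreases from 8 and is
[2 - t] from the time [c] on, hence 1 at the end. On the sphere this is [eta x t]: up to
the time [c] the factor is at least [2 - c], where [Psi] is [r0 \o q]. *)
Definition clock (t : R) : R := Num.max 0 (Num.min 1 (4 * t / c - 2)).
Definition blowup (t : R) : R := Num.max (2 - t) (8 - (t - 3 * c / 4) * (28 / c)).

Definition hcell (x : 'rV[R]_n) (t : R) : X :=
  if t <= 3 * c / 4 then ktop x (clock t) else Psi (blowup t *: x).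

Lemma clock01 t : 0 <= clock t <= 1.
Proof. by rewrite /clock le_max lexx ge_max ler01 ge_min lexx. Qed.

Lemma cont_hcell {Z : topologicalType} (f : Z -> 'rV[R]_n) (t : Z -> R) : continuous f ->
  (forall z, enorm (f z) <= 1) -> continuous t ->
  continuous (fun z => hcell (f z) (t z)).
Proof.
move=> cf f1 ct; have c0 := lt0r_neq0 c_gt0.
apply: (glue_le (c := t) (d := fun=> 3 * c / 4)) => //; first exact: contK.
- move=> Y j cj h; rewrite /hcell; under eq_fun do rewrite h.
  apply: cont_ktop.
  + exact: (cont_comp cf cj).
  + by [].
  + apply: contmax; first exact: contK; apply: contmin; first exact: contK.
    apply: contD; last exact: contK; apply: contM; last exact: contK.
    by apply: contM; [exact: contK | exact: (cont_comp ct cj)].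
  + by move=> y; exact: clock01.
- move=> Y j cj h; have ctj := cont_comp ct cj.
  rewrite (_ : (fun _ => _) = fun y => Psi (blowup (t (j y)) *: f (j y))).
    apply: cont_Psi; apply: contvZ; last exact: (cont_comp cf cj).
    apply: contmax; first by apply: contD; [exact: contK | exact: contN].
    apply: contD; first exact: contK; apply: contN; apply: contM; last exact: contK.
    by apply: contD => //; exact: contK.
  apply/funext => y; rewrite /hcell; case: ifPn => // e.
  have -> : t (j y) = 3 * c / 4 by apply/le_anti; rewrite e /= h.
  have -> : clock (3 * c / 4) = 1.
    rewrite /clock (_ : 4 * (3 * c / 4) / c - 2 = 1); last by field.
    by rewrite minxx (max_idPr ler01).
  rewrite ktop1//; congr (Psi (_ *: _)); rewrite /blowup subrr mul0r subr0.
  by rewrite (max_idPr _)//; have := c_gt0; lra.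
Qed.

Lemma hcell0 x t : enorm x <= 1 -> t <= c / 2 -> hcell x t = r1 (spoint x).
Proof.
move=> x1 tc; have cp := c_gt0; rewrite /hcell.
have -> : t <= 3 * c / 4 by lra.
rewrite (_ : clock t = 0) ?ktop0//; apply/max_idPl; rewrite ge_min; apply/orP; right.
by rewrite subr_le0 ler_pdivrMr//; lra.
Qed.

Lemma hcell1 x : enorm x <= 1 -> hcell x 1 = Phi x.
Proof.
move=> x1; have cp := c_gt0; have cl := c_le1; rewrite /hcell.
have -> : (1 <= 3 * c / 4) = false by apply/negbTE; rewrite -ltNge; lra.
rewrite (_ : blowup 1 = 1) ?scale1r ?Psi_in//.
rewrite /blowup (_ : 8 - (1 - 3 * c / 4) * (28 / c) = 29 - 28 / c); last by field; rewrite gt_eqF.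
rewrite (max_idPl _); first by ring.
suff : 28 <= 28 / c by lra.
by rewrite ler_pdivlMr//; lra.
Qed.

Lemma hcell_edge x t : enorm x = 1 -> 0 <= t <= 1 -> hcell x t = eta x t.
Proof.
move=> x1 /andP[t0 t1]; have cp := c_gt0; have cl := c_le1; rewrite /hcell.
case: ifPn => [h|].
  by rewrite ktop_edge// eta0// t0 /=; lra.
rewrite -ltNge => h.
have [ht|ht] := leP t c.
  rewrite eta0 ?t0// Psi_out.
    by rewrite dirZ ?dir_id// /blowup lt_max; apply/orP; left; lra.
  have bl : 2 - t <= blowup t by rewrite /blowup le_max lexx.
  by rewrite enormZ ?x1; lra.
rewrite (_ : blowup t = 2 - t); first by rewrite Psi_mid// t0.
apply/max_idPl; rewrite lerBlDr.
have : 7 <= (t - 3 * c / 4) * (28 / c); last lra.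
rewrite mulrA ler_pdivlMr//; lra.
Qed.

(** The new homotopy is constant up to [c / 2], as required of [eta] with [c] for the
cells of the next dimension. *)
Lemma attach_cell : exists (L' : set (set V)) (r' : (V -> R) -> X) (l' : V -> 'I_k)
    (s' : 'rV[R]_n -> V -> R) (h' : 'rV[R]_n -> R -> X),
  [/\ good U L' r' l',
   [/\ L0 `<=` L', forall y, in_cx L0 y -> r' y = r0 y,
     forall v, (forall i, v <> iota i) -> l' v = l0 v &
     forall s, L' s -> L0 s \/ (exists i, s (iota i)) /\
       (forall v, s v -> (exists i, v = iota i) \/ exists2 s0, L0 s0 & s0 v)],
   [/\ forall (Z : topologicalType) (f : Z -> 'rV[R]_n), continuous f ->
       (forall z, enorm (f z) <= 1) -> plot (fun z => s' (f z)),
     forall x, enorm x <= 1 -> in_cx L' (s' x) &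
     forall x, enorm x = 1 -> s' x = q x] &
   [/\ forall (Z : topologicalType) (f : Z -> 'rV[R]_n) (t : Z -> R), continuous f ->
       (forall z, enorm (f z) <= 1) -> continuous t ->
       continuous (fun z => h' (f z) (t z)),
     forall x t, enorm x <= 1 -> t <= c / 2 -> h' x t = r' (s' x),
     forall x, enorm x <= 1 -> h' x 1 = Phi x &
     forall x t, enorm x = 1 -> 0 <= t <= 1 -> h' x t = eta x t]].
Proof.
exists L1, r1, l1, spoint, hcell; split.
- exact: good_L1.
- split.
  + by move=> s Ls; left.
  + exact: r1_old.
  + by move=> v nv; apply: l1_old => -[i]; exact: nv.
  + move=> s [Ls|[x [x1 [i im si] st]]]; first by left.
    right; split; first by exists i.
    move=> v /st[[j [_ -> _]]|[xx [j [jm jb -> xj]]]]; first by left; exists j.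
    right; exists (supp (q x)); first exact: (qL xx).2.
    have [|_ hq] := near_out (y := x) xx; first by rewrite subrr normr0.
    by have := hq j jm jb xj; rewrite dir_id// /supp /= => /gt_eqF ->.
- split; [exact: @plot_spoint | exact: spoint_in | exact: spoint_edge].
- split; [exact: @cont_hcell | exact: hcell0 | exact: hcell1 | exact: hcell_edge].
Qed.

End cell_setup.

(** * Functions on a CW complex *)

Section cw_cells.
Context {R : realType} {K : topologicalType} (C : cw_structure R K).
Implicit Types e : cell C.

Lemma disc0 n : (0 : 'rV[R]_n) \in disc R n.
Proof. by rewrite inE /disc /= big1 ?ler01// => j _; rewrite mxE expr0n. Qed.

(** Vectors outside the disc are sent to its centre. *)
Definition toD n (x : 'rV[R]_n) : disc R n := insubd (SigSub (disc0 n)) x.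

Lemma val_toD n (x : 'rV[R]_n) : enorm x <= 1 -> val (toD x) = x.
Proof.
by rewrite enorm_le1 => x1; rewrite /toD /insubd insubT ?inE//= => h; rewrite x1 in h.
Qed.

Lemma toD_val n (u : disc R n) : toD (val u) = u. Proof. exact: valKd. Qed.

Lemma cont_toD {Z : topologicalType} n (f : Z -> 'rV[R]_n) : continuous f ->
  (forall z, enorm (f z) <= 1) -> continuous (fun z => toD (f z)).
Proof.
move=> cf f1; apply: continuous_comp_initial.
by rewrite (_ : _ \o _ = f)//; apply/funext => z /=; exact: val_toD.
Qed.

Definition chi e (x : 'rV[R]_(cell_dim e)) : K := char_map (toD x).

Lemma cont_chi {Z : topologicalType} e (f : Z -> 'rV[R]_(cell_dim e)) : continuous f ->
  (forall z, enorm (f z) <= 1) -> continuous (fun z => chi (f z)).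
Proof.
by move=> cf f1; apply: (cont_comp (@char_map_continuous _ _ C e)); exact: cont_toD.
Qed.

Lemma open_cell_chi e x : open_cell e x <-> exists2 d, enorm d < 1 & @chi e d = x.
Proof.
split => [[u ui <-]|[d d1 <-]].
  by exists (val u); [rewrite enorm_lt1 | rewrite /chi toD_val].
by exists (toD d) => //; rewrite /disc_interior /= val_toD ?ltW// -enorm_lt1.
Qed.

Lemma chi_ex x : exists e (d : 'rV[R]_(cell_dim e)), enorm d < 1 /\ chi d = x.
Proof.
have : [set: K] x by [].
by rewrite -(open_cell_cover C) => -[e _ /open_cell_chi[d d1 dx]]; exists e, d.
Qed.

Lemma chi_inj e e' (d : 'rV[R]_(cell_dim e)) (d' : 'rV[R]_(cell_dim e')) :
  enorm d < 1 -> enorm d' < 1 -> chi d = chi d' ->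
  existT (fun e => 'rV[R]_(cell_dim e)) e d = existT _ e' d'.
Proof.
move=> d1 d1' dd.
have ee : e = e'.
  apply: (@open_cell_disjoint R K C e e' Logic.I Logic.I); exists (chi d); split.
    by apply/open_cell_chi; exists d.
  by rewrite dd; apply/open_cell_chi; exists d'.
case: _ / ee d' d1' dd => d' d1' dd; congr existT.
have int (y : 'rV[R]_(cell_dim e)) : enorm y < 1 -> toD y \in disc_interior R (cell_dim e).
  by move=> y1; rewrite inE /disc_interior /= val_toD ?ltW// -enorm_lt1.
have := char_map_inj (int _ d1) (int _ d1') dd.
by move=> /(congr1 val); rewrite !val_toD ?ltW.
Qed.

(** A function on a CW complex can be prescribed on each open cell, since every point
lies in exactly one of them at exactly one parameter. *)
Lemma cell_rec (W : Type) (F : forall e, 'rV[R]_(cell_dim e) -> W) :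
  exists phi : K -> W, forall e (d : 'rV[R]_(cell_dim e)), enorm d < 1 -> phi (chi d) = F e d.
Proof.
have ex x : exists w, forall e (d : 'rV[R]_(cell_dim e)), enorm d < 1 -> chi d = x -> w = F e d.
  have [e [d [d1 <-]]] := chi_ex x; exists (F e d) => e' d' d1' /esym/(chi_inj d1 d1').
  exact: (congr1 (fun s : {e & 'rV[R]_(cell_dim e)} => F (projT1 s) (projT2 s))).
by have [phi h] := choice ex; exists phi => e d d1; exact: h.
Qed.

Definition lower n x := exists e (d : 'rV[R]_(cell_dim e)),
  [/\ (cell_dim e < n)%N, enorm d < 1 & chi d = x].

Lemma chi_finite e : exists2 F : set {classic cell C}, finite_set F &
  (forall e', F e' -> (cell_dim (e' : cell C) < cell_dim e)%N) /\
  forall d : 'rV[R]_(cell_dim e), enorm d = 1 ->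
    exists2 e', F e' & exists2 d' : 'rV[R]_(cell_dim (e' : cell C)), enorm d' < 1 & chi d' = chi d.
Proof.
have [F [fF dF cF]] := cw_closure_finite e.
exists F => //; split => // d d1.
have [|e' Fe' /open_cell_chi[d' d1' dd]] := cF (chi d).
  by exists (toD d) => //; rewrite /disc_boundary /= val_toD ?d1//; apply/enorm_eq1.
by exists e' => //; exists d'.
Qed.

Lemma lower_edge e (d : 'rV[R]_(cell_dim e)) : enorm d = 1 -> lower (cell_dim e) (chi d).
Proof.
move=> d1; have [F _ [dF cF]] := chi_finite e.
by have [e' Fe' [d' d1' dd]] := cF d d1; exists e', d'; split => //; exact: dF.
Qed.

Lemma lowerW m n x : (m <= n)%N -> lower m x -> lower n x.
Proof. by move=> mn [e [d [em d1 dx]]]; exists e, d; split => //; exact: leq_trans mn. Qed.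

Lemma lower_chi n e (d : 'rV[R]_(cell_dim e)) : (cell_dim e < n)%N -> enorm d <= 1 ->
  lower n (chi d).
Proof.
move=> en; rewrite le_eqVlt => /orP[/eqP /lower_edge|d1]; last by exists e, d.
by apply: lowerW; exact: ltnW.
Qed.

Definition cellcont {Y : topologicalType} n (u : K -> R -> Y) := forall e, (cell_dim e < n)%N ->
  forall (Z : topologicalType) (f : Z -> 'rV[R]_(cell_dim e)) (t : Z -> R),
  continuous f -> (forall z, enorm (f z) <= 1) -> continuous t -> (forall z, 0 <= t z <= 1) ->
  continuous (fun z => u (chi (f z)) (t z)).

Definition cellplot {V : choiceType} n (s : K -> V -> R) := forall e, (cell_dim e < n)%N ->
  forall (Z : topologicalType) (f : Z -> 'rV[R]_(cell_dim e)),
  continuous f -> (forall z, enorm (f z) <= 1) -> plot (fun z => s (chi (f z))).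

Lemma hausdorff_unitI : hausdorff_space (unitI R).
Proof.
apply: (@hausdorff_separate (unitI R) R [set (fun u : unitI R => val u)] (@Rhausdorff R)).
- by move=> f ->; exact: initial_continuous.
- by move=> x y /(_ _ erefl) /val_inj.
Qed.

Lemma compact_prod_disc n : compact [set: disc R n * unitI R].
Proof.
rewrite -setXTT; apply: compact_setX; last exact: compact_unitI.
by apply: compact_set_type; exact: compact_disc.
Qed.

(** The boundary of a cell lies in finitely many closed cells, which are compact. *)
Lemma edge_cont {Y : topologicalType} e (u : K -> R -> Y) : cellcont (cell_dim e) u ->
  forall (Z : topologicalType) (f : Z -> 'rV[R]_(cell_dim e)) (t : Z -> R),
  continuous f -> (forall z, enorm (f z) = 1) -> continuous t -> (forall z, 0 <= t z <= 1) ->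
  continuous (fun z => u (chi (f z)) (t z)).
Proof.
move=> cu Z f t cf f1 ct t01; have [F fF [dF cF]] := chi_finite e.
have f1' z : enorm (f z) <= 1 by rewrite f1.
rewrite (_ : (fun _ => _) = fun z => u (chi (f z)) (val (toI (t z)))); last first.
  by apply/funext => z; rewrite val_toI.
apply: (@compact_cover_continuous (K * unitI R)%type Y Z _ F
  (fun e' => (disc R (cell_dim (e' : cell C)) * unitI R)%type)
  (fun e' p => (char_map p.1, p.2)) (fun p => u p.1 (val p.2))
  (fun z => (chi (f z), toI (t z)))) => //.
- apply: hausdorff_prod; [exact: (cw_hausdorff C) | exact: hausdorff_unitI].
- by move=> e'; exact: compact_prod_disc.
- move=> e'; apply: pair_continuous; last by move=> p; exact: cvg_snd.
  by apply: (cont_comp (@char_map_continuous _ _ C e')) => p; exact: cvg_fst.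
- move=> e' Fe' /=.
  rewrite (_ : (fun _ => _) = fun p : disc R (cell_dim (e' : cell C)) * unitI R =>
     u (chi (val p.1)) (val p.2)); last by apply/funext => p; rewrite /chi toD_val.
  apply: cu; first exact: dF.
  + by apply: (cont_comp (@initial_continuous _ _ _)) => p; exact: cvg_fst.
  + by move=> p; rewrite enorm_le1; exact: set_mem (valP p.1).
  + by apply: (cont_comp (@initial_continuous _ _ _)) => p; exact: cvg_snd.
  + by move=> p; exact: unitIP.
- by apply: pair_continuous; [exact: cont_chi | exact: cont_toI].
- move=> z; have [e' Fe' [d' d1' dd]] := cF _ (f1 z).
  by exists e' => //; exists (toD d', toI (t z)) => //=; rewrite -dd.
Qed.

Lemma edge_plot {V : choiceType} e (s : K -> V -> R) : cellplot (cell_dim e) s ->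
  forall (Z : topologicalType) (f : Z -> 'rV[R]_(cell_dim e)),
  continuous f -> (forall z, enorm (f z) = 1) -> plot (fun z => s (chi (f z))).
Proof.
move=> ps Z f cf f1; split.
  move=> v; apply: (@edge_cont R e (fun x _ => s x v) _ Z f (fun=> 0)) => //.
  - by move=> e' ee Z' f' t' cf' f1' ct' t01'; exact: (ps e' ee Z' f' cf' f1').1.
  - exact: contK.
  - by move=> z; rewrite lexx ler01.
have [F fF [dF cF]] := chi_finite e.
have ex (e' : {classic cell C}) : exists W : set V, F e' -> finite_set W /\
    forall d : 'rV[R]_(cell_dim (e' : cell C)), enorm d < 1 -> supp (s (chi d)) `<=` W.
  have [Fe'|nF] := pselect (F e'); last by exists set0.
  have [|d|_ [W fW sW]] := ps e' (dF _ Fe') (disc R (cell_dim (e' : cell C))) val.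
  - exact: initial_continuous.
  - by rewrite enorm_le1; exact: set_mem (valP d).
  - exists W => _; split => // d d1; rewrite -[d](val_toD (ltW d1)); exact: sW.
have [W hW] := choice ex.
exists (\bigcup_(e' in F) W e').
  by apply: bigcup_finite => // e' /hW[].
move=> z v; have [e' Fe' [d' d1' <-]] := cF _ (f1 z) => sv.
by exists e' => //; apply: (hW e' Fe').2 sv.
Qed.

End cw_cells.

(** * CW complexes over a cover *)

Section realisation.
Context {R : realType} {K : topologicalType} (C : cw_structure R K).
Context {X : ptopologicalType} {k : nat} (U : 'I_k -> set X).
Hypotheses (oU : forall j, open (U j)) (covU : \bigcup_j U j = [set: X]).
Variable g : K -> X.
Hypothesis cg : continuous g.
Implicit Types e : cell C.

(** A supply of vertices, infinite for each cell. *)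
Definition cvert : choiceType := ({classic cell C} * nat)%type.
Definition vdim (v : cvert) : nat := cell_dim (v.1 : cell C).
Definition cv e i : cvert := (e : {classic cell C}, i).

(** A complex with map and labels, together with a lift of [T] to the complex and a
homotopy; [T] is [K] at a stage of the construction, and a disc while attaching a
cell. *)
Record approx (T : Type) := Approx {
  ap_cx : set (set cvert);
  ap_map : (cvert -> R) -> X;
  ap_lab : cvert -> 'I_k;
  ap_pt : T -> cvert -> R;
  ap_hom : T -> R -> X }.

(** The homotopy of stage [n] is constant up to this time, which is halved from each
dimension to the next as in [attach_cell]. *)
Definition newborn n : R := 2^-1 ^+ n.

(** The conditions concern the points of the cells with dimension less than [n]. The
last one makes a base vertex go to a vertex of the complex under a constant
homotopy. *)
Record stage n (S : approx K) : Prop := Stage {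
  st_good : good U (ap_cx S) (ap_map S) (ap_lab S);
  st_dim : forall s v, ap_cx S s -> s v -> (vdim v < n)%N;
  st_plot : cellplot C n (ap_pt S);
  st_in : forall x, lower C n x -> in_cx (ap_cx S) (ap_pt S x);
  st_cont : cellcont C n (ap_hom S);
  st_hom0 : forall x t, lower C n x -> 0 <= t <= newborn n ->
    ap_hom S x t = ap_map S (ap_pt S x);
  st_hom1 : forall x, lower C n x -> ap_hom S x 1 = g x;
  st_vert : forall e (d : 'rV[R]_(cell_dim e)), (0 < n)%N -> cell_dim e = 0%N -> enorm d <= 1 ->
    ap_pt S (chi d) = vertex (cv e 0) /\
    forall t, 0 <= t <= 1 -> ap_hom S (chi d) t = g (chi d) }.

Record stage_ext n (S S' : approx K) : Prop := StageExt {
  se_cx : ap_cx S `<=` ap_cx S';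
  se_map : forall y, in_cx (ap_cx S) y -> ap_map S' y = ap_map S y;
  se_lab : forall v, (vdim v < n)%N -> ap_lab S' v = ap_lab S v;
  se_pt : forall x, lower C n x -> ap_pt S' x = ap_pt S x;
  se_hom : forall x, lower C n x -> ap_hom S' x = ap_hom S x }.

(** The outcome of attaching one cell of dimension [n]. By [at_new] a new simplex has a
vertex that belongs to this cell, and all its other vertices belong to it or to
cells with smaller dimension; hence the results for different cells can be united. *)
Record attached n (S : approx K) e (D : approx 'rV[R]_(cell_dim e)) : Prop := Attached {
  at_good : good U (ap_cx D) (ap_map D) (ap_lab D);
  at_cx : ap_cx S `<=` ap_cx D;
  at_map : forall y, in_cx (ap_cx S) y -> ap_map D y = ap_map S y;
  at_lab : forall v, (forall i, v <> cv e i) -> ap_lab D v = ap_lab S v;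
  at_new : forall s, ap_cx D s -> ap_cx S s \/ (exists i, s (cv e i)) /\
    (forall v, s v -> (exists i, v = cv e i) \/ (vdim v < n)%N);
  at_plot : forall (Z : topologicalType) (f : Z -> 'rV[R]_(cell_dim e)), continuous f ->
    (forall z, enorm (f z) <= 1) -> plot (fun z => ap_pt D (f z));
  at_in : forall d, enorm d <= 1 -> in_cx (ap_cx D) (ap_pt D d);
  at_edge : forall d, enorm d = 1 -> ap_pt D d = ap_pt S (chi d);
  at_cont : forall (Z : topologicalType) (f : Z -> 'rV[R]_(cell_dim e)) (t : Z -> R),
    continuous f -> (forall z, enorm (f z) <= 1) -> continuous t -> (forall z, 0 <= t z <= 1) ->
    continuous (fun z => ap_hom D (f z) (t z));
  at_hom0 : forall d t, enorm d <= 1 -> 0 <= t <= newborn n.+1 -> ap_hom D d t = ap_map D (ap_pt D d);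
  at_hom1 : forall d, enorm d <= 1 -> ap_hom D d 1 = g (chi d);
  at_hom_edge : forall d t, enorm d = 1 -> 0 <= t <= 1 -> ap_hom D d t = ap_hom S (chi d) t;
  at_vert : forall d, n = 0%N -> enorm d <= 1 -> ap_pt D d = vertex (cv e 0) /\
    forall t, 0 <= t <= 1 -> ap_hom D d t = g (chi d) }.

Lemma newborn_gt0 n : 0 < newborn n.
Proof. by rewrite exprn_gt0// invr_gt0 ltr0n. Qed.

Lemma newborn_le1 n : newborn n <= 1.
Proof. by rewrite exprn_ile1// ?invr_ge0 ?ler0n// invf_le1 ?ltr0n// ler1n. Qed.

Lemma newbornS n : newborn n.+1 = newborn n / 2.
Proof. by rewrite /newborn exprSr. Qed.

Lemma new_cell n S e : stage n S -> cell_dim e = n -> forall s, ap_cx S s ->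
  forall i, ~ s (cv e i).
Proof. by move=> St en s Ls i /(st_dim St Ls); rewrite /vdim /= en ltnn. Qed.

Lemma disc_dim0 e (d : 'rV[R]_(cell_dim e)) : cell_dim e = 0%N -> d = 0.
Proof. by move=> e0; apply/rowP => -[j j0]; exfalso; rewrite e0 in j0. Qed.

(** Dimension 0 is separate since the lift has to be a single vertex and the homotopy
constant. *)
Lemma attach_vertex S e : stage 0 S -> cell_dim e = 0%N ->
  exists D, @attached 0 S e D.
Proof.
move=> St e0; have gS := st_good St; have fresh := new_cell St e0.
pose p : X := g (@chi R K C e 0); pose v0 := cv e 0.
have [j _ Uj] : (\bigcup_j U j) p by rewrite covU.
have no s : ~ ap_cx S s.
  move=> Ls; have [_ [v sv] _] := good_cx gS Ls.
  by have := st_dim St Ls sv.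
have chE (d : 'rV[R]_(cell_dim e)) : chi d = @chi R K C e 0 by rewrite (disc_dim0 d e0).
have noedge (d : 'rV[R]_(cell_dim e)) : enorm d <> 1.
  by rewrite (disc_dim0 d e0) => /enorm_eq1; rewrite big1 => [/esym/eqP|i _]; rewrite ?oner_eq0// mxE expr0n.
exists (@Approx _ [set [set v0]] (fun=> p) (fun v => if v == v0 then j else ap_lab S v) (fun=> vertex v0) (fun _ _ => p)).
split => //=.
- split => //=.
  + move=> s ->; split; [exact: finite_set1 | by exists v0 |].
    move=> s' s'v [v s'v']; apply/seteqP; split => // w ->; rewrite -(s'v _ s'v').
    by [].
  + by move=> s _ Z q _ _ _; exact: cst_continuous.
  + move=> y v [_ sy] yv; suff -> : v = v0 by rewrite eqxx.
    by have : supp y v by [rewrite /supp /= gt_eqF]; rewrite sy.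
- by move=> s /no.
- by move=> y [_ /no].
- by move=> v nv; case: eqP => // /nv.
- move=> s ->; right; split; first by exists 0%N.
  by move=> v ->; left; exists 0%N.
- move=> Z f cf f1; split; first by move=> v; exact: contK.
  by exists [set v0]; [exact: finite_set1 | move=> z v; rewrite supp_vertex].
- move=> d _; exact: vertex_in.
- by move=> d /noedge.
- by move=> Z f t _ _ _ _; exact: cst_continuous.
- by move=> d _; rewrite chE.
- by move=> d t /noedge.
- by move=> d _ _; split => // t _; rewrite chE.
Qed.

Lemma attach_ball n S e : stage n S -> cell_dim e = n -> exists D, @attached n S e D.
Proof.
case: n => [|n] St en; first exact: attach_vertex.
have gS := st_good St; have low d : enorm d = 1 -> lower C n.+1 (@chi R K C e d).
  by rewrite -en; exact: lower_edge.
have cPhi (Z : topologicalType) (f : Z -> 'rV[R]_(cell_dim e)) : continuous f ->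
    (forall z, enorm (f z) <= 1) -> continuous (fun z => g (chi (f z))).
  by move=> cf f1; apply: (cont_comp cg); exact: cont_chi.
have pq (Z : topologicalType) (f : Z -> 'rV[R]_(cell_dim e)) : continuous f ->
    (forall z, enorm (f z) = 1) -> plot (fun z => ap_pt S (chi (f z))).
  by apply: edge_plot; rewrite en; exact: st_plot.
have qL d : enorm d = 1 -> in_cx (ap_cx S) (ap_pt S (@chi R K C e d)).
  by move=> /low; exact: st_in.
have ceta (Z : topologicalType) (f : Z -> 'rV[R]_(cell_dim e)) (t : Z -> R) :
    continuous f -> (forall z, enorm (f z) = 1) -> continuous t ->
    (forall z, 0 <= t z <= 1) -> continuous (fun z => ap_hom S (chi (f z)) (t z)).
  by apply: edge_cont; rewrite en; exact: st_cont.
have eta0 d t : enorm d = 1 -> 0 <= t <= newborn n.+1 ->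
    ap_hom S (@chi R K C e d) t = ap_map S (ap_pt S (chi d)).
  by move=> /low; exact: st_hom0.
have eta1 d : enorm d = 1 -> ap_hom S (@chi R K C e d) 1 = g (chi d).
  by move=> /low; exact: st_hom1.
have iota_inj : injective (cv e) by move=> i j [].
have [|d [m [F [lab [isb [psi net]]]]]] := cell_net_ex gS oU covU cPhi pq qL ceta
  (newborn_gt0 n.+1) (newborn_le1 n.+1) eta0 eta1; first by exists (cv e 0).
have [L' [r' [l' [s' [h' [g' [a1 a2 a3 a4] [b1 b2 b3] [c1 c2 c3 c4]]]]]]] :=
  attach_cell gS cPhi pq qL ceta (newborn_gt0 n.+1) (newborn_le1 n.+1) eta0 eta1 net
    iota_inj (new_cell St en).
exists (Approx L' r' l' s' h'); split => //=.
- move=> s /a4[Ls|[es sv]]; [by left | right; split => // v /sv[|[s0 Ls s0v]]; first by left].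
  by right; apply: (st_dim St Ls).
- by move=> Z f t cf f1 ct _; exact: c1.
- by move=> d' t d1 /andP[_ t1]; apply: c2 => //; rewrite -newbornS.
Qed.

(** All cells with dimension [n] are attached at once. *)
Section step.
Variables (n : nat) (S : approx K).
Hypothesis St : stage n S.
Variable D : forall e, approx 'rV[R]_(cell_dim e).
Hypothesis aD : forall e, cell_dim e = n -> attached n S (D e).

Lemma new_uniq e e' s : cell_dim e = n -> cell_dim e' = n -> ap_cx (D e) s ->
  ap_cx (D e') s -> ~ ap_cx S s -> e = e'.
Proof.
move=> en en' /(at_new (aD en))[//|[_ sv]] /(at_new (aD en'))[//|[[i si] _]] _.
by have [[j []]|] := sv _ si; [|rewrite /vdim /= en' ltnn].
Qed.

Definition step_cx : set (set cvert) := fun s =>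
  ap_cx S s \/ exists e, cell_dim e = n /\ ap_cx (D e) s.

Definition step_map (y : cvert -> R) : X :=
  if pselect (in_cx (ap_cx S) y) then ap_map S y else
  if pselect (exists e, cell_dim e = n /\ in_cx (ap_cx (D e)) y) is left ex
  then ap_map (D (sval (cid ex))) y else point.

Definition step_lab (v : cvert) : 'I_k :=
  if vdim v == n then ap_lab (D (v.1 : cell C)) v else ap_lab S v.

Lemma step_mapS (y : cvert -> R) : in_cx (ap_cx S) y -> step_map y = ap_map S y.
Proof. by move=> yS; rewrite /step_map; case: pselect. Qed.

Lemma step_mapD e (y : cvert -> R) : cell_dim e = n -> in_cx (ap_cx (D e)) y -> step_map y = ap_map (D e) y.
Proof.
move=> en yD; rewrite /step_map; case: pselect => [yS|nS].
  by rewrite (at_map (aD en)).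
case: pselect => [ex|[]]; last by exists e.
case: (cid ex) => e' /= [en' yD'].
rewrite (new_uniq en en' yD.2 yD'.2)// => Ly.
by apply: nS; split => //; exact: yD.1.
Qed.

Lemma step_inS (y : cvert -> R) : in_cx (ap_cx S) y -> in_cx step_cx y.
Proof. by move=> [y0 Ly]; split => //; left. Qed.

Lemma step_inD e (y : cvert -> R) : cell_dim e = n -> in_cx (ap_cx (D e)) y -> in_cx step_cx y.
Proof. by move=> en [y0 Ly]; split => //; right; exists e. Qed.

Lemma step_in_case (y : cvert -> R) : in_cx step_cx y -> in_cx (ap_cx S) y \/
  exists e, cell_dim e = n /\ in_cx (ap_cx (D e)) y.
Proof. by move=> [y0 [Ly|[e [en Ly]]]]; [left | right; exists e]. Qed.

Lemma step_lab_old v : (vdim v < n)%N -> step_lab v = ap_lab S v.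
Proof. by move=> vn; rewrite /step_lab ltn_eqF. Qed.

Lemma step_labD e s v : cell_dim e = n -> ap_cx (D e) s -> s v -> step_lab v = ap_lab (D e) v.
Proof.
move=> en Ls sv.
have old : (vdim v < n)%N -> step_lab v = ap_lab (D e) v.
  move=> vn; rewrite step_lab_old// (at_lab (aD en))// => i E.
  by move: vn; rewrite E /vdim /= en ltnn.
have [Ls'|[_ /(_ _ sv)[[i ->]|//]]] := at_new (aD en) Ls.
  exact: old (st_dim St Ls' sv).
by rewrite /step_lab ifT//; apply/eqP.
Qed.

Lemma step_good : good U step_cx step_map step_lab.
Proof.
have gS := st_good St.
split.
- move=> s [/(good_cx gS)[fs ns ss]|[e [en Ls]]].
    by split => // s' s's s'n; left; exact: ss.
  have [fs ns ss] := good_cx (at_good (aD en)) Ls.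
  by split => // s' s's s'n; right; exists e; split => //; exact: ss.
- move=> s Ls Z p cp pL ps.
  have sub L : cx L -> L s -> forall z, in_cx L (p z).
    move=> cL Ls' z; have [p0 pz] := pL z; split => //.
    have [_ _] := cL _ Ls'; apply; first exact: ps.
    case: pz => [/(good_cx gS)[]//|[e [en]]].
    by move=> /(good_cx (at_good (aD en)))[].
  case: Ls => [Ls|[e [en Ls]]].
    under eq_fun do rewrite (step_mapS (sub _ (good_cx gS) Ls _)).
    by apply: (good_cont gS Ls) => //; exact: sub (good_cx gS) Ls.
  have gD := at_good (aD en).
  under eq_fun do rewrite (step_mapD en (sub _ (good_cx gD) Ls _)).
  by apply: (good_cont gD Ls) => //; exact: sub (good_cx gD) Ls.
- have sc L c y : 0 < c -> in_cx L y -> in_cx L (fun v : cvert => c * y v : R).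
    move=> c0 [y0 Ly]; split; first by move=> v; rewrite mulr_ge0// ltW.
    rewrite (_ : supp _ = supp y)//; apply/seteqP; split => v; rewrite /supp /= mulf_eq0 negb_or.
      by move=> /andP[].
    by move=> ->; rewrite gt_eqF.
  move=> c y c0 /step_in_case[yS|[e [en yD]]].
    by rewrite !step_mapS ?(good_scale gS)//; exact: sc.
  by rewrite !(step_mapD en) ?(good_scale (at_good (aD en)))//; exact: sc.
- move=> y v /step_in_case[yS|[e [en yD]]] yv.
    have sv : supp y v by rewrite /supp /= gt_eqF.
    rewrite step_mapS// step_lab_old; first exact: (good_lab gS).
    exact: (st_dim St yS.2).
  have sv : supp y v by rewrite /supp /= gt_eqF.
  rewrite (step_mapD en)// (step_labD en yD.2)//.
  exact: (good_lab (at_good (aD en))).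
Qed.

(** The values on the cells with dimension [n] extend those on lower cells, provided that
they agree on the boundary. *)
Lemma step_rec (W : Type) (F : forall e, 'rV[R]_(cell_dim e) -> W) (F0 : K -> W) :
  (forall e d, cell_dim e = n -> enorm d = 1 -> F e d = F0 (chi d)) ->
  exists phi : K -> W, (forall x, lower C n x -> phi x = F0 x) /\
    forall e d, cell_dim e = n -> enorm d <= 1 -> phi (chi d) = F e d.
Proof.
move=> edge.
have [phi hphi] := cell_rec (fun e (d : 'rV[R]_(cell_dim e)) =>
  if cell_dim e == n then F e d else F0 (chi d)).
have old x : lower C n x -> phi x = F0 x.
  by move=> [e [d [en d1 <-]]]; rewrite hphi// ltn_eqF.
exists phi; split => // e d en; rewrite le_eqVlt => /orP[/eqP d1|d1]; last by rewrite hphi// ifT//; apply/eqP.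
by rewrite old ?edge// -en; exact: lower_edge.
Qed.

Lemma stage_step : exists S', stage n.+1 S' /\ stage_ext n S S'.
Proof.
have [|pt [ptS ptD]] := @step_rec _ (fun e => ap_pt (D e)) (ap_pt S).
  by move=> e d en d1; rewrite (at_edge (aD en)).
have [|hm [hmS hmD]] := @step_rec _ (fun e d t => ap_hom (D e) d (val (toI t)))
    (fun x t => ap_hom S x (val (toI t))).
  by move=> e d en d1; apply/funext => t; rewrite (at_hom_edge (aD en))//; exact: unitIP.
pose h x t := if pselect (lower C n x) then ap_hom S x t else hm x t.
have hS x : lower C n x -> h x = ap_hom S x.
  by move=> xn; apply/funext => t; rewrite /h; case: pselect.
have hD e d t : cell_dim e = n -> enorm d <= 1 -> 0 <= t <= 1 -> h (chi d) t = ap_hom (D e) d t.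
  move=> en d1 t01; rewrite /h; case: pselect => [xn|nx]; last by rewrite hmD// val_toI.
  have E := hmD _ _ en d1; rewrite (hmS _ xn) in E.
  by have := congr1 (fun F : R -> X => F t) E; rewrite /= val_toI.
have dimS e : (cell_dim e < n.+1)%N -> (cell_dim e < n)%N \/ cell_dim e = n.
  by rewrite ltnS leq_eqVlt => /orP[/eqP|]; [right | left].
have lowS x : lower C n.+1 x -> lower C n x \/
    exists e (d : 'rV[R]_(cell_dim e)), [/\ cell_dim e = n, enorm d <= 1 & chi d = x].
  move=> [e [d [/dimS[en|en] d1 dx]]]; first by left; exists e, d.
  by right; exists e, d; split => //; exact: ltW.
exists (Approx step_cx step_map step_lab pt h); split; last first.
  split => //=.
  - by move=> s; left.
  - exact: step_mapS.
  - exact: step_lab_old.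
split => /=.
- exact: step_good.
- move=> s v [Ls /(st_dim St Ls)|[e [en Ls]] sv]; first exact: ltnW.
  have [Ls'|[_ /(_ _ sv)[[i ->]|]]] := at_new (aD en) Ls.
  + exact: ltnW (st_dim St Ls' sv).
  + by rewrite /vdim /= en.
  + exact: ltnW.
- move=> e /dimS[en|en] Z f cf f1.
    under eq_fun => z do rewrite (ptS _ (lower_chi en (f1 z))).
    exact: (st_plot St).
  under eq_fun do rewrite ptD//.
  exact: (at_plot (aD en)).
- move=> x /lowS[xn|[e [d [en d1 <-]]]].
    by rewrite ptS//; apply: step_inS; exact: (st_in St).
  by rewrite ptD//; apply: (step_inD en); exact: (at_in (aD en)).
- move=> e /dimS[en|en] Z f t cf f1 ct t01.
    under eq_fun => z do rewrite (hS _ (lower_chi en (f1 z))).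
    exact: (st_cont St).
  under eq_fun do rewrite hD//.
  exact: (at_cont (aD en)).
- move=> x t /lowS[xn|[e [d [en d1 <-]]]] /andP[t0 tn].
    rewrite hS// ptS// step_mapS; last exact: (st_in St).
    apply: (st_hom0 St) => //; rewrite t0 /= (le_trans tn)// newbornS.
    by have := newborn_gt0 n; lra.
  rewrite hD ?t0 ?(le_trans tn (newborn_le1 _))// ptD// (step_mapD en); last exact: (at_in (aD en)).
  by apply: (at_hom0 (aD en)) => //; rewrite t0.
- move=> x /lowS[xn|[e [d [en d1 <-]]]].
    by rewrite hS// (st_hom1 St).
  by rewrite hD ?ler01 ?lexx// (at_hom1 (aD en)).
- move=> e d _ e0 d1; have [n0|n0] := posnP n.
    have en : cell_dim e = n by rewrite e0 n0.
    have [p1 p2] := at_vert (aD en) n0 d1; rewrite ptD//; split => // t t01.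
    by rewrite hD// p2.
  have en : (cell_dim e < n)%N by rewrite e0.
  have low := lower_chi en d1; rewrite (ptS _ low) (hS _ low); exact: (st_vert St).
Qed.

End step.

Lemma stage_next n S : stage n S -> exists S', stage n.+1 S' /\ stage_ext n S S'.
Proof.
move=> St.
have ex e : exists D : approx 'rV[R]_(cell_dim e), cell_dim e = n -> attached n S D.
  have [en|ne] := pselect (cell_dim e = n); last first.
    by exists (Approx (ap_cx S) (ap_map S) (ap_lab S) (fun=> fun=> 0) (fun _ _ => point)).
  by have [D aD] := attach_ball St en; exists D.
exact: (stage_step St (D := fun e => sval (cid (ex e))) (fun e => svalP (cid (ex e)))).
Qed.

Lemma stage0 : exists S, stage 0 S.
Proof.
have [j _ _] : (\bigcup_j U j) point by rewrite covU.
exists (Approx set0 (fun=> point) (fun=> j) (fun=> fun=> 0) (fun _ _ => point)).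
have no x : ~ lower C 0 x by move=> [e [d []]].
split => //=; last by move=> x /no.
  by split => // y v [].
by move=> x /no.
Qed.

Lemma stages : exists S : nat -> approx K, forall n, stage n (S n) /\ stage_ext n (S n) (S n.+1).
Proof.
have [S0 St0] := stage0.
pose next n (S : {S | stage n S}) : {S' | stage n.+1 S' /\ stage_ext n (sval S) S'} :=
  cid (stage_next (svalP S)).
pose fix F n : {S | stage n S} :=
  if n is m.+1 then exist _ (sval (next m (F m))) (svalP (next m (F m))).1 else exist _ S0 St0.
exists (fun n => sval (F n)) => n; split; first exact: svalP.
exact: (svalP (next n (F n))).2.
Qed.

Lemma stages_le (S : nat -> approx K) :
  (forall n, stage n (S n) /\ stage_ext n (S n) (S n.+1)) ->
  forall m n, (m <= n)%N -> stage_ext m (S m) (S n).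
Proof.
move=> hS m; elim=> [|n ih].
  by rewrite leqn0 => /eqP ->; split.
rewrite leq_eqVlt => /orP[/eqP <-|]; first by split.
rewrite ltnS => mn; have [i1 i2 i3 i4 i5] := ih mn.
have [_ [j1 j2 j3 j4 j5]] := hS n.
split.
- by move=> s /i1; exact: j1.
- move=> y ym; rewrite j2 ?i2//; split; [exact: ym.1 | exact: i1 ym.2].
- by move=> v vm; rewrite j3 ?i3//; exact: leq_trans mn.
- by move=> x xm; rewrite j4 ?i4//; exact: lowerW xm.
- by move=> x xm; rewrite j5 ?i5//; exact: lowerW xm.
Qed.

(** The union of all stages: each point of [K] and each simplex belongs to a finite
stage, and stages do not change on what they have defined. *)
Theorem realisation_ex : exists (L : set (set cvert)) (r : (cvert -> R) -> X)
    (l : cvert -> 'I_k) (s : K -> cvert -> R) (h : K -> R -> X),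
  [/\ good U L r l,
   (forall n, cellplot C n s) /\ (forall x, in_cx L (s x)),
   forall n, cellcont C n h,
   (forall x, h x 0 = r (s x)) /\ (forall x, h x 1 = g x) &
   forall e (d : 'rV[R]_(cell_dim e)), cell_dim e = 0%N -> enorm d <= 1 ->
     s (chi d) = vertex (cv e 0) /\ forall t, 0 <= t <= 1 -> h (chi d) t = g (chi d)].
Proof.
have [S hS] := stages; have le := stages_le hS.
have St n := (hS n).1.
have cxle m n (y : cvert -> R) : (m <= n)%N -> in_cx (ap_cx (S m)) y -> in_cx (ap_cx (S n)) y.
  by move=> mn [y0 ym]; split => //; exact: se_cx (le _ _ mn) _ ym.
pose L s := exists n, ap_cx (S n) s.
have inL n (y : cvert -> R) : in_cx (ap_cx (S n)) y -> in_cx L y.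
  by move=> [y0 yn]; split => //; exists n.
have Lin (y : cvert -> R) : in_cx L y -> exists n, in_cx (ap_cx (S n)) y.
  by move=> [y0 [n yn]]; exists n.
have [r rE] : exists r : (cvert -> R) -> X, forall n y, in_cx (ap_cx (S n)) y -> r y = ap_map (S n) y.
  have ex (y : cvert -> R) : exists p, forall n, in_cx (ap_cx (S n)) y -> p = ap_map (S n) y.
    have [[n yn]|no] := pselect (exists n, in_cx (ap_cx (S n)) y); last first.
      by exists point => n yn; exfalso; apply: no; exists n.
    exists (ap_map (S n) y) => m ym; have [mn|/ltnW nm] := leqP m n.
      exact: (se_map (le _ _ mn)).
    by rewrite (se_map (le _ _ nm)).
  by have [r hr] := choice ex; exists r => n y; exact: hr.
pose l v := ap_lab (S (vdim v).+1) v.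
have lE n v : (vdim v < n)%N -> l v = ap_lab (S n) v.
  by move=> vn; rewrite (se_lab (le _ _ vn)).
have [s sE'] := cell_rec (fun e (d : 'rV[R]_(cell_dim e)) => ap_pt (S (cell_dim e).+1) (chi d)).
have sE n x : lower C n x -> s x = ap_pt (S n) x.
  move=> [e [d [en d1 <-]]]; rewrite sE'// (se_pt (le _ _ en))//.
  by exists e, d; split.
have [h hE'] := cell_rec (fun e (d : 'rV[R]_(cell_dim e)) => ap_hom (S (cell_dim e).+1) (chi d)).
have hE n x : lower C n x -> h x = ap_hom (S n) x.
  move=> [e [d [en d1 <-]]]; rewrite hE'// (se_hom (le _ _ en))//.
  by exists e, d; split.
have low x : exists n, lower C n x.
  by have [e [d [d1 <-]]] := @chi_ex R K C x; exists (cell_dim e).+1, e, d; split.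
exists L, r, l, s, h; split.
- split.
  + move=> c [n /(good_cx (st_good (St n)))[fc nc cc]]; split => // c' cc' nc'.
    by exists n; exact: cc.
  + move=> c [n cn] Z p cp pL ps.
    have pn z : in_cx (ap_cx (S n)) (p z).
      have [p0 [m pm]] := pL z; split => //.
      have [_ _] := good_cx (st_good (St n)) cn; apply; first exact: ps.
      by have [] := good_cx (st_good (St m)) pm.
    under eq_fun => z do rewrite (rE _ _ (pn z)).
    exact: (good_cont (st_good (St n)) cn).
  + move=> c y c0 /Lin[n yn]; rewrite (rE _ _ yn) -(good_scale (st_good (St n)) c0 yn).
    apply: rE; split; first by move=> v; rewrite mulr_ge0 ?yn.1// ltW.
    rewrite (_ : supp _ = supp y); first exact: yn.2.
    apply/seteqP; split => v; rewrite /supp /= mulf_eq0 negb_or; first by move=> /andP[].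
    by move=> ->; rewrite gt_eqF.
  + move=> y v /Lin[n yn] yv; rewrite (rE _ _ yn) (lE n); last first.
      by apply: (st_dim (St n) yn.2); rewrite /supp /= gt_eqF.
    exact: (good_lab (st_good (St n))).
- split => [n e en Z f cf f1|x].
    under eq_fun => z do rewrite (sE _ _ (lower_chi en (f1 z))).
    exact: (st_plot (St n)).
  have [n xn] := low x; rewrite (sE _ _ xn).
  exact: inL (st_in (St n) xn).
- move=> n e en Z f t cf f1 ct t01.
  under eq_fun => z do rewrite (hE _ _ (lower_chi en (f1 z))).
  exact: (st_cont (St n)).
- split=> x; have [n xn] := low x; rewrite (hE _ _ xn).
    rewrite (sE _ _ xn) (st_hom0 (St n))// ?lexx ?(ltW (newborn_gt0 n))//.
    by rewrite (rE n)//; exact: (st_in (St n)).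
  exact: (st_hom1 (St n)).
- move=> e d e0 d1; have en : (cell_dim e < 1)%N by rewrite e0.
  have xn := lower_chi en d1; rewrite (sE _ _ xn) (hE _ _ xn).
  exact: (st_vert (St 1)).
Qed.

End realisation.

(** * Path components *)

Section paths.
Context {R : realType} {Y : topologicalType}.

Lemma joined_of (x y : Y) (c : R -> Y) :
  (forall (Z : topologicalType) (t : Z -> R), continuous t -> (forall z, 0 <= t z <= 1) ->
    continuous (fun z => c (t z))) -> c 0 = x -> c 1 = y -> joined (R := R) x y.
Proof.
move=> cc c0 c1; exists (fun u => c (val u)) => //.
by apply: cc; [exact: initial_continuous | exact: unitIP].
Qed.

Lemma path_ext (c : unitI R -> Y) : continuous c -> forall (Z : topologicalType) (t : Z -> R),
  continuous t -> (forall z, 0 <= t z <= 1) -> continuous (fun z => c (toI (t z))).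
Proof. by move=> cc Z t ct t01; apply: (cont_comp cc); exact: cont_toI. Qed.

Lemma joined_sym (x y : Y) : joined (R := R) x y -> joined (R := R) y x.
Proof.
move=> [c cc [<- <-]]; apply: (@joined_of _ _ (fun t => c (toI (1 - t)))).
- move=> Z t ct t01; apply: (path_ext cc (t := fun z => 1 - t z)).
    by apply: contD; [exact: contK | exact: contN].
  by move=> z; have /andP[? ?] := t01 z; rewrite subr_ge0 gerBl; apply/andP.
- by rewrite subr0 toI1.
- by rewrite subrr toI0.
Qed.

Lemma joined_trans (x y z : Y) : joined (R := R) x y -> joined (R := R) y z ->
  joined (R := R) x z.
Proof.
move=> [c cc [<- <-]] [d cd [d0 <-]].
apply: (@joined_of _ _ (fun t => if t <= 2^-1 then c (toI (2 * t)) else d (toI (2 * t - 1)))).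
- have e2 : 2 * 2^-1 = 1 :> R by field.
  move=> Z t ct t01; apply: (glue_le (c := t) (d := fun=> 2^-1)) => //; first exact: contK.
  + move=> W j cj h; under eq_fun do rewrite h.
    apply: (path_ext cc (t := fun w => 2 * t (j w))).
      by apply: contM; [exact: contK | exact: (cont_comp ct cj)].
    by move=> w; have := h w; have := t01 (j w); lra.
  + move=> W j cj h.
    rewrite (_ : (fun _ => _) = fun w => d (toI (2 * t (j w) - 1))).
      apply: (path_ext cd (t := fun w => 2 * t (j w) - 1)).
        apply: contD; last exact: contK.
        by apply: contM; [exact: contK | exact: (cont_comp ct cj)].
      by move=> w; have := h w; have := t01 (j w); lra.
    apply/funext => w; case: ifPn => // e.
    have -> : t (j w) = 2^-1 by apply/le_anti; rewrite e h.
    by rewrite e2 subrr toI1 toI0 d0.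
- by rewrite mulr0 toI0 ifT// invr_ge0 ler0n.
- rewrite ifF; first by rewrite mulr1 (_ : 2 - 1 = 1 :> R) ?toI1//; ring.
  by apply/negbTE; rewrite -ltNge invf_lt1 ?ltr0n// ltr1n.
Qed.

End paths.

Section path_components.
Context {R : realType}.

Lemma joined_chi (K : topologicalType) (C : cw_structure R K) (e : cell C) (d : 'rV[R]_(cell_dim e)) :
  enorm d <= 1 -> @joined R K (chi d) (@chi R K C e 0).
Proof.
move=> d1; apply: (@joined_of R K _ _ (fun t => chi ((1 - t) *: d))).
- move=> Z t ct t01; apply: cont_chi.
    apply: contvZ; last exact: cst_continuous.
    by apply: contD; [exact: contK | exact: contN].
  move=> z; have /andP[t0 t1] := t01 z.
  by rewrite enormZ ?subr_ge0// (le_trans _ d1)// ler_piMl ?enorm_ge0// gerBl.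
- by rewrite subr0 scale1r.
- by rewrite subrr scale0r.
Qed.

(** Every point of a closed cell is joined to its centre, so the preimage of a union of
path components in a disc is empty or the whole disc. *)
Lemma component_closed (K : topologicalType) (C : cw_structure R K) (P : set K) :
  (forall x y, joined (R := R) x y -> P x -> P y) -> closed P.
Proof.
move=> hP; apply: (cw_weak_topology (c := C)) => e.
have eqP0 (u : disc R (cell_dim e)) : P (char_map u) <-> P (@chi R K C e 0).
  have j : joined (R := R) (char_map u) (@chi R K C e 0).
    rewrite -[u]toD_val; apply: joined_chi; rewrite enorm_le1; exact: set_mem (valP u).
  by split; apply: hP => //; exact: joined_sym.
have [P0|nP] := pselect (P (@chi R K C e 0)).
  rewrite (_ : _ @^-1` P = setT); first exact: closedT.
  by apply/seteqP; split => // u _; apply/eqP0.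
rewrite (_ : _ @^-1` P = set0); first exact: closed0.
by apply/seteqP; split => // u /= /eqP0.
Qed.

(** The path component of the base point of the CW complex is open and closed. Its
preimage in [X] is therefore all of [X], and paths come back by the inverse
equivalence. *)
Lemma cw_path_connected (X : ptopologicalType) : connected [set: X] ->
  has_cw_type R X -> path_connected R X.
Proof.
move=> conX [K [C _] [a' [b' [ba _]]]].
have [a aE] : exists a, hpi R a = a' by exists (repr a'); exact: hpi_repr.
have [b bE] : exists b, hpi R b = b' by exists (repr b'); exact: hpi_repr.
have : hpi R (bcomp b a) = hpi R (bid X) by rewrite -hcompE aE bE.
move=> /hpiP[H [cH H0 H1 Hp]].
pose P := [set y : K | joined (R := R) y point].
have Pj x y : joined (R := R) x y -> P x -> P y.
  by move=> xy; exact: joined_trans (joined_sym xy).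
have clP := component_closed C Pj.
have opP : open P.
  rewrite -closedC; apply: (component_closed C) => x y xy nx Py.
  by apply: nx; exact: joined_trans xy Py.
have all : a @^-1` P = [set: X].
  apply: conX.
  - exists point; exists (fun=> point); first exact: cst_continuous.
    by rewrite map_point.
  - exists (a @^-1` P); last by rewrite setTI.
    by apply: open_comp => // x _; exact: cts_fun.
  - exists (a @^-1` P); last by rewrite setTI.
    by apply: preimage_closed => // x _; exact: cts_fun.
move=> x.
apply: (@joined_trans R X _ (b (a x))).
  apply: joined_sym; exists (fun t => H (x, t)).
    by apply: (cont_comp cH); apply: pair_continuous; [exact: cst_continuous | move=> t; exact: cvg_id].
  by rewrite H0 H1.
have [c cc [c0 c1]] : P (a x) by have : (a @^-1` P) x by rewrite all.
exists (fun t => b (c t)); first by apply: cont_comp cc; exact: cts_fun.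
by rewrite c0 c1 map_point.
Qed.

End path_components.

(** * The composite is null *)

Section composites.
Context {R : realType} {X : ptopologicalType}.

Definition composite (fs : seq (basedMap X X)) : basedMap X X :=
  foldr (fun f g => bcomp f g) (bid X) fs.

Lemma compositeE fs x : composite fs x = foldr (fun (f : basedMap X X) x => f x) x fs.
Proof. by elim: fs => //= f fs <-. Qed.

Lemma cellwise_continuous (K Y : topologicalType) (C : cw_structure R K) (u : K -> R -> Y) :
  (forall n, cellcont C n u) -> continuous (fun p : K * unitI R => u p.1 (val p.2)).
Proof.
move=> cu.
apply: (@final_prod_continuous K (unitI R) Y (cell C) (fun e => disc R (cell_dim e))
  (fun e => @char_map R K C e)).
- exact: compact_unitI.
- exact: regular_unitI.
- exact: (cw_weak_topology (c := C)).
- by move=> x; have [e [d [_ <-]]] := @chi_ex R K C x; exists e, (toD d).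
- move=> e /=.
  rewrite (_ : (fun _ => _) = fun p : disc R (cell_dim e) * unitI R =>
     u (chi (val p.1)) (val p.2)); last by apply/funext => p; rewrite /chi toD_val.
  apply: (cu (cell_dim e).+1) => //.
  + by apply: (cont_comp (@initial_continuous _ _ _)) => p; exact: cvg_fst.
  + by move=> p; rewrite enorm_le1; exact: set_mem (valP p.1).
  + by apply: (cont_comp (@initial_continuous _ _ _)) => p; exact: cvg_snd.
  + by move=> p; exact: unitIP.
Qed.

(** With [b : K -> X] a homotopy equivalence from a CW complex, [F \o b] is homotopic to
[F \o r \o s], where [F \o r] is null on the complex over the cover, and null by a
homotopy that fixes the vertex under the base point. *)
Lemma composite_null (k : nat) (fs : seq (basedMap X X)) :
  connected [set: X] -> has_cw_type R X -> categorical_cover R X k ->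
  (forall f, List.In f fs -> Z_Sigma R X (hpi R f)) -> (k <= 2 ^ size fs)%N ->
  hpi R (composite fs) = hzero R X X.
Proof.
move=> conX cwX [U [hU covU]] Zfs kfs.
have pX := cw_path_connected conX cwX.
have [K [C [e0 [e00 pe0]]] [a' [b' [ba _]]]] := cwX.
have [a aE] : exists a, hpi R a = a' by exists (repr a'); exact: hpi_repr.
have [b bE] : exists b, hpi R b = b' by exists (repr b'); exact: hpi_repr.
have cb : continuous b by exact: cts_fun.
have [d0 d01 pE] := (open_cell_chi e0 point).1 pe0.
have [L [r [l [s [h [gL [ps sL] ch [h0 h1] hv]]]]]] :=
  realisation_ex C (fun j => (hU j).1) covU cb.
have [sv hpt] := hv e0 d0 e00 (ltW d01); rewrite pE in sv hpt.
set F := composite fs; have cF : continuous F by exact: cts_fun.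
have labT : fhom L (fun y => F (r y)) (fun=> point).
  have := null_on_labels gL pX (fun j => (hU j).2) Zfs (J := [set: 'I_k]%SET).
  rewrite cardsT card_ord => /(_ kfs).
  rewrite (_ : (fun y => foldr _ _ _) = fun y => F (r y)); last first.
    by apply/funext => y; rewrite compositeE.
  apply: fhom_subcx => c Lc; split => // v _ /=; exact: finset.in_setT.
have cLv : L [set cv e0 0] by rewrite -(@supp_vertex R) -sv; exact: (sL point).2.
have cFr : fcont L (fun y => F (r y)).
  by move=> Z p pp pL; apply: (cont_comp cF); exact: (good_fcont gL).
have Fv : F (r (vertex (cv e0 0))) = point.
  by rewrite -sv -h0 hpt ?lexx ?ler01// !map_point.
have [H [cH H0 H1 Hv]] := fhom_based (good_cx gL) cFr cLv Fv labT.
have c1 n : cellcont C n (fun x t => F (h x (1 - t))).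
  move=> e en Z f t cf f1 ct t01; apply: (cont_comp cF).
  apply: (ch n e en Z f (fun z => 1 - t z)) => //.
    by apply: contD; [exact: contK | exact: contN].
  by move=> z; have := t01 z; lra.
have c2 n : cellcont C n (fun x t => H (s x) t).
  by move=> e en Z f t cf f1 ct t01; apply: cH => //; exact: (ps n).
have C1 := cellwise_continuous c1; have C2 := cellwise_continuous c2.
have cm : continuous (fun x => H (s x) 0).
  apply: (cont_comp (f := fun x => (x, I0 : unitI R)) C2).
  by apply: pair_continuous; [move=> x; exact: cvg_id | exact: cst_continuous].
have [|m mE] := based_ex cm; first by rewrite sv Hv// lexx ler01.
have Fb : hpi R (bcomp F b) = hzero R K X.
  transitivity (hpi R m); apply/hpiP.
    exists (fun p => F (h p.1 (1 - val p.2))); split.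
    - exact: C1.
    - by move=> x /=; rewrite subr0 h1.
    - by move=> x /=; rewrite subrr mE H0// h0.
    - move=> t /=; rewrite hpt ?map_point//.
      by have /andP[? ?] := unitIP t; rewrite subr_ge0 gerBl; apply/andP.
  exists (fun p => H (s p.1) (val p.2)); split.
  - exact: C2.
  - by move=> x /=; rewrite mE.
  - by move=> x /=; rewrite H1.
  - by move=> t /=; rewrite sv Hv//; exact: unitIP.
by rewrite -(hcomph1 (hpi R F)) -ba -bE hcompA hcompE Fb hcomp0h.
Qed.

End composites.

(** * Category, logarithm and nilpotency *)

Section numerics.
Context {R : realType}.

Lemma least_nat_attained (P : set nat) : least_nat R P \is a fin_num ->
  exists2 m, P m & least_nat R P = m%:R%:E.
Proof.
move=> fP; have [n Pn] : P !=set0.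
  apply/set0P; apply: contraTneq fP => ->.
  by rewrite /least_nat image_set0 ereal_inf0.
have ex : exists n, `[< P n >] by exists n; apply/asboolP.
have [m /asboolP Pm min] := ex_minnP ex.
exists m => //; apply/le_anti/andP; split; first by apply: ereal_inf_lbound; exists m.
apply: le_ereal_inf_tmp => _ [i Pi <-].
by rewrite lee_fin ler_nat; apply: min; apply/asboolP.
Qed.

Lemma least_nat_le (P : set nat) n : P n -> (least_nat R P <= n%:R%:E)%E.
Proof. by move=> Pn; apply: ereal_inf_lbound; exists n. Qed.

Lemma log2_le (k n : nat) : (0 < k)%N -> log2 (k%:R : R) <= n%:R -> (k <= 2 ^ n)%N.
Proof.
move=> k0; rewrite /log2 ler_pdivrMr ?ln_gt0 ?ltr1n// mulr_natl -lnXn ?ltr0n//.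
by rewrite ler_ln ?posrE ?exprn_gt0 ?ltr0n// -natrX ler_nat.
Qed.

Lemma log2_ge0 (k : nat) : (0 < k)%N -> 0 <= log2 (k%:R : R).
Proof. by move=> k0; rewrite /log2 divr_ge0// ln_ge0 ?ler1n. Qed.

End numerics.

Section products.
Context {R : realType} {X : ptopologicalType}.
Hypotheses (conX : connected [set: X]) (cwX : has_cw_type R X).

Lemma big_hcomp_composite (I : Type) (s : seq I) (f : I -> hclass R X X) :
  \big[@hcomp R X X X/hid R X]_(i <- s) f i = hpi R (composite [seq repr (f i) | i <- s]).
Proof.
elim: s => [|i s ih]; first by rewrite big_nil.
by rewrite big_cons ih /= -hcompE hpi_repr.
Qed.

Lemma product_null (k n : nat) (f : 'I_n -> hclass R X X) : categorical_cover R X k ->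
  (forall i, Z_Sigma R X (f i)) -> (k <= 2 ^ n)%N ->
  \big[@hcomp R X X X/hid R X]_(i < n) f i = hzero R X X.
Proof.
move=> ck Zf kn; rewrite big_hcomp_composite; apply: (composite_null (k := k)) => //; last first.
  by rewrite size_map [index_enum _]unlock -enumT size_enum_ord.
by elim: (index_enum _) => //= i s ih g [<-|/ih//]; rewrite hpi_repr.
Qed.

Lemma cover_pos k : categorical_cover R X k -> (0 < k)%N.
Proof.
move=> [U [_ covU]]; have [j _ _] : (\bigcup_i U i) point by rewrite covU.
exact: leq_ltn_trans (ltn_ord j).
Qed.

End products.

Theorem proposition2p5 (R : realType) (X : ptopologicalType)
  (X_connected : connected [set: X])
  (X_cw : has_cw_type R X)
  (X_cat : lscat R X \is a fin_num) :
  (forall (n : nat) (f : 'I_n -> hclass R X X),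
     log2 (fine (lscat R X)) <= n%:R ->
     (forall i, Z_Sigma R X (f i)) ->
     \big[@hcomp R X X X/hid R X]_(i < n) f i = hzero R X X) /\
  (t_Sigma R X <= (Num.ceil (log2 (fine (lscat R X))))%:~R%:E)%E.
Proof.
have [k ck E] := least_nat_attained X_cat.
rewrite (E : lscat R X = k%:R%:E) /=.
have k0 := cover_pos ck.
have null n (f : 'I_n -> hclass R X X) : log2 (k%:R : R) <= n%:R ->
    (forall i, Z_Sigma R X (f i)) -> \big[@hcomp R X X X/hid R X]_(i < n) f i = hzero R X X.
  by move=> kn Zf; exact: (product_null X_connected X_cw ck Zf (log2_le k0 kn)).
split=> //.
have c0 : 0 <= Num.ceil (log2 (k%:R : R)) by rewrite ceil_ge0 (lt_le_trans _ (log2_ge0 k0)).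
have cge := ceil_ge (log2 (k%:R : R)).
rewrite /t_Sigma; case: asboolP => [_|ncX]; first by rewrite lee_fin ler0z.
move: cge c0; case: (Num.ceil _) => // -[|m] cge _.
  (* for ceiling 0 the empty product shows that the identity is null *)
  exfalso; apply: ncX.
  have := null 0%N (fun=> hzero R X X) cge; rewrite big_ord0; apply=> i.
  exact: Z_Sigma0.
apply: least_nat_le; exists m => // x Zx.
rewrite big_change_idx.
have := null m.+1 (fun i => x i) cge (fun i => Zx i).
by rewrite big_ord_recr.
Qed.
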